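(* Let $\Sigma$ be a topological surface of genus zero with $n\geq0$ punctures. Let $\rho:\pi_1\Sigma\to\mathrm{GL}_2(\mathbb{C})$ be a semisimple representation such that for every pair of pants $P\subset\Sigma$, the restriction of $\rho$ to (the image in $\pi_1\Sigma$ of) $\pi_1P$ has finite image. Then the image of $\rho$ is finite.
   Context: A pair of pants on a surface $\Sigma$ is a subsurface of genus zero with three boundary curves. *)

(* Defs.v *)
From HB Require Import structures.
From mathcomp Require Import all_boot all_order all_algebra.
From mathcomp Require Import generic_quotient complex lra.
From mathcomp Require Import all_classical all_reals topology normedtype.

Set Implicit Arguments.
Unset Strict Implicit.
Unset Printing Implicit Defensive.

Import Order.TTheory GRing.Theory Num.Theory.
Import numFieldNormedType.Exports.

Local Open Scope classical_set_scope.
Local Open Scope ring_scope.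
Local Open Scope quotient_scope.

Definition homeomorphic (X Y : topologicalType) : Prop :=
  exists (f : X -> Y) (g : Y -> X),
    [/\ continuous f, continuous g, cancel f g & cancel g f].

Section surfaces.
Variable R : realType.

Definition sphere2 : set (R * R * R) :=
  [set p | p.1.1 ^+ 2 + p.1.2 ^+ 2 + p.2 ^+ 2 = 1].

(* Sets are coerced to types, which carry the subspace topology. *)
Definition genus0_surface (n : nat) (T : topologicalType) : Prop :=
  exists F : set (R * R * R),
    [/\ F `<=` sphere2, (F #= `I_n)%card & homeomorphic T (sphere2 `\` F)].

(* The closed disc of radius 4 centred at the origin, minus the open discs of *)
(* radius 1 centred at (-2, 0) and (2, 0): this is the compact surface of     *)
(* genus zero with three boundary curves.                                     *)
Definition standard_pants : set (R * R) :=
  [set p | [/\ p.1 ^+ 2 + p.2 ^+ 2 <= 4 ^+ 2,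
               1 <= (p.1 + 2) ^+ 2 + p.2 ^+ 2 &
               1 <= (p.1 - 2) ^+ 2 + p.2 ^+ 2]].

(* The boundary curves of P may be inessential in T. *)
Definition pair_of_pants (T : topologicalType) (P : set T) : Prop :=
  homeomorphic P standard_pants.

End surfaces.

Section paths.
Variable R : realType.

Definition I01 : set R := `[0, 1]%classic.

Lemma I01E (t : R) : I01 t = (0 <= t /\ t <= 1).
Proof.
by rewrite /I01 /= in_itv /=; apply/propext; split=> [/andP[]|[-> ->]].
Qed.

(* Only the values of path_fun on [0, 1] matter. *)
Record cpath (T : topologicalType) (x y : T) := CPath {
  path_fun :> R -> T;
  path_cts : {within I01, continuous path_fun};
  path_at0 : path_fun 0 = x;
  path_at1 : path_fun 1 = y }.

HB.instance Definition _ T x y := gen_eqMixin (@cpath T x y).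
HB.instance Definition _ T x y := gen_choiceMixin (@cpath T x y).

Definition homotopic (T : topologicalType) (x y : T) (f g : cpath x y) : Prop :=
  exists H : R * R -> T,
    [/\ {within I01 `*` I01, continuous H},
        forall t, I01 t -> H (0, t) = f t,
        forall t, I01 t -> H (1, t) = g t,
        forall s, I01 s -> H (s, 0) = x &
        forall s, I01 s -> H (s, 1) = y].

Lemma within_comp (X Y Z : topologicalType) (A : set X) (B : set Y)
    (f : X -> Y) (g : Y -> Z) :
  {within A, continuous f} -> {within B, continuous g} ->
  (forall x, A x -> B (f x)) -> {within A, continuous (g \o f)}.
Proof.
move=> /subspace_continuousP cf /subspace_continuousP cg AB.
apply/subspace_continuousP => x Ax.
apply: (@cvg_trans _ (g @ within B (nbhs (f x)))); last exact: cg (AB _ Ax).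
move=> U /= gU; rewrite !nbhs_simpl /=.
have := cf x Ax _ gU.
rewrite /nbhs /= /within /=; apply: filterS => z /= zU Az.
by apply: zU => //; exact: AB.
Qed.

Lemma within_eq (X Y : topologicalType) (A : set X) (f g : X -> Y) :
  (forall x, A x -> f x = g x) ->
  {within A, continuous f} -> {within A, continuous g}.
Proof.
by move=> fg; apply: subspace_eq_continuous => x /set_mem /fg.
Qed.

Lemma cts_pair (X Y Z : topologicalType) (f : X -> Y) (g : X -> Z) :
  continuous f -> continuous g -> continuous (fun x => (f x, g x)).
Proof.
by move=> cf cg x; apply: (@cvg_pair _ _ _ _ (nbhs (f x)) (nbhs (g x)));
  [exact: cf|exact: cg].
Qed.

Lemma cts_fst (X Y : topologicalType) : continuous (@fst X Y).
Proof. by move=> p; exact: cvg_fst. Qed.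

Lemma cts_snd (X Y : topologicalType) : continuous (@snd X Y).
Proof. by move=> p; exact: cvg_snd. Qed.

Lemma cts_rev (X : topologicalType) (f : X -> R) :
  continuous f -> continuous (fun x => 1 - f x).
Proof. by move=> cf x; apply: cvgB; [exact: cvg_cst|exact: cf]. Qed.

Lemma cts_dbl (X : topologicalType) (f : X -> R) :
  continuous f -> continuous (fun x => 2 * f x).
Proof. by move=> cf x; apply: cvgM; [exact: cvg_cst|exact: cf]. Qed.

Lemma cts_dblB1 (X : topologicalType) (f : X -> R) :
  continuous f -> continuous (fun x => 2 * f x - 1).
Proof.
by move=> cf x; apply: cvgB; [exact: (cts_dbl cf)|exact: cvg_cst].
Qed.

Section homotopy.
Context {T : topologicalType}.
Implicit Types x y z : T.

Lemma homotopic_refl x y (f : cpath x y) : homotopic f f.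
Proof.
exists (fun p => f p.2); split=> //=.
- apply: (@within_comp _ _ _ _ I01 snd f); last by move=> p [].
    by apply: continuous_subspaceT; exact: cts_snd.
  exact: path_cts.
- by move=> s _; exact: path_at0.
- by move=> s _; exact: path_at1.
Qed.

Lemma homotopic_sym x y (f g : cpath x y) : homotopic f g -> homotopic g f.
Proof.
move=> [H [cH H0 H1 Hx Hy]]; exists (fun p => H (1 - p.1, p.2)).
have I1 s : I01 s -> I01 (1 - s) by rewrite !I01E => -[? ?]; split; lra.
split=> //=.
- apply: (@within_comp (R * R)%type (R * R)%type T _ (I01 `*` I01)
      (fun p : R * R => (1 - p.1, p.2)) H) => //.
    by apply: continuous_subspaceT; apply: cts_pair;
        [exact: (cts_rev (@cts_fst R R))|exact: cts_snd].
  by move=> [s t] [/= /I1].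
- by move=> t It; rewrite subr0 H1.
- by move=> t It; rewrite subrr H0.
- by move=> s /I1 /Hx.
- by move=> s /I1 /Hy.
Qed.

Lemma closed_half1 : closed [set p : R * R | p.1 <= 2^-1].
Proof.
have := @closed_comp _ _ (fst : R * R -> R) [set t : R | t <= 2^-1].
by apply; [move=> p _; exact: cts_fst|exact: closed_le].
Qed.

Lemma closed_half1' : closed [set p : R * R | 2^-1 <= p.1].
Proof.
have := @closed_comp _ _ (fst : R * R -> R) [set t : R | 2^-1 <= t].
by apply; [move=> p _; exact: cts_fst|exact: closed_ge].
Qed.

Lemma closed_half2 : closed [set p : R * R | p.2 <= 2^-1].
Proof.
have := @closed_comp _ _ (snd : R * R -> R) [set t : R | t <= 2^-1].
by apply; [move=> p _; exact: cts_snd|exact: closed_le].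
Qed.

Lemma closed_half2' : closed [set p : R * R | 2^-1 <= p.2].
Proof.
have := @closed_comp _ _ (snd : R * R -> R) [set t : R | 2^-1 <= t].
by apply; [move=> p _; exact: cts_snd|exact: closed_ge].
Qed.

Lemma I01_closed : closed I01.
Proof. exact: itv_closed. Qed.

Lemma square_closed : closed (I01 `*` I01).
Proof.
rewrite (_ : _ `*` _ = (fst @^-1` I01) `&` (snd @^-1` I01)) //.
apply: closedI; apply: closed_comp => //; try exact: I01_closed.
- by move=> p _; exact: cts_fst.
- by move=> p _; exact: cts_snd.
Qed.

Lemma paste_within (X : topologicalType) (A B C : set X) (f g : X -> T)
    (b : X -> bool) :
  closed A -> closed B -> C `<=` A `|` B ->
  (forall p, A p -> C p -> (if b p then f p else g p) = f p) ->
  (forall p, B p -> C p -> (if b p then f p else g p) = g p) ->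
  closed C ->
  {within C `&` A, continuous f} -> {within C `&` B, continuous g} ->
  {within C, continuous (fun p => if b p then f p else g p)}.
Proof.
move=> cA cB CAB bA bB cC cf cg.
rewrite (_ : C = (C `&` A) `|` (C `&` B)); last first.
  by rewrite -setIUr; apply/esym/setIidPl.
apply: withinU_continuous; try exact: closedI.
- by apply: within_eq cf => p [Cp Ap]; rewrite bA.
- by apply: within_eq cg => p [Cp Bp]; rewrite bB.
Qed.

Lemma homotopic_trans x y (f g h : cpath x y) :
  homotopic f g -> homotopic g h -> homotopic f h.
Proof.
move=> [H [cH H0 H1 Hx Hy]] [K [cK K0 K1 Kx Ky]].
exists (fun p => if p.1 <= 2^-1 then H (2 * p.1, p.2) else K (2 * p.1 - 1, p.2)).
split.
- apply: (@paste_within (R * R)%type _ _ (I01 `*` I01)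
    (fun p => H (2 * p.1, p.2)) (fun p => K (2 * p.1 - 1, p.2))
    (fun p => p.1 <= 2^-1) closed_half1 closed_half1').
  + by move=> [s t] _ /=; case: (leP s 2^-1) => [|/ltW]; [left|right].
  + by move=> [s t] /= ->.
  + move=> [s t] /= s2 [/= _ It]; case: ifP => // s2'.
    have -> : s = 2^-1 by lra.
    by rewrite divff ?subrr ?pnatr_eq0// H1// K0.
  + exact: square_closed.
  + apply: (@within_comp (R * R)%type (R * R)%type T _ (I01 `*` I01)
      (fun p : R * R => (2 * p.1, p.2)) H) => //.
      by apply: continuous_subspaceT; apply: cts_pair;
        [exact: (cts_dbl (@cts_fst R R))|exact: cts_snd].
    by move=> [s t] [[/=]]; rewrite !I01E => -[? ?] [? ?] ?;
      do 2!split=> //=; lra.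
  + apply: (@within_comp (R * R)%type (R * R)%type T _ (I01 `*` I01)
      (fun p : R * R => (2 * p.1 - 1, p.2)) K) => //.
      by apply: continuous_subspaceT; apply: cts_pair;
        [exact: (cts_dblB1 (@cts_fst R R))|exact: cts_snd].
    by move=> [s t] [[/=]]; rewrite !I01E => -[? ?] [? ?] ?;
      do 2!split=> //=; lra.
- by move=> t It /=; rewrite invr_ge0 ler0n mulr0 H0.
- move=> t It /=; rewrite ifF; last by apply/negbTE; rewrite -ltNge; lra.
  by rewrite (_ : 2 * 1 - 1 = 1 :> R) ?K1//; lra.
- move=> s; rewrite I01E => -[s0 s1] /=; case: ifPn => [s2|].
    by rewrite Hx// I01E; split; lra.
  by rewrite -ltNge => s2; rewrite Kx// I01E; split; lra.
- move=> s; rewrite I01E => -[s0 s1] /=; case: ifPn => [s2|].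
    by rewrite Hy// I01E; split; lra.
  by rewrite -ltNge => s2; rewrite Ky// I01E; split; lra.
Qed.

(* Two reparametrizations of the same path are homotopic, by a straight-line  *)
(* homotopy of the parameters.                                                *)
Lemma homotopic_reparam x y (f g : cpath x y) (p : R -> T) (u v : R -> R) :
  {within I01, continuous p} -> continuous u -> continuous v ->
  (forall t, I01 t -> I01 (u t)) -> (forall t, I01 t -> I01 (v t)) ->
  u 0 = v 0 -> u 1 = v 1 ->
  (forall t, I01 t -> f t = p (u t)) -> (forall t, I01 t -> g t = p (v t)) ->
  homotopic f g.
Proof.
move=> cp cu cv Iu Iv uv0 uv1 fE gE.
have I0 : I01 0 by rewrite I01E; split; lra.
have I1 : I01 1 by rewrite I01E; split; lra.
exists (fun q => p ((1 - q.1) * u q.2 + q.1 * v q.2)); split=> /=.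
- apply: (@within_comp _ _ _ _ I01
    (fun q : R * R => (1 - q.1) * u q.2 + q.1 * v q.2) p) => //.
    apply: continuous_subspaceT => q; apply: cvgD; apply: cvgM.
    + exact: (cts_rev (@cts_fst R R)).
    + by apply: (@continuous_comp _ _ _ snd u); [exact: cts_snd|exact: cu].
    + exact: cts_fst.
    + by apply: (@continuous_comp _ _ _ snd v); [exact: cts_snd|exact: cv].
  move=> [s t] [/= + /[dup] /Iu + /Iv]; rewrite !I01E => -[? ?] [? ?] [? ?].
  by split; nra.
- by move=> t It; rewrite subr0 mul1r mul0r addr0 fE.
- by move=> t It; rewrite subrr mul1r mul0r add0r gE.
- by move=> s _; rewrite -uv0 -mulrDl subrK mul1r -fE// path_at0.
- by move=> s _; rewrite -uv1 -mulrDl subrK mul1r -fE// path_at1.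
Qed.

Lemma path_cst_cts x : {within I01, continuous (cst x : R -> T)}.
Proof. by apply: continuous_subspaceT => t; exact: cvg_cst. Qed.

Definition path_cst x : cpath x x := CPath (@path_cst_cts x) erefl erefl.

Definition path_rev_fun x y (f : cpath x y) (t : R) : T := f (1 - t).

Lemma path_rev_cts x y (f : cpath x y) :
  {within I01, continuous (path_rev_fun f)}.
Proof.
rewrite /path_rev_fun.
apply: (@within_comp R R T _ I01 (fun t : R => 1 - t) f); last 1 first.
- by move=> t; rewrite !I01E => -[? ?]; split; lra.
- by apply: continuous_subspaceT; apply: (@cts_rev _ id) => t; exact: cvg_id.
- exact: path_cts.
Qed.

Lemma path_rev0 x y (f : cpath x y) : path_rev_fun f 0 = y.
Proof. by rewrite /path_rev_fun subr0 path_at1. Qed.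

Lemma path_rev1 x y (f : cpath x y) : path_rev_fun f 1 = x.
Proof. by rewrite /path_rev_fun subrr path_at0. Qed.

Definition path_rev x y (f : cpath x y) : cpath y x :=
  CPath (@path_rev_cts x y f) (path_rev0 f) (path_rev1 f).

Definition path_cat_fun x y z (f : cpath x y) (g : cpath y z) (t : R) : T :=
  if t <= 2^-1 then f (2 * t) else g (2 * t - 1).

Lemma path_cat_cts x y z (f : cpath x y) (g : cpath y z) :
  {within I01, continuous (path_cat_fun f g)}.
Proof.
rewrite /path_cat_fun; apply: (@paste_within R _ _ I01 (fun t => f (2 * t)) (fun t => g (2 * t - 1))
    (fun t => t <= 2^-1) (@closed_le R 2^-1) (@closed_ge R 2^-1)).
- by move=> t _ /=; case: (leP t 2^-1) => [|/ltW]; [left|right].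
- by move=> t /= ->.
- move=> t /= t2 It; case: ifP => // t2'.
  have -> : t = 2^-1 by lra.
  by rewrite divff ?subrr ?pnatr_eq0// path_at0 path_at1.
- exact: I01_closed.
- apply: (@within_comp R R T _ I01 (fun t : R => 2 * t) f).
  + by apply: continuous_subspaceT; apply: (@cts_dbl _ id) => t; exact: cvg_id.
  + exact: path_cts.
  + by move=> t [/=]; rewrite !I01E => -[? ?] ?; split; lra.
- apply: (@within_comp R R T _ I01 (fun t : R => 2 * t - 1) g).
  + by apply: continuous_subspaceT; apply: (@cts_dblB1 _ id) => t; exact: cvg_id.
  + exact: path_cts.
  + by move=> t [/=]; rewrite !I01E => -[? ?] ?; split; lra.
Qed.

Lemma path_cat0 x y z (f : cpath x y) (g : cpath y z) : path_cat_fun f g 0 = x.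
Proof. by rewrite /path_cat_fun invr_ge0 ler0n mulr0 path_at0. Qed.

Lemma path_cat1 x y z (f : cpath x y) (g : cpath y z) : path_cat_fun f g 1 = z.
Proof.
rewrite /path_cat_fun ifF; last by apply/negbTE; rewrite -ltNge; lra.
by rewrite (_ : 2 * 1 - 1 = 1 :> R) ?path_at1//; lra.
Qed.

Definition path_cat x y z (f : cpath x y) (g : cpath y z) : cpath x z :=
  CPath (@path_cat_cts x y z f g) (path_cat0 f g) (path_cat1 f g).

Lemma homotopic_rev x y (f g : cpath x y) :
  homotopic f g -> homotopic (path_rev f) (path_rev g).
Proof.
have I1 s : I01 s -> I01 (1 - s) by rewrite !I01E => -[? ?]; split; lra.
move=> [H [cH H0 H1 Hx Hy]]; exists (fun p => H (p.1, 1 - p.2)); split=> /=.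
- apply: (@within_comp (R * R)%type (R * R)%type T _ (I01 `*` I01)
      (fun p : R * R => (p.1, 1 - p.2)) H) => //.
    by apply: continuous_subspaceT; apply: cts_pair;
        [exact: cts_fst|exact: (cts_rev (@cts_snd R R))].
  by move=> [s t] [/= ? /I1].
- by move=> t /I1 /H0.
- by move=> t /I1 /H1.
- by move=> s /Hy; rewrite subr0.
- by move=> s /Hx; rewrite subrr.
Qed.

Lemma homotopic_cat x y z (f f' : cpath x y) (g g' : cpath y z) :
  homotopic f f' -> homotopic g g' ->
  homotopic (path_cat f g) (path_cat f' g').
Proof.
move=> [H [cH H0 H1 Hx Hy]] [K [cK K0 K1 Kx Ky]].
exists (fun p => if p.2 <= 2^-1 then H (p.1, 2 * p.2) else K (p.1, 2 * p.2 - 1)).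
split.
- apply: (@paste_within (R * R)%type _ _ (I01 `*` I01)
    (fun p => H (p.1, 2 * p.2)) (fun p => K (p.1, 2 * p.2 - 1))
    (fun p => p.2 <= 2^-1) closed_half2 closed_half2').
  + by move=> [s t] _ /=; case: (leP t 2^-1) => [|/ltW]; [left|right].
  + by move=> [s t] /= ->.
  + move=> [s t] /= s2 [/= Is It]; case: ifP => // s2'.
    have -> : t = 2^-1 by lra.
    by rewrite divff ?subrr ?pnatr_eq0// Hy// Kx.
  + exact: square_closed.
  + apply: (@within_comp (R * R)%type (R * R)%type T _ (I01 `*` I01)
      (fun p : R * R => (p.1, 2 * p.2)) H) => //.
      by apply: continuous_subspaceT; apply: cts_pair;
        [exact: cts_fst|exact: (cts_dbl (@cts_snd R R))].
    by move=> [s t] [[/=]]; rewrite !I01E => -[? ?] [? ?] ?;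
      do 2!split=> //=; lra.
  + apply: (@within_comp (R * R)%type (R * R)%type T _ (I01 `*` I01)
      (fun p : R * R => (p.1, 2 * p.2 - 1)) K) => //.
      by apply: continuous_subspaceT; apply: cts_pair;
        [exact: cts_fst|exact: (cts_dblB1 (@cts_snd R R))].
    by move=> [s t] [[/=]]; rewrite !I01E => -[? ?] [? ?] ?;
      do 2!split=> //=; lra.
- move=> t; rewrite I01E /= /path_cat_fun => -[t0 t1]; case: ifPn => [t2|].
    by rewrite H0// I01E; split; lra.
  by rewrite -ltNge => t2; rewrite K0// I01E; split; lra.
- move=> t; rewrite I01E /= /path_cat_fun => -[t0 t1]; case: ifPn => [t2|].
    by rewrite H1// I01E; split; lra.
  by rewrite -ltNge => t2; rewrite K1// I01E; split; lra.
- by move=> s Is /=; rewrite invr_ge0 ler0n mulr0 Hx.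
- move=> s Is /=; rewrite ifF; last by apply/negbTE; rewrite -ltNge; lra.
  by rewrite (_ : 2 * 1 - 1 = 1 :> R) ?Ky//; lra.
Qed.

Lemma affine_cts (a b : R) : continuous (fun t : R => a * t + b).
Proof.
move=> t; apply: cvgD; last exact: cvg_cst.
by apply: cvgM; [exact: cvg_cst|exact: cvg_id].
Qed.

Lemma homotopic_cat_cst_l x y (f : cpath x y) :
  homotopic (path_cat (path_cst x) f) f.
Proof.
apply: (homotopic_reparam (p := f)
  (u := (fun=> 0) \max (fun t => 2 * t + -1)) (v := id)) => //=.
- exact: path_cts.
- by move=> t; apply: continuous_max; [exact: cvg_cst|exact: affine_cts].
- by move=> t; exact: cvg_id.
- move=> t; rewrite !I01E => -[t0 t1].
  by rewrite le_max lexx ge_max ler01; split=> //; lra.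
- by rewrite max_l//; lra.
- by rewrite max_r; lra.
- move=> t; rewrite I01E => -[t0 t1]; rewrite /path_cat_fun.
  case: ifPn => [t2|]; first by rewrite max_l ?path_at0//; lra.
  by rewrite -ltNge => t2; rewrite max_r//; lra.
Qed.

Lemma homotopic_cat_cst_r x y (f : cpath x y) :
  homotopic (path_cat f (path_cst y)) f.
Proof.
apply: (homotopic_reparam (p := f)
  (u := (fun=> 1) \min (fun t => 2 * t + 0)) (v := id)) => //=.
- exact: path_cts.
- by move=> t; apply: continuous_min; [exact: cvg_cst|exact: affine_cts].
- by move=> t; exact: cvg_id.
- move=> t; rewrite !I01E => -[t0 t1].
  by rewrite ge_min lexx le_min ler01; split=> //; lra.
- by rewrite min_r; lra.
- by rewrite min_l; lra.
- move=> t; rewrite I01E => -[t0 t1]; rewrite /path_cat_fun.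
  case: ifPn => [t2|]; first by rewrite min_r ?addr0//; lra.
  by rewrite -ltNge => t2; rewrite min_l ?path_at1//; lra.
Qed.

Lemma homotopic_cat_rev_l x y (f : cpath x y) :
  homotopic (path_cat (path_rev f) f) (path_cst y).
Proof.
apply: (homotopic_reparam (p := f)
  (u := (fun t => 2 * t + -1) \max (fun t => -2 * t + 1)) (v := fun=> 1)) => //=.
- exact: path_cts.
- by move=> t; apply: continuous_max; exact: affine_cts.
- by move=> t; exact: cvg_cst.
- move=> t; rewrite !I01E => -[t0 t1].
  rewrite le_max ge_max; split; last by apply/andP; split; lra.
  by case: (leP t 2^-1) => ?; apply/orP; [right|left]; lra.
- by move=> t _; rewrite I01E; split; lra.
- by rewrite max_r; lra.
- by rewrite max_l; lra.
- move=> t; rewrite I01E => -[t0 t1]; rewrite /path_cat_fun /= /path_rev_fun.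
  case: ifPn => [t2|]; first by rewrite max_r; [congr (f _)|]; lra.
  by rewrite -ltNge => t2; rewrite max_l//; lra.
- by move=> t _; rewrite path_at1.
Qed.

Lemma homotopic_cat_rev_r x y (f : cpath x y) :
  homotopic (path_cat f (path_rev f)) (path_cst x).
Proof.
apply: (homotopic_reparam (p := f)
  (u := (fun t => 2 * t + 0) \min (fun t => -2 * t + 2)) (v := fun=> 0)) => //=.
- exact: path_cts.
- by move=> t; apply: continuous_min; exact: affine_cts.
- by move=> t; exact: cvg_cst.
- move=> t; rewrite !I01E => -[t0 t1].
  rewrite le_min ge_min; split; first by apply/andP; split; lra.
  by case: (leP t 2^-1) => ?; apply/orP; [left|right]; lra.
- by move=> t _; rewrite I01E; split; lra.
- by rewrite min_l; lra.
- by rewrite min_r; lra.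
- move=> t; rewrite I01E => -[t0 t1]; rewrite /path_cat_fun /= /path_rev_fun.
  case: ifPn => [t2|]; first by rewrite min_l ?addr0//; lra.
  by rewrite -ltNge => t2; rewrite min_r; [congr (f _)|]; lra.
- by move=> t _; rewrite path_at0.
Qed.

Lemma homotopic_catA x y z w (f : cpath x y) (g : cpath y z) (h : cpath z w) :
  homotopic (path_cat f (path_cat g h)) (path_cat (path_cat f g) h).
Proof.
apply: homotopic_sym.
apply: (homotopic_reparam (p := path_cat f (path_cat g h))
  (u := (fun t => 2 * t + 0) \min
        ((fun t => 1 * t + 4^-1) \min (fun t => 2^-1 * t + 2^-1)))
  (v := id)) => //=.
- exact: path_cat_cts.
- move=> t; apply: continuous_min; first exact: affine_cts.
  by apply: continuous_min; exact: affine_cts.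
- by move=> t; exact: cvg_id.
- move=> t; rewrite !I01E => -[t0 t1].
  rewrite !le_min !ge_min; split; first by apply/and3P; split; lra.
  by apply/or3P/Or33; lra.
- by rewrite min_l ?le_min ?mulr0 ?addr0//; apply/andP; split; lra.
- by rewrite min_r ?ge_min; [rewrite min_r; lra|apply/orP; right; lra].
- move=> t; rewrite I01E => -[t0 t1]; rewrite {1}/path_cat_fun /=.
  rewrite {1}/path_cat_fun; case: (leP t 2^-1) => t2.
    case: (leP (2 * t) 2^-1) => t4.
      rewrite min_l ?le_min; last by apply/andP; split; lra.
      by rewrite /path_cat_fun ifT; [congr (f _)|]; lra.
    rewrite min_r ?ge_min; last by apply/orP; left; lra.
    rewrite min_l; last lra.
    rewrite /path_cat_fun ifF /=; last by apply/negbTE; rewrite -ltNge; lra.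
    by rewrite /path_cat_fun ifT; [congr (g _)|]; lra.
  rewrite min_r ?ge_min; last by apply/orP; right; lra.
  rewrite min_r; last lra.
  rewrite /path_cat_fun ifF /=; last by apply/negbTE; rewrite -ltNge; lra.
  rewrite /path_cat_fun ifF; last by apply/negbTE; rewrite -ltNge; lra.
  by congr (h _); lra.
Qed.

Definition homotopicb x y : rel (cpath x y) := fun f g => `[< homotopic f g >].

Lemma homotopicb_equiv x y : equiv_class_of (@homotopicb x y).
Proof.
split.
- by move=> f; apply/asboolP/homotopic_refl.
- by move=> f g; apply/asboolP/asboolP; exact: homotopic_sym.
- move=> g f h /asboolP fg /asboolP gh; apply/asboolP.
  exact: homotopic_trans fg gh.
Qed.

Canonical homotopicb_equivRel x y := EquivRelPack (@homotopicb_equiv x y).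

End homotopy.

Definition pi1 (T : topologicalType) (x : T) : Type :=
  {eq_quot @homotopicb T x x}.

Section pi1_group.
Context {T : topologicalType}.
Implicit Types x y : T.

HB.instance Definition _ x := Quotient.on (pi1 x).
HB.instance Definition _ x := Choice.on (pi1 x).

Definition pi1_class x (f : cpath x x) : pi1 x := \pi_(pi1 x) f.

Lemma pi1_classP x (f g : cpath x x) :
  pi1_class f = pi1_class g <-> homotopic f g.
Proof.
split=> [/eqP|fg]; first by rewrite /pi1_class eqmodE => /asboolP.
by apply/eqP; rewrite /pi1_class eqmodE; apply/asboolP.
Qed.

Lemma pi1_class_repr x (a : pi1 x) : pi1_class (repr a) = a.
Proof. exact: reprK. Qed.

Lemma pi1_repr_class x (f : cpath x x) : homotopic (repr (pi1_class f)) f.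
Proof. by apply/pi1_classP; exact: pi1_class_repr. Qed.

Definition pi1_one x : pi1 x := pi1_class (path_cst x).
Definition pi1_mul x (a b : pi1 x) : pi1 x :=
  pi1_class (path_cat (repr a) (repr b)).
Definition pi1_inv x (a : pi1 x) : pi1 x := pi1_class (path_rev (repr a)).

Lemma pi1_mulE x (f g : cpath x x) :
  pi1_mul (pi1_class f) (pi1_class g) = pi1_class (path_cat f g).
Proof. by apply/pi1_classP/homotopic_cat; exact: pi1_repr_class. Qed.

Lemma pi1_invE x (f : cpath x x) :
  pi1_inv (pi1_class f) = pi1_class (path_rev f).
Proof. by apply/pi1_classP/homotopic_rev; exact: pi1_repr_class. Qed.

Lemma pi1_mulA x : associative (@pi1_mul x).
Proof.
move=> a b c; rewrite -(pi1_class_repr a) -(pi1_class_repr b).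
rewrite -(pi1_class_repr c) !pi1_mulE; exact/pi1_classP/homotopic_catA.
Qed.

Lemma pi1_mul1 x : left_id (pi1_one x) (@pi1_mul x).
Proof.
move=> a; rewrite -(pi1_class_repr a) pi1_mulE.
exact/pi1_classP/homotopic_cat_cst_l.
Qed.

Lemma pi1_mulr1 x : right_id (pi1_one x) (@pi1_mul x).
Proof.
move=> a; rewrite -(pi1_class_repr a) pi1_mulE.
exact/pi1_classP/homotopic_cat_cst_r.
Qed.

Lemma pi1_mulV x : left_inverse (pi1_one x) (@pi1_inv x) (@pi1_mul x).
Proof.
move=> a; rewrite -(pi1_class_repr a) pi1_invE pi1_mulE.
exact/pi1_classP/homotopic_cat_rev_l.
Qed.

Lemma pi1_mulrV x : right_inverse (pi1_one x) (@pi1_inv x) (@pi1_mul x).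
Proof.
move=> a; rewrite -(pi1_class_repr a) pi1_invE pi1_mulE.
exact/pi1_classP/homotopic_cat_rev_r.
Qed.

HB.instance Definition _ x := isGroup.Build (pi1 x)
  (@pi1_mulA x) (@pi1_mul1 x) (@pi1_mulr1 x) (@pi1_mulV x) (@pi1_mulrV x).

(* The change of basepoint along a path a from x to y. *)
Definition pi1_conj x y (a : cpath x y) (g : pi1 y) : pi1 x :=
  pi1_class (path_cat (path_cat a (repr g)) (path_rev a)).

Lemma pi1_conjE x y (a : cpath x y) (f : cpath y y) :
  pi1_conj a (pi1_class f) = pi1_class (path_cat (path_cat a f) (path_rev a)).
Proof.
apply/pi1_classP/homotopic_cat; last exact: homotopic_refl.
by apply: homotopic_cat; [exact: homotopic_refl|exact: pi1_repr_class].
Qed.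

End pi1_group.

Section functoriality.
Context {X Y : topologicalType}.
Variables (i : X -> Y) (i_cts : continuous i).

Lemma path_map_cts (x y : X) (f : cpath x y) : {within I01, continuous (i \o f)}.
Proof.
by apply: within_continuous_comp; [move=> z _; exact: i_cts|exact: path_cts].
Qed.

Definition path_map (x y : X) (f : cpath x y) : cpath (i x) (i y) :=
  CPath (@path_map_cts x y f) (congr1 i (path_at0 f)) (congr1 i (path_at1 f)).

Lemma homotopic_map (x y : X) (f g : cpath x y) :
  homotopic f g -> homotopic (path_map f) (path_map g).
Proof.
move=> [H [cH H0 H1 Hx Hy]]; exists (i \o H); split=> /=.
- by apply: within_continuous_comp => // z _; exact: i_cts.
- by move=> t /H0 ->.
- by move=> t /H1 ->.
- by move=> s /Hx ->.
- by move=> s /Hy ->.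
Qed.

Definition pi1_map (x : X) (g : pi1 x) : pi1 (i x) :=
  pi1_class (path_map (repr g)).

Lemma pi1_mapE (x : X) (f : cpath x x) :
  pi1_map (pi1_class f) = pi1_class (path_map f).
Proof. by apply/pi1_classP/homotopic_map; exact: pi1_repr_class. Qed.

End functoriality.

(* The image in pi1(T, x) of pi1(P, p), for a path a in T from x to p; it     *)
(* depends on p and a only up to conjugacy when P is path-connected.          *)
Definition pi1_sub_image (T : topologicalType) (P : set T) (x : T) (p : P)
    (a : cpath x (set_val p)) : set (pi1 x) :=
  range (pi1_conj a \o
         @pi1_map P T set_val (@initial_continuous P T set_val) p).

End paths.

Arguments homotopic {R T x y} f g.
Arguments pi1 R {T} x.
Arguments pi1_sub_image {R T P x p} a.

Section representations.
Variables (G : groupType) (F : fieldType) (n : nat).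
Variable rho : G -> 'M[F]_n.

(* As for mx_repr in MathComp, this forces rho to take values in GL_n(F). *)
Definition mx_group_repr : Prop :=
  rho 1%g = 1%:M /\ {morph rho : g h / (g * h)%g >-> g *m h}.

Lemma mx_group_repr_unit : mx_group_repr -> forall g, rho g \in unitmx.
Proof.
move=> [rho1 rhoM] g.
by have /mulmx1_unit[] : rho g *m rho g^-1%g = 1%:M by rewrite -rhoM mulgV rho1.
Qed.

(* Subspaces of F^n are row spaces, on which matrices act on the right. *)
Definition stable_subspace (U : 'M[F]_n) : Prop :=
  forall g, stablemx U (rho g).

Definition simple_subrepr (V : 'M[F]_n) : Prop :=
  [/\ stable_subspace V, V != 0 &
      forall U : 'M[F]_n, stable_subspace U -> (U <= V)%MS -> U != 0 ->
        (V <= U)%MS].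

Definition semisimple_repr : Prop :=
  exists (J : finType) (V : J -> 'M[F]_n),
    [/\ forall j, simple_subrepr (V j),
        (\sum_j V j :=: 1%:M)%MS &
        mxdirect (\sum_j V j)%MS].

End representations.

(* Main.v *)
Require Import Defs.
From HB Require Import structures.
From mathcomp Require Import all_boot all_order all_algebra complex.
From mathcomp Require Import lra ring zify cyclic separable cyclotomic.
From mathcomp Require Import all_classical all_reals topology normedtype realfun.

(* Loops around the punctures generate the fundamental group: the surface is  *)
(* covered by convex charts, and a path that stays in one chart contributes a *)
(* factor which depends only on its endpoints.  If the punctures are put in   *)
(* the plane with distinct abscissas, the loop g_q descends to the left of    *)
(* the puncture q and comes back to its right.  Shears (x, y) |-> (a x + b,   *)
(* y - phi x) move any prescribed punctures into the holes of the standard    *)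
(* pair of pants and all the others far below it; hence two of the g_q always *)
(* generate a finite group under rho, and every product of distinct g_q in    *)
(* the order of the abscissas has an image of finite order.                   *)
(*                                                                            *)
(* For 2x2 matrices these facts suffice.  If the images A_q of the g_q        *)
(* commute, the group they generate is plainly finite.  Otherwise rescale the *)
(* A_q to have determinant 1, and let z be a root of unity such that the      *)
(* traces of the ascending products lie in the ring O of real elements of     *)
(* Z[z].  Since v u + u v is a combination of 1, u and v with coefficients    *)
(* polynomial in tr u, tr v, tr (u v), ascending products span all words over *)
(* O, so all words h have traces in O.  Some A_p and A_q generate a finite    *)
(* nonabelian group K, and Schur orthogonality gives                          *)
(*   sum_(k in K) tr (h k^-1) k = (|K| / 2) h,                                *)
(*   sum_(k in K) tr (h k^-1) ^ 2 = |K|.                                      *)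
(* The second equation holds for all conjugates of the traces, which are real *)
(* and therefore bounded; so the traces take finitely many values, and by the *)
(* first equation so does h.                                                  *)

Set Implicit Arguments.
Unset Strict Implicit.
Unset Printing Implicit Defensive.

Import Order.TTheory GRing.Theory Num.Theory.
Import numFieldNormedType.Exports.
Local Open Scope classical_set_scope.
Local Open Scope ring_scope.

(** * Holonomy *)

(** Topology and algebra meet at [surface_group_reduction]. Topologically, the surface is projected
    stereographically from a pole to a punctured plane. The class of a path is a product of local
    factors, each depending on endpoints only ([chart_holE], [itv_local_to_global]). With cuts
    hanging down from the punctures, only crossings of cuts contribute, so the loops [ploop]
    generate up to conjugation ([pi1_generated]), and loops around the two holes of a sheared pair
    of pants become products of prescribed [ploop]s in the order of abscissas ([pants_loops]).
    Finiteness on pants thus puts any two generators in a finite matrix monoid and gives every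
    ascending product finite order.

    Algebraically, [finite_words] shows that these two facts suffice in size 2. In determinant 1,
    [word_trace] reduces traces of words to traces of ascending products, which are sums of two
    roots of unity. Two noncommuting generators give a finite nonabelian group; [schur_norm] bounds
    the traces of a word against this group at all conjugates, [finite_bounded_conj] leaves finitely
    many values for them, and [schur_expansion] recovers the word. *)

Section holonomy.
Context {R : realType} {T : topologicalType} {x0 : T}.
Variable c : forall x : T, cpath R x0 x.
Local Notation I := (@I01 R).

(** The chosen paths [c] turn every path into a loop at [x0], which makes this a functor from the
    fundamental groupoid to the group. *)
Definition holc x y (g : cpath R x y) : pi1 R x0 :=
  pi1_class (path_cat (path_cat (c x) g) (path_rev (c y))).

Lemma holc_homotopic x y (f g : cpath R x y) :
  homotopic f g -> holc f = holc g.
Proof.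
move=> fg; apply/pi1_classP; apply: homotopic_cat; last exact: homotopic_refl.
by apply: homotopic_cat => //; exact: homotopic_refl.
Qed.

Lemma holc_cat x y z (f : cpath R x y) (g : cpath R y z) :
  holc (path_cat f g) = (holc f * holc g)%g.
Proof.
rewrite [RHS]pi1_mulE; apply/pi1_classP/homotopic_sym.
have rfl u v (h : cpath R u v) : homotopic h h by exact: homotopic_refl.
apply: (homotopic_trans (homotopic_sym (homotopic_catA _ _ _))).
apply: (@homotopic_trans _ _ _ _ _
  (path_cat (path_cat (c x) f) (path_cat g (path_rev (c z))))).
  apply: homotopic_cat; first exact: rfl.
  apply: (homotopic_trans (homotopic_catA _ _ _)).
  apply: homotopic_cat; last exact: rfl.
  apply: (homotopic_trans (homotopic_catA _ _ _)).
  apply: homotopic_trans; last exact: homotopic_cat_cst_l.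
  by apply: homotopic_cat; [exact: homotopic_cat_rev_l|exact: rfl].
apply: (homotopic_trans (homotopic_catA _ _ _)).
by apply: homotopic_cat; [exact/homotopic_sym/homotopic_catA|exact: rfl].
Qed.

Lemma holc_cst x : holc (path_cst R x) = 1%g.
Proof.
apply: (@mulgI _ (holc (path_cst R x))).
by rewrite mulg1 -holc_cat; apply/holc_homotopic/homotopic_cat_cst_l.
Qed.

Lemma holc_rev x y (f : cpath R x y) : holc (path_rev f) = (holc f)^-1%g.
Proof.
apply/esym/mulg1_eq; rewrite -holc_cat -(holc_cst x).
exact/holc_homotopic/homotopic_cat_rev_r.
Qed.

(* Reading holonomy off bare functions avoids transporting paths along        *)
(* equalities between their endpoints; it is 1 on functions that are not      *)
(* continuous on [0, 1].                                                      *)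
Definition hol (f : R -> T) : pi1 R x0 :=
  if pselect {within I, continuous f} is left cf
  then holc (@CPath R T (f 0) (f 1) f cf erefl erefl) else 1%g.

Lemma holE x y (g : cpath R x y) : hol g = holc g.
Proof.
case: g => f cf f0 f1; subst x y; rewrite /hol /=.
by case: pselect => // cf'; rewrite (Prop_irrelevance cf' cf).
Qed.

Lemma hol_homotopic (f g : R -> T) (H : R * R -> T) :
  {within I, continuous f} -> {within I, continuous g} ->
  {within I `*` I, continuous H} ->
  (forall t, I t -> H (0, t) = f t) -> (forall t, I t -> H (1, t) = g t) ->
  (forall s, I s -> H (s, 0) = f 0) -> (forall s, I s -> H (s, 1) = f 1) ->
  hol f = hol g.
Proof.
move=> cf cg cH H0 H1 Hx Hy.
have I0 : I 0 by rewrite I01E; split; lra.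
have I1 : I 1 by rewrite I01E; split; lra.
have fg0 : g 0 = f 0 by rewrite -H1// Hx.
have fg1 : g 1 = f 1 by rewrite -H1// Hy.
rewrite (holE (@CPath R T (f 0) (f 1) f cf erefl erefl)).
rewrite (holE (@CPath R T (f 0) (f 1) g cg fg0 fg1)).
by apply: holc_homotopic; exists H; split.
Qed.

Lemma hol_ext (f g : R -> T) : {within I, continuous f} ->
  (forall t, I t -> f t = g t) -> hol f = hol g.
Proof.
move=> cf fg; apply: (@hol_homotopic _ _ (fun p => f p.2)) => //.
- by apply: within_eq cf => t; exact: fg.
- apply: (@within_comp _ _ _ _ I snd f) => //; last by move=> p [].
  by apply: continuous_subspaceT; exact: cts_snd.
Qed.

Definition subpath (X : Type) (f : R -> X) (s t : R) : R -> X :=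
  fun u => f (s + (t - s) * u).

Lemma subpath_I (s t u : R) : 0 <= s -> s <= t -> t <= 1 -> I u ->
  I (s + (t - s) * u).
Proof. by rewrite !I01E => s0 st t1 [u0 u1]; split; nra. Qed.

Lemma subpath_within (X : topologicalType) (f : R -> X) (s t : R) :
  0 <= s -> s <= t -> t <= 1 ->
  {within I, continuous f} -> {within I, continuous (subpath f s t)}.
Proof.
move=> s0 st t1 cf.
apply: (@within_comp _ _ _ I I (fun u => s + (t - s) * u) f) => //.
  apply: continuous_subspaceT => u; apply: cvgD; first exact: cvg_cst.
  by apply: cvgM; [exact: cvg_cst|exact: cvg_id].
by move=> u; exact: subpath_I.
Qed.

Lemma hol_subpath (f : R -> T) (s t u : R) : {within I, continuous f} ->
  0 <= s -> s <= t -> t <= u -> u <= 1 ->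
  hol (subpath f s u) = (hol (subpath f s t) * hol (subpath f t u))%g.
Proof.
move=> cf s0 st tu u1.
have e0 a b : subpath f a b 0 = f a by rewrite /subpath mulr0 addr0.
have e1 a b : subpath f a b 1 = f b by rewrite /subpath mulr1 addrC subrK.
have c1 : {within I, continuous (subpath f s t)}.
  by apply: subpath_within => //; lra.
have c2 : {within I, continuous (subpath f t u)}.
  by apply: subpath_within => //; lra.
have c3 : {within I, continuous (subpath f s u)}.
  by apply: subpath_within => //; lra.
rewrite (holE (CPath c1 (e0 _ _) (e1 _ _))) (holE (CPath c2 (e0 _ _) (e1 _ _))).
rewrite (holE (CPath c3 (e0 _ _) (e1 _ _))) -holc_cat.
apply/holc_homotopic/homotopic_sym.
(* [m] runs during the first half and then rests at 1, [M] rests at 0 and then runs, so one formula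
   covers both branches of the concatenation. *)
pose m : R -> R := (fun v => 2 * v + 0) \min (fun=> 1).
pose M : R -> R := (fun v => 2 * v + -1) \max (fun=> 0).
have cm : continuous m.
  by move=> v; apply: continuous_min; [exact: affine_cts|exact: cvg_cst].
have cM : continuous M.
  by move=> v; apply: continuous_max; [exact: affine_cts|exact: cvg_cst].
apply: (homotopic_reparam (p := f)
  (u := fun v => s + (t - s) * m v + (u - t) * M v)
  (v := fun v => s + (u - s) * v)) => //=.
- move=> v; apply: cvgD; first (apply: cvgD; first exact: cvg_cst).
    by apply: cvgM; [exact: cvg_cst|exact: cm].
  by apply: cvgM; [exact: cvg_cst|exact: cM].
- move=> v; apply: cvgD; first exact: cvg_cst.
  by apply: cvgM; [exact: cvg_cst|exact: cvg_id].
- move=> v; rewrite !I01E /m /M /= => -[v0 v1].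
  by case: (leP (2 * v + 0) 1); case: (leP (2 * v + -1) 0) => ? ?; split; nra.
- by move=> v; apply: subpath_I; lra.
- by rewrite /m /M /= min_l ?max_r; lra.
- by rewrite /m /M /= min_r ?max_l; lra.
- move=> v; rewrite I01E => -[v0 v1]; rewrite /path_cat_fun /= /subpath /m /M /=.
  case: (leP v 2^-1) => v2.
    by rewrite min_l ?max_r; [congr f|..]; lra.
  by rewrite min_r ?max_l; [congr f|..]; lra.
Qed.

End holonomy.

(* Connectedness of [0, 1], in the form of an induction on subintervals.      *)
Lemma itv_local_to_global (R : realType) (Q : R -> R -> Prop) :
  (forall s t u, 0 <= s -> s <= t -> t <= u -> u <= 1 ->
    Q s t -> Q t u -> Q s u) ->
  (forall x, 0 <= x <= 1 -> exists2 d, 0 < d & forall s t,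
    0 <= s -> s <= t -> t <= 1 -> `|s - x| < d -> `|t - x| < d -> Q s t) ->
  Q 0 1.
Proof.
move=> Qtr Qloc.
pose A := [set x : R | 0 <= x <= 1 /\ Q 0 x].
have A0 : A 0.
  split; first by rewrite lexx ler01.
  have [|d d0 Qd] := Qloc 0; first by rewrite lexx ler01.
  by apply: Qd; rewrite ?subrr ?normr0.
have ubA : has_sup A.
  by split; [exists 0|exists 1 => x [/andP[]]].
have s0 : 0 <= sup A by apply: ub_le_sup => //; exact: ubA.2.
have s1 : sup A <= 1 by apply: ge_sup => [|x [/andP[]]]; [exists 0|].
have [|d d0 Qd] := Qloc (sup A); first by rewrite s0.
have [y [/andP[y0 y1] Qy] yd] := sup_adherent d0 ubA.
have ys : y <= sup A.
  by apply: ub_le_sup => //; [exact: ubA.2|split=> //; rewrite y0].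
(* A point beyond the supremum, capped at 1: as [z] lies in [A], the cap must be active, so [z] is
   1. *)
pose z := Num.min (sup A + d / 2) 1.
have Qz : Q 0 z.
  apply: (Qtr 0 y z) => //; rewrite /z.
  - by rewrite le_min y1 andbT; lra.
  - by rewrite ge_min lexx orbT.
  - apply: Qd => //.
    + by rewrite le_min y1 andbT; lra.
    + by rewrite ge_min lexx orbT.
    + by rewrite ltr_norml; lra.
    + by rewrite ltr_norml; case: (leP (sup A + d / 2) 1) => ?; lra.
have Az : A z.
  split=> //; rewrite /z ge_min lexx orbT andbT le_min ler01 andbT; lra.
have : z <= sup A by apply: ub_le_sup => //; exact: ubA.2.
rewrite {1}/z; case: (leP (sup A + d / 2) 1) => h1; first lra.
by move=> _; move: Qz; rewrite /z min_r//; lra.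
Qed.

(** * Paths in a subspace *)

Section subspace_paths.
Context {R : realType}.
Local Notation I := (@I01 R).

Lemma set_val_continuous (T : topologicalType) (A : set T) :
  continuous (set_val : A -> T).
Proof. exact: initial_continuous. Qed.

Lemma continuous_to_sub (X T : topologicalType) (A : set T) (f : X -> A) :
  continuous (set_val \o f) -> continuous f.
Proof. exact: continuous_comp_initial. Qed.

Lemma continuous_from_sub (T Y : topologicalType) (A : set T) (f : T -> Y) :
  {within A, continuous f} -> continuous (f \o set_val : A -> Y).
Proof. by move/subspace_sigL_continuousP. Qed.

Lemma cpath_to_sub (T : topologicalType) (A : set T) (f : R -> T) (p q : A) :
  {within I, continuous f} -> (forall t, I t -> A (f t)) ->
  f 0 = set_val p -> f 1 = set_val q ->
  exists g : cpath R p q, forall t, I t -> set_val (g t) = f t.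
Proof.
move=> cf fA f0 f1.
(* The value [p] is a dummy, never taken on [0, 1]. *)
pose g (t : R) : A :=
  if pselect (A (f t)) is left h then SigSub (mem_set h) else p.
have gE t : I t -> set_val (g t) = f t.
  by move=> It; rewrite /g; case: pselect => // nA; have := fA _ It.
have I0 : I 0 by rewrite I01E; split; lra.
have I1 : I 1 by rewrite I01E; split; lra.
have cg : {within I, continuous g}.
  apply: continuous_to_sub; apply: within_eq cf => t It.
  by rewrite -gE.
have g0 : g 0 = p by apply: val_inj; rewrite -!set_valE gE.
have g1 : g 1 = q by apply: val_inj; rewrite -!set_valE gE.
by exists (CPath cg g0 g1).
Qed.

Context {T : topologicalType} {x0 : T} (c : forall x : T, cpath R x0 x).
Variable P : set T.
Let incl (p q : P) (g : cpath R p q) :=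
  Defs.path_map (@initial_continuous P T set_val) g.

(** Inclusion commutes with concatenation as functions, so [hol] compares the two sides without any
    homotopy to construct. *)
Lemma holc_incl_cat (p q r : P) (f : cpath R p q) (g : cpath R q r) :
  holc c (incl (path_cat f g)) = (holc c (incl f) * holc c (incl g))%g.
Proof.
rewrite -holc_cat -!holE; apply: hol_ext; first exact: path_cts.
by move=> t _ /=; rewrite /path_cat_fun /=; case: ifP.
Qed.

Lemma holc_incl_rev (p q : P) (f : cpath R p q) :
  holc c (incl (path_rev f)) = (holc c (incl f))^-1%g.
Proof. by rewrite -holc_rev -!holE. Qed.

Lemma pi1_sub_image_loop (p : P) (g : cpath R p p) :
  pi1_sub_image (c (set_val p)) (holc c (incl g)).
Proof. by exists (pi1_class g) => //=; rewrite pi1_mapE pi1_conjE. Qed.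

End subspace_paths.

(** * Convex charts *)

Section charts.
Context {R : realType}.
Local Notation I := (@I01 R).

Definition seg (p q : R * R) (t : R) : R * R :=
  (p.1 + t * (q.1 - p.1), p.2 + t * (q.2 - p.2)).

Definition convex2 (D : set (R * R)) : Prop :=
  forall p q t, D p -> D q -> I t -> D (seg p q t).

Lemma seg0 p q : seg p q 0 = p.
Proof. by case: p => ? ?; rewrite /seg !mul0r !addr0. Qed.

Lemma seg1 p q : seg p q 1 = q.
Proof.
by case: q => ? ?; rewrite /seg !mul1r; congr (_, _); rewrite addrC subrK.
Qed.

Lemma cts_seg (X : topologicalType) (f g : X -> R * R) (s : X -> R) :
  continuous f -> continuous g -> continuous s ->
  continuous (fun x => seg (f x) (g x) (s x)).
Proof.
move=> cf cg cs; have c1 : continuous (fun x => (f x).1).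
  by move=> x; apply: continuous_comp; [exact: cf|exact: cts_fst].
have c2 : continuous (fun x => (f x).2).
  by move=> x; apply: continuous_comp; [exact: cf|exact: cts_snd].
have c3 : continuous (fun x => (g x).1).
  by move=> x; apply: continuous_comp; [exact: cg|exact: cts_fst].
have c4 : continuous (fun x => (g x).2).
  by move=> x; apply: continuous_comp; [exact: cg|exact: cts_snd].
apply: cts_pair => x.
- apply: cvgD; first exact: c1.
  by apply: cvgM; [exact: cs|apply: cvgB; [exact: c3|exact: c1]].
- apply: cvgD; first exact: c2.
  by apply: cvgM; [exact: cs|apply: cvgB; [exact: c4|exact: c2]].
Qed.

Lemma seg_within p q : {within I, continuous (seg p q)}.
Proof.
apply: continuous_subspaceT; apply: cts_seg => x; try exact: cvg_cst.
exact: cvg_id.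
Qed.

Context {T : topologicalType} {x0 : T}.
Variable c : forall x : T, cpath R x0 x.
Variables (psi : R * R -> T) (M : set (R * R)).
Hypothesis psi_cts : {within M, continuous psi}.

Lemma chart_path (f : R -> R * R) : {within I, continuous f} ->
  (forall t, I t -> M (f t)) -> {within I, continuous (psi \o f)}.
Proof. by move=> cf fM; apply: (within_comp cf psi_cts). Qed.

Definition chart_hol (p q : R * R) := hol c (psi \o seg p q).

Variable D : set (R * R).
Hypotheses (DM : D `<=` M) (Dconv : convex2 D).

(** The straight-line homotopy from a path to its chord stays in the convex set [D]. *)
Lemma chart_holE (f : R -> R * R) : {within I, continuous f} ->
  (forall t, I t -> D (f t)) -> hol c (psi \o f) = chart_hol (f 0) (f 1).
Proof.
move=> cf fD.
have I0 : I 0 by rewrite I01E; split; lra.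
have I1 : I 1 by rewrite I01E; split; lra.
apply: (@hol_homotopic _ _ _ c _ _
  (fun p => psi (seg (f p.2) (seg (f 0) (f 1) p.2) p.1))).
- by apply: chart_path => // t /fD /DM.
- apply: chart_path; first exact: seg_within.
  by move=> t It; apply/DM/Dconv => //; exact: fD.
- apply: (@within_comp _ _ _ _ M
    (fun p => seg (f p.2) (seg (f 0) (f 1) p.2) p.1) psi) => //.
    have cs : continuous (snd : subspace (I `*` I) -> R).
      by apply: continuous_subspaceT; exact: cts_snd.
    apply: (@cts_seg (subspace (I `*` I)) (fun p => f p.2)
      (fun p => seg (f 0) (f 1) p.2) fst).
    + apply: (@within_comp _ _ _ (I `*` I) I snd f) => //; last by move=> p [].
    + apply: (@within_comp _ _ _ (I `*` I) I snd (seg (f 0) (f 1))) => //.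
        exact: seg_within.
      by move=> p [].
    + by apply: continuous_subspaceT; exact: cts_fst.
  move=> [s t] [/= Is It]; apply/DM/Dconv => //; first exact: fD.
  by apply: Dconv => //; exact: fD.
- by move=> t _; rewrite seg0.
- by move=> t _; rewrite seg1.
- by move=> s _ /=; rewrite seg0 /seg !subrr !mulr0 !addr0; case: (f 0).
- by move=> s _ /=; rewrite seg1 /seg !subrr !mulr0 !addr0; case: (f 1).
Qed.

(** The broken line through [q] is a path in [D], so [chart_holE] applies to it and to both of its
    halves. *)
Lemma chart_hol_tri p q r : D p -> D q -> D r ->
  (chart_hol p q * chart_hol q r)%g = chart_hol p r.
Proof.
move=> Dp Dq Dr.
pose m : R -> R := (fun v => 2 * v + 0) \min (fun=> 1).
pose M' : R -> R := (fun v => 2 * v + -1) \max (fun=> 0).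
have cm : continuous m.
  by move=> v; apply: continuous_min; [exact: affine_cts|exact: cvg_cst].
have cM : continuous M'.
  by move=> v; apply: continuous_max; [exact: affine_cts|exact: cvg_cst].
pose f t := if t <= 2^-1 then seg p q (m t) else seg q r (M' t).
have Im t : I t -> I (m t).
  rewrite !I01E /m /= => -[? ?]; case: (leP (2 * t + 0) 1); split; lra.
have IM t : I t -> I (M' t).
  rewrite !I01E /M' /= => -[? ?]; case: (leP (2 * t + -1) 0); split; lra.
have fD t : I t -> D (f t).
  move=> It; rewrite /f; case: ifP => _; apply: Dconv => //;
    [exact: Im|exact: IM].
have cf : {within I, continuous f}.
  rewrite /f; apply: (@paste_within (R * R)%type R _ _ I (fun t => seg p q (m t))
    (fun t => seg q r (M' t)) (fun t => t <= 2^-1)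
    (@closed_le R 2^-1) (@closed_ge R 2^-1)).
  - by move=> t _ /=; case: (leP t 2^-1) => [|/ltW]; [left|right].
  - by move=> t /= ->.
  - move=> t /= t2 It; case: ifP => // t2'.
    have -> : t = 2^-1 by lra.
    rewrite /m /M' /= min_r ?max_r ?seg1 ?seg0//; lra.
  - exact: I01_closed.
  - apply: continuous_subspaceT; apply: cts_seg => x; try exact: cvg_cst.
    exact: cm.
  - apply: continuous_subspaceT; apply: cts_seg => x; try exact: cvg_cst.
    exact: cM.
have cpf : {within I, continuous (psi \o f)}.
  by apply: chart_path => // t /fD /DM.
have f0 : f 0 = p.
  by rewrite /f invr_ge0 ler0n /m /= min_l ?mulr0 ?addr0 ?seg0 //; lra.
have f1 : f 1 = r.
  rewrite /f ifF /M' /=; last by apply/negbTE; rewrite -ltNge; lra.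
  have -> : Num.max (2 * 1 - 1) 0 = 1 :> R by rewrite max_l; lra.
  exact: seg1.
have fh : f 2^-1 = q by rewrite /f lexx /m /= min_r ?seg1//; lra.
have sub a b : 0 <= a -> a <= b -> b <= 1 ->
    hol c (subpath (psi \o f) a b) = chart_hol (f a) (f b).
  move=> a0 ab b1.
  rewrite (@chart_holE (subpath f a b)).
  - by rewrite /subpath mulr0 addr0 mulr1 addrC subrK.
  - exact: subpath_within.
  - by move=> t It; apply: fD; exact: subpath_I.
have l0 : 0 <= 2^-1 :> R by lra.
have l1 : 2^-1 <= 1 :> R by lra.
have := @hol_subpath _ _ _ c (psi \o f) 0 2^-1 1 cpf (lexx _) l0 l1 (lexx _).
rewrite (sub 0 2^-1)// (sub 2^-1 1)// (sub 0 1) ?ler01//.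
by rewrite f0 f1 fh => ->.
Qed.

Lemma chart_hol_refl p : D p -> chart_hol p p = 1%g.
Proof.
by move=> Dp; apply: (@mulgI _ (chart_hol p p)); rewrite mulg1 chart_hol_tri.
Qed.

Lemma chart_hol_sym p q : D p -> D q -> chart_hol q p = (chart_hol p q)^-1%g.
Proof.
by move=> Dp Dq; apply/esym/mulg1_eq; rewrite chart_hol_tri ?chart_hol_refl.
Qed.

End charts.

(** * The punctured plane *)

Section gprod.
Variable G : groupType.

Definition gprod (s : seq G) : G := foldr (fun x y => x * y)%g 1%g s.

Lemma gprod_cat s t : gprod (s ++ t) = (gprod s * gprod t)%g.
Proof. by elim: s => [|x s IH] /=; rewrite ?mul1g// IH mulgA. Qed.

End gprod.

Lemma sqr_sum_eq0 (R : realDomainType) (p : R * R) :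
  p.1 ^+ 2 + p.2 ^+ 2 = 0 -> p = (0, 0).
Proof.
case: p => x y /= /eqP; rewrite paddr_eq0 ?sqr_ge0// !sqrf_eq0.
by move=> /andP[/eqP -> /eqP ->].
Qed.

Lemma conv_gt (R : realFieldType) (l a b t : R) :
  l < a -> l < b -> 0 <= t -> t <= 1 -> l < a + t * (b - a).
Proof.
move=> la lb t0 t1; rewrite -subr_gt0.
rewrite (_ : _ - l = (1 - t) * (a - l) + t * (b - l)); last by ring.
case: (ltP 0 t) => [tp|t0'].
  by apply: ltr_wpDl; [apply: mulr_ge0|apply: mulr_gt0]; lra.
by apply: ltr_wpDr; [apply: mulr_ge0|apply: mulr_gt0]; lra.
Qed.

Lemma conv_lt (R : realFieldType) (l a b t : R) :
  a < l -> b < l -> 0 <= t -> t <= 1 -> a + t * (b - a) < l.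
Proof.
move=> la lb t0 t1; rewrite -ltrN2.
rewrite (_ : - (a + _) = - a + t * (- b - - a)); last by ring.
by apply: conv_gt => //; rewrite ltrN2.
Qed.

Section punctured_plane.
Context {R : realType} {T : topologicalType} {x0 : T}.
Local Notation I := (@I01 R).
Variable c : forall x : T, cpath R x0 x.
Variables (psi : R * R -> T) (Q : seq (R * R)).
Hypothesis Qsorted : sorted (fun p q => p.1 < q.1) Q.

Definition plane_minus : set (R * R) := [set p | p \notin Q].
Local Notation M := plane_minus.
Hypothesis psi_cts : {within M, continuous psi}.
Variables dl ht : R.
Hypothesis dl_gt0 : 0 < dl.
Hypothesis dl_gap : {in Q &, forall p q, p != q -> dl <= `|p.1 - q.1|}.
Hypothesis ht_gt : {in Q, forall q, q.2 < ht}.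

Local Notation h := (chart_hol c psi).

(** The cuts are the vertical rays hanging from the punctures. Distinct abscissas differ by at least
    [dl], so a shift by [dl / 2] leaves a cut without reaching another. *)
Definition on_cut (p : R * R) := has (fun q => (q.1 == p.1) && (p.2 < q.2)) Q.
Definition off_cut (p : R * R) : R := if on_cut p then p.1 - dl / 2 else p.1.

(* The holonomy of the path that descends to p from the basepoint (0, ht),    *)
(* passing to the left of the puncture above p if there is one.               *)
Definition gauge (p : R * R) : pi1 R x0 :=
  (h (0%R, ht) (off_cut p, ht) * h (off_cut p, ht) (off_cut p, p.2) *
   h (off_cut p, p.2) p)%g.

(** A gauge transformation: the path is closed up by the descents to its endpoints, so only its
    crossings of cuts contribute. *)
Definition plane_hol (f : R -> R * R) : pi1 R x0 :=
  (gauge (f 0%R) * hol c (psi \o f) * (gauge (f 1%R))^-1)%g.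

Definition seg_hol (p q : R * R) : pi1 R x0 :=
  (gauge p * h p q * (gauge q)^-1)%g.

Definition ploop (q : R * R) : pi1 R x0 :=
  seg_hol (q.1 - dl / 2, q.2 - 1) (q.1 + dl / 2, q.2 - 1).

Lemma plane_hol_convex (D : set (R * R)) (f : R -> R * R) :
  D `<=` M -> convex2 D -> {within I, continuous f} ->
  (forall t, I t -> D (f t)) -> plane_hol f = seg_hol (f 0) (f 1).
Proof.
by move=> DM Dc cf fD; rewrite /plane_hol (chart_holE c psi_cts DM Dc).
Qed.

Lemma seg_hol_tri (D : set (R * R)) p q r :
  D `<=` M -> convex2 D -> D p -> D q -> D r ->
  (seg_hol p q * seg_hol q r)%g = seg_hol p r.
Proof.
move=> DM Dc Dp Dq Dr; rewrite /seg_hol.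
rewrite -(chart_hol_tri c psi_cts DM Dc Dp Dq Dr).
by move: (gauge p) (gauge q) (gauge r) => a b d; rewrite !mulgA mulgVK.
Qed.

Lemma seg_hol_refl p : M p -> seg_hol p p = 1%g.
Proof.
move=> Mp; have D1 : [set p] `<=` M by move=> _ ->.
have Dc : convex2 [set p].
  by move=> _ _ t -> -> _; rewrite /seg !subrr !mulr0 !addr0; case: (p).
by rewrite /seg_hol (chart_hol_refl c psi_cts D1 Dc)// mulg1 mulgV.
Qed.

Lemma seg_hol_sym (D : set (R * R)) p q :
  D `<=` M -> convex2 D -> D p -> D q -> seg_hol q p = (seg_hol p q)^-1%g.
Proof.
move=> DM Dc Dp Dq; apply/esym/mulg1_eq.
rewrite (seg_hol_tri DM Dc)// seg_hol_refl//.
exact: DM.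
Qed.

Lemma gauge_off_cut p : M p -> ~~ on_cut p ->
  gauge p = (h (0%R, ht) (p.1, ht) * h (p.1, ht) p)%g.
Proof.
move=> Mp np; rewrite /gauge /off_cut (negbTE np).
have D1 : [set p] `<=` M by move=> _ ->.
have Dc : convex2 [set p].
  by move=> _ _ t -> -> _; rewrite /seg !subrr !mulr0 !addr0; case: (p).
case: p np Mp D1 Dc => px py np Mp D1 Dc /=.
by rewrite (chart_hol_refl c psi_cts D1 Dc)// mulg1.
Qed.

Lemma above_all (p : R * R) : ht <= p.2 -> M p.
Proof.
move=> hp; apply/negP => Qp; have := ht_gt Qp; lra.
Qed.

(** The closed-up path is a chain of segments in [D] and in the half-plane above height [ht]; both
    are convex and free of punctures, so everything cancels. *)
Lemma seg_hol_one (D : set (R * R)) p q : D `<=` M -> convex2 D ->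
  D p -> D q -> D (p.1, ht) -> D (q.1, ht) ->
  ~~ on_cut p -> ~~ on_cut q -> seg_hol p q = 1%g.
Proof.
move=> DM Dc Dp Dq Dp' Dq' np nq.
pose U : set (R * R) := [set p | ht <= p.2].
have UM : U `<=` M by move=> u; exact: above_all.
have Uc : convex2 U.
  move=> u v t; rewrite /U /= I01E => ? ? [? ?]; rewrite /seg /=; nra.
rewrite /seg_hol !gauge_off_cut//; try exact: DM.
rewrite -(chart_hol_tri c psi_cts UM Uc (p := (0, ht)) (q := (p.1, ht))
  (r := (q.1, ht))) /U//=.
rewrite -(mulgA _ (h (p.1, ht) p)) (chart_hol_tri c psi_cts DM Dc Dp' Dp Dq).
rewrite -(mulgA _ (h (p.1, ht) (q.1, ht))).
rewrite (chart_hol_tri c psi_cts DM Dc Dp' Dq' Dq).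
by rewrite mulgV.
Qed.

Definition strip (l r : R) : set (R * R) := [set p | l < p.1 < r].

Lemma strip_convex l r : convex2 (strip l r).
Proof.
move=> p q t; rewrite /strip /seg /= I01E => /andP[? ?] /andP[? ?] [? ?].
by rewrite conv_gt ?conv_lt.
Qed.

Lemma strip_sub l r : {in Q, forall q, ~~ (l < q.1 < r)} -> strip l r `<=` M.
Proof. by move=> nQ p /= lpr; apply/negP => /nQ; rewrite lpr. Qed.

Lemma seg_hol_strip l r p q : {in Q, forall q, ~~ (l < q.1 < r)} ->
  strip l r p -> strip l r q -> seg_hol p q = 1%g.
Proof.
move=> nQ lp lq; apply: (seg_hol_one (strip_sub nQ) (@strip_convex l r)) => //.
- apply/hasPn => u Qu; apply/negP => /andP[/eqP up _].
  by have := nQ _ Qu; rewrite up lp.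
- apply/hasPn => u Qu; apply/negP => /andP[/eqP up _].
  by have := nQ _ Qu; rewrite up lq.
Qed.

Section near_puncture.
Variable u : R * R.
Hypothesis Qu : u \in Q.

Definition above : set (R * R) := [set p | `|p.1 - u.1| < dl /\ u.2 < p.2].
Definition below : set (R * R) := [set p | `|p.1 - u.1| < dl /\ p.2 < u.2].

Lemma near_eq q : q \in Q -> `|q.1 - u.1| < dl -> q = u.
Proof.
move=> Qq; apply: contraPP => /eqP qu; apply/negP; rewrite -leNgt.
exact: dl_gap.
Qed.

Lemma above_sub : above `<=` M.
Proof.
move=> p [pu pu2]; apply/negP => Qp.
by move: pu2; rewrite (near_eq Qp pu) ltxx.
Qed.

Lemma below_sub : below `<=` M.
Proof.
move=> p [pu pu2]; apply/negP => Qp.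
by move: pu2; rewrite (near_eq Qp pu) ltxx.
Qed.

Lemma above_convex : convex2 above.
Proof.
move=> p q t [pu pu2] [qu qu2]; rewrite I01E => -[t0 t1]; split=> /=.
  move: pu qu; rewrite !ltr_distl => /andP[? ?] /andP[? ?].
  by rewrite conv_gt ?conv_lt.
exact: conv_gt.
Qed.

Lemma below_convex : convex2 below.
Proof.
move=> p q t [pu pu2] [qu qu2]; rewrite I01E => -[t0 t1]; split=> /=.
  move: pu qu; rewrite !ltr_distl => /andP[? ?] /andP[? ?].
  by rewrite conv_gt ?conv_lt.
exact: conv_lt.
Qed.

Lemma seg_hol_above p q : above p -> above q -> seg_hol p q = 1%g.
Proof.
move=> ap aq; apply: (seg_hol_one above_sub above_convex) => //.
- by split; [case: ap|exact: ht_gt].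
- by split; [case: aq|exact: ht_gt].
- apply/hasPn => v Qv; apply/negP => /andP[/eqP vp pv].
  by case: ap => pu /ltW; rewrite leNgt -(near_eq Qv) ?pv// vp.
- apply/hasPn => v Qv; apply/negP => /andP[/eqP vp pv].
  by case: aq => pu /ltW; rewrite leNgt -(near_eq Qv) ?pv// vp.
Qed.

Lemma gap_left : {in Q, forall q, ~~ (u.1 - dl < q.1 < u.1)}.
Proof.
move=> q Qq; apply/negP => /andP[h1 h2].
have qu : q = u by apply: near_eq => //; rewrite ltr_norml; lra.
by move: h2; rewrite qu ltxx.
Qed.

Lemma gap_right : {in Q, forall q, ~~ (u.1 < q.1 < u.1 + dl)}.
Proof.
move=> q Qq; apply/negP => /andP[h1 h2].
have qu : q = u by apply: near_eq => //; rewrite ltr_norml; lra.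
by move: h1; rewrite qu ltxx.
Qed.

Lemma seg_hol_below_left p q : below p -> below q -> p.1 < u.1 -> q.1 < u.1 ->
  seg_hol p q = 1%g.
Proof.
rewrite /below /= !ltr_norml => -[/andP[? ?] _] [/andP[? ?] _] ? ?.
by apply: (seg_hol_strip gap_left); rewrite /strip /=; lra.
Qed.

Lemma seg_hol_below_right p q : below p -> below q -> u.1 < p.1 -> u.1 < q.1 ->
  seg_hol p q = 1%g.
Proof.
rewrite /below /= !ltr_norml => -[/andP[? ?] _] [/andP[? ?] _] ? ?.
by apply: (seg_hol_strip gap_right); rewrite /strip /=; lra.
Qed.

(** The holonomy is trivial on each side of the cut, so the crossing can be slid to the standard one
    in [ploop]. *)
Lemma seg_hol_below_cross p q : below p -> below q -> p.1 < u.1 -> u.1 < q.1 ->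
  seg_hol p q = ploop u.
Proof.
move=> bp bq pu uq.
have dl0 := dl_gt0.
have b1 : below (u.1 - dl / 2, u.2 - 1).
  by split=> /=; rewrite ?ltr_norml; lra.
have b2 : below (u.1 + dl / 2, u.2 - 1).
  by split=> /=; rewrite ?ltr_norml; lra.
rewrite -(seg_hol_tri below_sub below_convex bp b1 bq).
rewrite -(seg_hol_tri below_sub below_convex b1 b2 bq).
rewrite seg_hol_below_left ?(seg_hol_below_right b2 bq) ?mul1g ?mulg1//=; lra.
Qed.

(** The gauge of a point on a cut is routed through the point half a gap to its left, so moving
    there costs nothing. *)
Lemma seg_hol_off_cut p : below p -> below (off_cut p, p.2) /\
  seg_hol (off_cut p, p.2) p = 1%g.
Proof.
move=> bp; have dl0 := dl_gt0.
have [np|np] := boolP (on_cut p); last first.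
  rewrite /off_cut (negbTE np); case: p np bp => a b /= np bp.
  by split=> //; apply/seg_hol_refl/below_sub.
have pu : p.1 = u.1.
  have /hasP[v Qv /andP[/eqP vp pv]] := np; case: bp => pu _.
  by rewrite -vp; congr fst; apply: near_eq => //; rewrite vp.
have bp' : below (off_cut p, p.2).
  split=> /=; last by case: bp.
  by rewrite /off_cut np pu ltr_norml; lra.
split=> //; rewrite /seg_hol.
rewrite (gauge_off_cut (p := (off_cut p, p.2)))/=; last 2 first.
- exact: below_sub.
- apply/hasPn => v Qv /=; apply/negP => /andP[/eqP vp _].
  have := gap_left Qv; rewrite vp /off_cut np pu; lra.
by rewrite [gauge p]/gauge mulgV.
Qed.

(** Both endpoints are first moved off the cut. A point on it moves left, which is why the
    inequalities are strict. *)
Lemma seg_hol_below p q : below p -> below q -> seg_hol p q =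
  ((if (u.1 < p.1)%R then (ploop u)^-1 else 1) *
   (if (u.1 < q.1)%R then ploop u else 1))%g.
Proof.
move=> bp bq; have dl0 := dl_gt0.
have [bp' ep] := seg_hol_off_cut bp; have [bq' eq] := seg_hol_off_cut bq.
rewrite -(seg_hol_tri below_sub below_convex bp bp' bq).
rewrite -(seg_hol_tri below_sub below_convex bp' bq' bq) eq mulg1.
rewrite (seg_hol_sym below_sub below_convex bp' bp) ep invg1 mul1g.
have side p1 : below p1 -> if (u.1 < p1.1)%R then (off_cut p1 > u.1)%R else
    (off_cut p1 < u.1)%R.
  move=> b1; rewrite /off_cut; have [np|np] := boolP (on_cut p1).
    have pu : p1.1 = u.1.
      have /hasP[v Qv /andP[/eqP vp pv]] := np; case: b1 => pu _.
      by rewrite -vp; congr fst; apply: near_eq => //; rewrite vp.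
    by rewrite pu ltxx; lra.
  case: ltrP => // pu; rewrite lt_neqAle pu andbT; apply/negP => /eqP pu1.
  move/hasPn: np => /(_ _ Qu); rewrite pu1 eqxx /=; case: b1 => _ ->//.
have := side _ bp; have := side _ bq; case: ifP => uq; case: ifP => up hq hp.
- by rewrite seg_hol_below_right//= mulVg.
- by rewrite seg_hol_below_cross//= mul1g.
- rewrite (seg_hol_sym below_sub below_convex bq' bp').
  by rewrite seg_hol_below_cross//= mulg1.
- by rewrite seg_hol_below_left//= mul1g.
Qed.

End near_puncture.

Lemma plane_hol_subpath (f : R -> R * R) (s t u : R) :
  {within I, continuous f} ->
  (forall v, I v -> M (f v)) -> 0 <= s -> s <= t -> t <= u -> u <= 1 ->
  plane_hol (subpath f s u) =
  (plane_hol (subpath f s t) * plane_hol (subpath f t u))%g.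
Proof.
move=> cf fM s0 st tu u1; rewrite /plane_hol.
have e0 a b : subpath f a b 0 = f a by rewrite /subpath mulr0 addr0.
have e1 a b : subpath f a b 1 = f b by rewrite /subpath mulr1 addrC subrK.
have cpf := chart_path psi_cts cf fM.
rewrite !e0 !e1 (hol_subpath c cpf s0 st tu u1).
move: (gauge (f s)) (gauge (f t)) (gauge (f u)) => a b d.
by rewrite !mulgA mulgVK.
Qed.

Lemma abscissa_gap (x : R) : exists2 d, 0 < d &
  {in Q, forall q, `|q.1 - x| < d -> q.1 = x}.
Proof.
elim: (Q) => [|q s [d d0 IH]]; first by exists 1.
have [qx|qx] := eqVneq q.1 x.
  by exists d => // r; rewrite inE => /orP[/eqP ->//|]; exact: IH.
exists (Num.min d `|q.1 - x|).
  by rewrite lt_min d0 normr_gt0 subr_eq0.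
move=> r; rewrite inE lt_min => /orP[/eqP ->|rs] /andP[rd].
  by rewrite ltxx.
by move=> _; exact: IH rd.
Qed.

(* The convention that a point below a puncture counts as lying to its left   *)
(* comes from off_cut.                                                        *)
Definition crossing (y : R -> R) (a b : R) : pi1 R x0 :=
  gprod [seq ploop q | q <- Q & (a <= q.1 < b) && (y q.1 < q.2)].

(** Half-open intervals count each puncture once, and [Qsorted] lists those left of [b] first, as a
    noncommutative product requires. *)
Lemma crossing_cat y a b d : a <= b -> b <= d ->
  crossing y a d = (crossing y a b * crossing y b d)%g.
Proof.
move=> ab bd; rewrite /crossing -gprod_cat -map_cat; congr (gprod (map _ _)).
have tr : transitive (fun p q : R * R => p.1 < q.1).
  by move=> p q r; exact: lt_trans.
elim: (Q) Qsorted => //= q s IH; rewrite path_sortedE// => /andP[qs /IH ->].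
have [aq|qa] /= := leP a q.1; last first.
  have -> // : (b <= q.1) = false by apply/negbTE; rewrite -ltNge; lra.
have [qb|bq] /= := ltP q.1 b.
  by rewrite (lt_le_trans qb bd) /=; case: ifP.
suff -> : [seq x <- s | (a <= x.1 < b) && (y x.1 < x.2)] = [::].
  by rewrite /=; case: ifP.
apply/eqP; rewrite -size_eq0 size_filter -leqn0 leqNgt -has_count.
apply/hasPn => r /(allP qs) qr; apply/negP => /andP[/andP[_ rb] _]; lra.
Qed.

Lemma crossing_none y a b :
  {in Q, forall q, ~~ ((a <= q.1 < b) && (y q.1 < q.2))} ->
  crossing y a b = 1%g.
Proof.
move=> nQ; rewrite /crossing.
suff -> : [seq q <- Q | (a <= q.1 < b) && (y q.1 < q.2)] = [::] by [].
apply/eqP; rewrite -size_eq0 size_filter -leqn0 leqNgt -has_count.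
exact/hasPn.
Qed.

Definition graph_path (y : R -> R) (a b t : R) : R * R :=
  (a + (b - a) * t, y (a + (b - a) * t)).

Lemma Q_uniq : uniq Q.
Proof.
apply: (sorted_uniq _ _ Qsorted) => [p q r|p]; last exact: ltxx.
exact: lt_trans.
Qed.

Lemma crossing_one y a b (u : R * R) : u \in Q -> y u.1 < u.2 ->
  a <= b -> `|a - u.1| < dl -> `|b - u.1| < dl ->
  crossing y a b = if a <= u.1 < b then ploop u else 1%g.
Proof.
move=> Qu yu ab au bu; case: ifP => uab; last first.
  apply: crossing_none => q Qq; apply/negP => /andP[/andP[aq qb] _].
  have qu : q = u.
    apply: (near_eq Qu Qq); move: au bu.
    by rewrite !ltr_norml => /andP[? ?] /andP[? ?]; apply/andP; split; lra.
  by move: uab; rewrite -qu aq qb.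
rewrite /crossing.
suff -> : [seq q <- Q | (a <= q.1 < b) && (y q.1 < q.2)] = [:: u].
  by rewrite /= mulg1.
rewrite -(filter_pred1_uniq Q_uniq Qu); apply: eq_in_filter => q Qq /=.
apply/andP/eqP => [[/andP[aq qb] _]|->]; last by rewrite uab.
apply: (near_eq Qu Qq); move: au bu.
by rewrite !ltr_norml => /andP[? ?] /andP[? ?]; apply/andP; split; lra.
Qed.

(** Both sides are multiplicative over subintervals, so [itv_local_to_global] leaves a local claim.
    Near a given abscissa the graph stays in a strip without punctures, or else below or above the
    single nearby puncture. *)
Lemma plane_hol_graph (y : R -> R) (a b : R) : continuous y -> a <= b ->
  {in Q, forall q, a <= q.1 <= b -> y q.1 != q.2} ->
  plane_hol (graph_path y a b) = crossing y a b.
Proof.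
move=> cy ab yQ; pose f := graph_path y a b.
pose X (t : R) := a + (b - a) * t.
have fE t : f t = (X t, y (X t)) by [].
have cX : continuous X.
  move=> t; apply: cvgD; first exact: cvg_cst.
  by apply: cvgM; [exact: cvg_cst|exact: cvg_id].
have cf : {within I, continuous f}.
  apply: continuous_subspaceT; apply: cts_pair => // t.
  by apply: continuous_comp; [exact: cX|exact: cy].
have Xab t : I t -> a <= X t <= b.
  by rewrite I01E /X => -[? ?]; apply/andP; split; nra.
have fM t : I t -> M (f t).
  move=> /Xab abt; apply/negP => Qf.
  by have := yQ _ Qf abt; rewrite eqxx.
have Xmono s t : s <= t -> X s <= X t by rewrite /X => st; nra.
suff : plane_hol (subpath f 0 1) = crossing y (X 0) (X 1).
  rewrite /X mulr0 addr0 mulr1 (addrC a) subrK => <-; congr plane_hol.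
  by apply/funext => t; rewrite /subpath subr0 mul1r add0r.
have e0 s t : subpath f s t 0 = f s by rewrite /subpath mulr0 addr0.
have e1 s t : subpath f s t 1 = f t by rewrite /subpath mulr1 addrC subrK.
apply: (@itv_local_to_global R
  (fun s t => plane_hol (subpath f s t) = crossing y (X s) (X t))).
  move=> s t u s0 st tu u1 Qst Qtu.
  by rewrite (plane_hol_subpath cf fM s0 st tu u1) Qst Qtu -crossing_cat// Xmono.
move=> t0 t01.
have It0 : I t0 by rewrite I01E; move/andP: t01.
have near_X (e : R) : 0 < e -> exists2 d, 0 < d &
    forall s, `|s - t0| < d -> `|X s - X t0| < e.
  move=> e0'; have /cvgrPdist_lt/(_ _ e0')/nbhs_ballP[d /= d0 hd] := cX t0.
  exists d => // s st; rewrite distrC; apply: hd.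
  by rewrite /ball /= distrC.
have near_fM (D : set (R * R)) (e : R) : 0 < e -> D `<=` M -> convex2 D ->
    (forall s, I s -> `|X s - X t0| < e -> D (f s)) -> exists2 d, 0 < d &
    forall s t, 0 <= s -> s <= t -> t <= 1 -> `|s - t0| < d -> `|t - t0| < d ->
    [/\ plane_hol (subpath f s t) = seg_hol (f s) (f t), D (f s), D (f t),
      `|X s - X t0| < e & `|X t - X t0| < e].
  move=> e0' DM Dc fD; have [d d0 hd] := near_X _ e0'.
  exists d => // s t s0 st t1 sd td.
  have Is : I s by rewrite I01E; split; lra.
  have It : I t by rewrite I01E; split; lra.
  split; [|by apply: fD => //; exact: hd..|exact: hd|exact: hd].
  rewrite -(e0 s t) -(e1 s t); apply: (plane_hol_convex DM Dc).
    by apply: subpath_within.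
  move=> u Iu; apply: fD; first by apply: subpath_I.
  apply: hd; move: Iu sd td; rewrite I01E !ltr_norml => -[u0 u1].
  by move=> /andP[? ?] /andP[? ?]; apply/andP; split; nra.
have [e e_gt0 He] := abscissa_gap (X t0).
have [/hasP[u Qu /eqP ux]|/hasPn nx] :=
    boolP (has (fun q => q.1 == X t0) Q); last first.
  pose D := strip (X t0 - e) (X t0 + e).
  have nD : {in Q, forall q, ~~ (X t0 - e < q.1 < X t0 + e)}.
    move=> q Qq; apply/negP => /andP[h1 h2].
    have := nx _ Qq; rewrite He ?eqxx// ltr_norml; lra.
  have [|d d0 hd] := near_fM D e e_gt0 (strip_sub nD) (@strip_convex _ _).
    move=> s Is; rewrite fE /D /strip /= ltr_norml => /andP[? ?].
    by apply/andP; split; lra.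
  exists d => // s t s0 st t1 sd td.
  have [-> Ds Dt sX tX] := hd _ _ s0 st t1 sd td.
  rewrite (seg_hol_strip nD)// crossing_none// => q Qq.
  apply/negP => /andP[/andP[h1 h2] _]; have := nx _ Qq.
  rewrite He ?eqxx//; move: sX tX; rewrite !ltr_norml.
  by move=> /andP[? ?] /andP[? ?]; apply/andP; split; lra.
have : y u.1 != u.2 by apply: yQ => //; rewrite ux; exact: Xab.
rewrite neq_lt => /orP[yu|uy].
- have yu' : 0 < u.2 - y (X t0) by rewrite -ux; lra.
  have /cvgrPdist_lt/(_ _ yu')/nbhs_ballP[e' /= e'0 he'] := cy (X t0).
  have [|s Is|d d0 hd] := near_fM (below u) (Num.min e' dl) _
    (below_sub Qu) (@below_convex u).
  + by rewrite lt_min e'0.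
  + rewrite lt_min => /andP[se sd]; rewrite fE; split; first by rewrite /= ux.
    have := he' (X s); rewrite /ball /= distrC => /(_ se).
    by rewrite /= ltr_norml; lra.
  exists d => // s t s0 st t1 sd td.
  have [-> Ds Dt] := hd _ _ s0 st t1 sd td.
  rewrite !lt_min => /andP[_ sX] /andP[_ tX].
  rewrite (seg_hol_below Qu)// !fE /=.
  rewrite (crossing_one Qu yu (Xmono _ _ st)) ?ux//.
  have := Xmono _ _ st.
  case: (ltP (X t0) (X s)); case: (ltP (X t0) (X t)) => h1 h2 h3 /=.
  + by rewrite mulVg.
  + by exfalso; lra.
  + by rewrite mul1g.
  + by rewrite mulg1.
- have yu' : 0 < y (X t0) - u.2 by rewrite -ux; lra.
  have /cvgrPdist_lt/(_ _ yu')/nbhs_ballP[e' /= e'0 he'] := cy (X t0).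
  have [|s Is|d d0 hd] := near_fM (above u) (Num.min e' dl) _
    (above_sub Qu) (@above_convex u).
  + by rewrite lt_min e'0.
  + rewrite lt_min => /andP[se sd]; rewrite fE; split; first by rewrite /= ux.
    have := he' (X s); rewrite /ball /= distrC => /(_ se).
    by rewrite /= ltr_norml; lra.
  exists d => // s t s0 st t1 sd td.
  have [-> Ds Dt] := hd _ _ s0 st t1 sd td.
  rewrite !lt_min => /andP[_ sX] /andP[_ tX].
  rewrite (seg_hol_above Qu)// crossing_none// => q Qq.
  apply/negP => /andP[/andP[h1 h2] h3].
  have qu : q = u.
    apply: (near_eq Qu Qq); move: sX tX; rewrite ux !ltr_norml.
    by move=> /andP[? ?] /andP[? ?]; apply/andP; split; lra.
  by move: h3; rewrite qu; lra.
Qed.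

Inductive loop_group : pi1 R x0 -> Prop :=
| loop_group1 : loop_group 1%g
| loop_groupM a b : loop_group a -> loop_group b -> loop_group (a * b)%g
| loop_groupV a : loop_group a -> loop_group a^-1%g
| loop_group_ploop q : q \in Q -> loop_group (ploop q).

Lemma strip_open l r : open (strip l r).
Proof.
rewrite (_ : strip l r = fst @^-1` `]l, r[%classic).
  by apply: open_comp => [p _|]; [exact: cts_fst|exact: itv_open].
by apply/seteqP; split => p; rewrite /strip /= in_itv.
Qed.

Lemma punctured_plane_local p : M p -> exists D : set (R * R),
  [/\ nbhs p D, D `<=` M, convex2 D &
      forall a b, D a -> D b -> loop_group (seg_hol a b)].
Proof.
move=> Mp; have [e e0 He] := abscissa_gap p.1.
have dl0 := dl_gt0.
have [/hasP[u Qu /eqP ux]|/hasPn nx] :=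
    boolP (has (fun q => q.1 == p.1) Q); last first.
  exists (strip (p.1 - e) (p.1 + e)).
  have nD : {in Q, forall q, ~~ (p.1 - e < q.1 < p.1 + e)}.
    move=> q Qq; apply/negP => /andP[h1 h2].
    have := nx _ Qq; rewrite He ?eqxx// ltr_norml; lra.
  split.
  - by apply: open_nbhs_nbhs; split; [exact: strip_open|rewrite /strip /=; lra].
  - exact: strip_sub.
  - exact: strip_convex.
  - by move=> a b Da Db; rewrite (seg_hol_strip nD)//; exact: loop_group1.
have oS (O : set R) : open O -> open (snd @^-1` O : set (R * R)).
  by move=> oO; apply: open_comp => // q _; exact: cts_snd.
have stripE (q : R * R) : `|q.1 - u.1| < dl <-> strip (u.1 - dl) (u.1 + dl) q.
  by rewrite /strip /= ltr_distl.
have pu : p.2 != u.2.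
  apply/negP => /eqP pu2; move/negP: (Mp : p \notin Q); apply.
  suff -> : p = u by [].
  by move: pu2 ux; case: (p) => a b; case: (u) => a' b' /= -> ->.
move: pu; rewrite neq_lt => /orP[pu|up].
- exists (below u); split.
  + apply: open_nbhs_nbhs; split; last first.
      by split=> //; rewrite ux subrr normr0.
    rewrite (_ : below u = strip (u.1 - dl) (u.1 + dl) `&`
      snd @^-1` `]-oo, u.2[%classic).
      by apply: openI; [exact: strip_open|apply: oS; exact: lray_open].
    apply/seteqP; split => q; rewrite /below /=.
      by move=> [/stripE ? ?]; split=> //=; rewrite in_itv.
    by move=> [/stripE ? /=]; rewrite in_itv.
  + exact: below_sub.
  + exact: below_convex.
  + move=> a b Da Db; rewrite (seg_hol_below Qu Da Db).
    by apply: loop_groupM; case: ifP => _;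
      do ?[exact: loop_group1|exact: loop_group_ploop|apply: loop_groupV].
- exists (above u); split.
  + apply: open_nbhs_nbhs; split; last first.
      by split=> //; rewrite ux subrr normr0.
    rewrite (_ : above u = strip (u.1 - dl) (u.1 + dl) `&`
      snd @^-1` `]u.2, +oo[%classic).
      by apply: openI; [exact: strip_open|apply: oS; exact: rray_open].
    apply/seteqP; split => q; rewrite /above /=.
      by move=> [/stripE ? ?]; split=> //=; rewrite in_itv /= andbT.
    by move=> [/stripE ? /=]; rewrite in_itv /= andbT.
  + exact: above_sub.
  + exact: above_convex.
  + by move=> a b Da Db; rewrite (seg_hol_above Qu Da Db); exact: loop_group1.
Qed.

(** * Generation of the fundamental group by loops around punctures *)

Section generation.
Variables (pr : T -> R * R) (E : set T).
Hypothesis prK : forall t, ~ E t -> M (pr t) /\ psi (pr t) = t.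
Hypothesis E_closed : closed E.
Hypothesis pr_cts : forall t, ~ E t -> {for t, continuous pr}.

Section with_gauge.
Variable gE : pi1 R x0.

(** No descent in the plane reaches [E]; there [gE] stands in for the gauge, to be chosen in
    [surface_hol_generated]. *)
Definition surface_gauge (t : T) : pi1 R x0 :=
  if pselect (E t) then gE else gauge (pr t).

Definition surface_hol (f : R -> T) : pi1 R x0 :=
  (surface_gauge (f 0%R) * hol c f * (surface_gauge (f 1%R))^-1)%g.

Lemma surface_gaugeE t : ~ E t -> surface_gauge t = gauge (pr t).
Proof. by rewrite /surface_gauge; case: pselect. Qed.

Lemma surface_hol_subpath (f : R -> T) (s t u : R) : {within I, continuous f} ->
  0 <= s -> s <= t -> t <= u -> u <= 1 ->
  surface_hol (subpath f s u) =
  (surface_hol (subpath f s t) * surface_hol (subpath f t u))%g.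
Proof.
move=> cf s0 st tu u1; rewrite /surface_hol.
have e0 a b : subpath f a b 0 = f a by rewrite /subpath mulr0 addr0.
have e1 a b : subpath f a b 1 = f b by rewrite /subpath mulr1 addrC subrK.
rewrite !e0 !e1 (hol_subpath c cf s0 st tu u1).
move: (surface_gauge (f s)) (surface_gauge (f t)) (surface_gauge (f u)).
move=> a b d.
by rewrite !mulgA mulgVK.
Qed.

Lemma within_near (f : R -> T) (x : R) (N : set T) :
  {within I, continuous f} -> I x -> nbhs (f x) N ->
  exists2 d, 0 < d & forall s, I s -> `|s - x| < d -> N (f s).
Proof.
move=> /subspace_continuousP cf Ix Nx.
have /nbhs_ballP[d /= d0 hd] := cf x Ix _ Nx.
by exists d => // s Is sd; apply: hd => //; rewrite /ball /= distrC.
Qed.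

Lemma subpath_near (f : R -> T) (x d : R) (N : set T) :
  (forall s, I s -> `|s - x| < d -> N (f s)) ->
  forall s t, 0 <= s -> s <= t -> t <= 1 -> `|s - x| < d -> `|t - x| < d ->
  forall u, I u -> N (subpath f s t u).
Proof.
move=> hd s t s0 st t1 sd td u Iu; apply: hd; first exact: subpath_I.
move: Iu sd td; rewrite I01E !ltr_norml => -[u0 u1].
by move=> /andP[? ?] /andP[? ?]; apply/andP; split; nra.
Qed.

Lemma surface_hol_local (f : R -> T) (x : R) : {within I, continuous f} -> I x ->
  ~ E (f x) -> exists2 d, 0 < d & forall s t,
    0 <= s -> s <= t -> t <= 1 -> `|s - x| < d -> `|t - x| < d ->
    loop_group (surface_hol (subpath f s t)).
Proof.
move=> cf Ix nEx; have [Mx _] := prK nEx.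
have [D [pD DM Dc Dg]] := punctured_plane_local Mx.
have nN : nbhs (f x) (~` E `&` pr @^-1` D).
  apply: filterI; last exact: (pr_cts nEx).
  by apply: open_nbhs_nbhs; split=> //; exact: closed_openC.
have [d d0 hd] := within_near cf Ix nN; exists d => // s t s0 st t1 sd td.
have fN := subpath_near hd s0 st t1 sd td.
have cg : {within I, continuous (subpath f s t)} by exact: subpath_within.
have cpg : {within I, continuous (pr \o subpath f s t)}.
  apply: (within_comp (B := ~` E) cg); last by move=> u /fN[].
  by apply/continuous_in_subspaceT => u /set_mem; exact: pr_cts.
have I0 : I 0 by rewrite I01E; split; lra.
have I1 : I 1 by rewrite I01E; split; lra.
rewrite /surface_hol !surface_gaugeE; [|exact: (fN _ I1).1|exact: (fN _ I0).1].
rewrite (@hol_ext _ _ _ c _ (psi \o (pr \o subpath f s t)))//; last first.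
  by move=> u /fN[nE _] /=; rewrite (prK nE).2.
rewrite (chart_holE c psi_cts DM Dc cpg); last by move=> u /fN[].
by apply: Dg; [exact: (fN _ I0).2|exact: (fN _ I1).2].
Qed.

Lemma subpath01 (f : R -> T) : subpath f 0 1 = f.
Proof. by apply/funext => t; rewrite /subpath subr0 mul1r add0r. Qed.

Lemma surface_hol_off_pole (f : R -> T) : {within I, continuous f} ->
  (forall t, I t -> ~ E (f t)) -> loop_group (surface_hol f).
Proof.
move=> cf fE; rewrite -(subpath01 f).
apply: (@itv_local_to_global R
  (fun s t => loop_group (surface_hol (subpath f s t)))).
  move=> s t u s0 st tu u1 Qst Qtu; rewrite (surface_hol_subpath cf s0 st tu u1).
  exact: loop_groupM.
by move=> x /andP[x0' x1]; apply: surface_hol_local; rewrite ?I01E//; apply: fE;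
  rewrite I01E.
Qed.

End with_gauge.

(** Here [r] is the square of the radius. *)
Definition disc (r : R) : set (R * R) := [set p | p.1 ^+ 2 + p.2 ^+ 2 < r].

Lemma disc_convex r : convex2 (disc r).
Proof.
move=> p q t; rewrite /disc /seg /= I01E => pr' qr [t0 t1].
have := conv_lt pr' qr t0 t1; apply: le_lt_trans.
rewrite -subr_ge0.
rewrite (_ : _ - _ = t * (1 - t) * ((p.1 - q.1) ^+ 2 + (p.2 - q.2) ^+ 2)).
  apply: mulr_ge0; last by apply: addr_ge0; exact: sqr_ge0.
  by apply: mulr_ge0 => //; rewrite subr_ge0.
by ring.
Qed.

(** A convex chart at the point missed by the plane; [om] need invert [tau] only near [t0]. *)
Definition cap_chart (t0 : T) : Prop :=
  exists (tau : R * R -> T) (om : T -> R * R) (r : R),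
    [/\ 0 < r, {within disc r, continuous tau}, tau 0 = t0,
        \forall t \near t0, [/\ disc r (om t), tau (om t) = t &
          {for t, continuous om}] &
        forall w, disc r w -> w <> 0 -> ~ E (tau w)].

Hypothesis E_one : forall t t', E t -> E t' -> t = t'.
Hypothesis E_cap : forall t, E t -> cap_chart t.

(** Filling in the pole adds no generator. In the cap, a segment avoiding the centre is a path off
    the pole, whose holonomy is already in the loop group; [gE] is chosen so that the segment from
    [w0] to the centre is trivial, and every other segment decomposes into such ones. *)
Lemma surface_hol_generated : exists gE, forall f : R -> T,
  {within I, continuous f} -> loop_group (surface_hol gE f).
Proof.
have [[t0 Et0]|nE] := pselect (exists t, E t); last first.
  exists 1%g => f cf; apply: surface_hol_off_pole => // t _ Et.
  by apply: nE; exists (f t).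
have [tau [om [r [r0 ctau tau0 near_om tauE]]]] := E_cap Et0.
(* The cap at 1 ensures (rr / 2)^2 < r, as [r] is a squared radius. *)
pose rr := Num.min r 1.
have rr0 : 0 < rr by rewrite lt_min r0 ltr01.
have rr1 : rr <= 1 by rewrite ge_min lexx orbT.
have rrr : rr <= r by rewrite ge_min lexx.
pose w0 : R * R := (rr / 2, 0).
have Dw0 : disc r w0 by rewrite /disc /=; nra.
have nw0 : w0 <> 0 by case => /eqP; rewrite mulf_eq0; lra.
have D0 : disc r 0 by rewrite /disc /= expr0n /= addr0.
pose hV := chart_hol c tau.
pose gE := (gauge (pr (tau w0)) * hV w0 0%R)%g.
pose gV w := surface_gauge gE (tau w).
pose gHV p q := (gV p * hV p q * (gV q)^-1)%g.
have DD : disc r `<=` disc r by [].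
have Dc := @disc_convex r.
have tri p q s : disc r p -> disc r q -> disc r s ->
    (gHV p q * gHV q s)%g = gHV p s.
  move=> Dp Dq Ds; rewrite /gHV -[hV p s](chart_hol_tri c ctau DD Dc Dp Dq Ds).
  by move: (gV p) (gV q) (gV s) => a b d; rewrite !mulgA mulgVK.
have inv p q : disc r p -> disc r q -> gHV q p = (gHV p q)^-1%g.
  move=> Dp Dq; rewrite /gHV [hV q p](chart_hol_sym c ctau DD Dc Dp Dq).
  by rewrite !invgM invgK mulgA.
(* A nonzero determinant means that [p] and [q] are linearly independent, so their segment misses
   the centre. *)
have off p q : disc r p -> disc r q -> p.1 * q.2 - p.2 * q.1 != 0 ->
    loop_group (gHV p q).
  move=> Dp Dq pq.
  have := @surface_hol_off_pole gE (tau \o seg p q).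
  rewrite /surface_hol /= seg0 seg1; apply.
    apply: (chart_path ctau); first exact: seg_within.
    by move=> t It; exact: Dc.
  move=> t It; apply: tauE; first exact: Dc.
  rewrite /seg => -[e1 e2]; move/eqP: pq; apply.
  have h1 : t * (p.1 * q.2 - p.2 * q.1) = 0.
    transitivity (p.1 * (p.2 + t * (q.2 - p.2)) -
      p.2 * (p.1 + t * (q.1 - p.1))); first by ring.
    by rewrite e1 e2 !mulr0 subr0.
  have h2 : (1 - t) * (p.1 * q.2 - p.2 * q.1) = 0.
    transitivity (q.2 * (p.1 + t * (q.1 - p.1)) -
      q.1 * (p.2 + t * (q.2 - p.2))); first by ring.
    by rewrite e1 e2 !mulr0 subr0.
  by lra.
have sq_neq0 (p : R * R) : p <> 0 -> p.1 ^+ 2 + p.2 ^+ 2 != 0.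
  by move=> p0; apply: contra_notN p0 => /eqP/sqr_sum_eq0.
have off0 p q : disc r p -> disc r q -> p <> 0 -> q <> 0 ->
    loop_group (gHV p q).
  move=> Dp Dq p0 q0.
  have [pq|] := eqVneq (p.1 * q.2 - p.2 * q.1) 0; last exact: off.
  (* A quarter turn of [p]: it is independent of [p], and of [q] since [q] is parallel to [p]. *)
  pose w : R * R := (- p.2, p.1).
  have Dw : disc r w by rewrite /disc /w /= sqrrN addrC.
  rewrite -(tri _ w)//; apply: loop_groupM; apply: off => //=.
    by rewrite mulrN opprK -!expr2 sq_neq0.
  apply: (contraNN _ (mulf_neq0 (sq_neq0 _ p0) (sq_neq0 _ q0))) => /eqP wq.
  apply/eqP; transitivity ((p.1 * q.2 - p.2 * q.1) ^+ 2 +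
    (- p.2 * q.2 - p.1 * q.1) ^+ 2); first by ring.
  by rewrite pq wq expr0n addr0.
have w00 : gHV w0 0 = 1%g.
  rewrite /gHV /gV surface_gaugeE; last exact: tauE.
  by rewrite tau0 /surface_gauge; case: pselect => [Et|//]; rewrite /gE mulgV.
have offw p : disc r p -> loop_group (gHV w0 p).
  move=> Dp; have [->|/eqP p0] := eqVneq p 0; last exact: off0.
  by rewrite w00; exact: loop_group1.
have all_off p q : disc r p -> disc r q -> loop_group (gHV p q).
  move=> Dp Dq; rewrite -(tri _ w0)//; apply: loop_groupM; last exact: offw.
  by rewrite inv//; apply/loop_groupV/offw.
exists gE => f cf; rewrite -(subpath01 f).
apply: (@itv_local_to_global R
  (fun s t => loop_group (surface_hol gE (subpath f s t)))).
  move=> s t u s0 st tu u1 Qst Qtu.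
  rewrite (surface_hol_subpath gE cf s0 st tu u1).
  exact: loop_groupM.
move=> x /andP[x0' x1]; have Ix : I x by rewrite I01E.
have [Efx|nEfx] := pselect (E (f x)); last exact: surface_hol_local.
have fx : f x = t0 by exact: E_one.
pose N := [set t | [/\ disc r (om t), tau (om t) = t & {for t, continuous om}]].
have near_N : nbhs (f x) N by rewrite fx.
have [d d0 hd] := within_near cf Ix near_N; exists d => // s t s0 st t1 sd td.
have fN := subpath_near (N := N) hd s0 st t1 sd td.
have cg : {within I, continuous (subpath f s t)} by exact: subpath_within.
have cpg : {within I, continuous (om \o subpath f s t)}.
  pose B := [set t | {for t, continuous om}].
  apply: (within_comp (B := B) cg); last by move=> u /fN[].
  by apply/continuous_in_subspaceT => u /set_mem.
have I0 : I 0 by rewrite I01E; split; lra.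
have I1 : I 1 by rewrite I01E; split; lra.
rewrite /surface_hol (@hol_ext _ _ _ c _ (tau \o (om \o subpath f s t)))//;
  last first.
  by move=> u /fN[_ e _] /=; rewrite e.
rewrite (chart_holE c ctau DD Dc cpg); last by move=> u /fN[].
have [Da ea _] := fN _ I0; have [Db eb _] := fN _ I1.
by have := all_off _ _ Da Db; rewrite /gHV /gV ea eb.
Qed.

(** For a loop at [x0], [holc] conjugates by the class of [c x0] and [surface_hol] by the gauge at
    [x0]; [g] combines the two. *)
Lemma pi1_generated : exists g : pi1 R x0, forall a : pi1 R x0,
  loop_group (g * a * g^-1)%g.
Proof.
have [gE gen] := surface_hol_generated.
exists (surface_gauge gE x0 * pi1_class (c x0))%g => a.
rewrite -(pi1_class_repr a).
have /gen : {within I, continuous (repr a : cpath R x0 x0)}.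
  exact: path_cts.
rewrite /surface_hol path_at0 path_at1 (holE c (repr a)) /holc.
rewrite -pi1_mulE -(pi1_mulE (c x0)) -pi1_invE.
by rewrite invgM !mulgA.
Qed.

End generation.

(** * Loops in sheared pairs of pants *)

Section pants.
Variables (pr : T -> R * R) (E : set T).
Hypothesis prK : forall t, ~ E t -> M (pr t) /\ psi (pr t) = t.
Hypothesis pr_cts : forall t, ~ E t -> {for t, continuous pr}.
Hypothesis psiK : forall p, M p -> ~ E (psi p) /\ pr (psi p) = p.
Variables (a b : R) (phi : R -> R) (S1 S2 : pred (R * R)).
Hypothesis a_gt0 : 0 < a.
Hypothesis phi_cts : continuous phi.
Hypothesis S1_in : {in Q, forall q, S1 q -> - 5 / 2 <= a * q.1 + b <= - 3 / 2}.
Hypothesis S2_in : {in Q, forall q, S2 q -> 3 / 2 <= a * q.1 + b <= 5 / 2}.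
Hypothesis phi_in : {in Q, forall q, S1 q || S2 q -> phi q.1 = q.2}.
Hypothesis phi_out : {in Q, forall q, ~~ (S1 q || S2 q) -> phi q.1 = q.2 + 10}.

(** The punctures in [S1] and [S2] land on the X-axis within 1/2 of the centres -2 and 2 of the
    holes; the others land at ordinate -10, outside the disc of radius 4. *)
Definition straighten (p : R * R) : R * R := (a * p.1 + b, p.2 - phi p.1).
Definition unstraighten (z : R * R) : R * R :=
  ((z.1 - b) / a, z.2 + phi ((z.1 - b) / a)).

Lemma straightenK : cancel straighten unstraighten.
Proof.
move=> [x y]; rewrite /straighten /unstraighten /=.
have -> : (a * x + b - b) / a = x by field; rewrite gt_eqF.
by rewrite subrK.
Qed.

Lemma unstraightenK : cancel unstraighten straighten.
Proof.
move=> [x y]; rewrite /straighten /unstraighten /=; congr (_, _).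
  by field; rewrite gt_eqF.
by rewrite addrK.
Qed.

Lemma straighten_cts : continuous straighten.
Proof.
apply: cts_pair => p; last first.
  apply: cvgB; first exact: cts_snd.
  by apply: continuous_comp; [exact: cts_fst|exact: phi_cts].
apply: cvgD; last exact: cvg_cst.
by apply: cvgM; [exact: cvg_cst|exact: cts_fst].
Qed.

Lemma unstraighten_cts : continuous unstraighten.
Proof.
have c1 : continuous (fun z : R * R => (z.1 - b) / a).
  move=> z; apply: cvgM; last exact: cvg_cst.
  by apply: cvgB; [exact: cts_fst|exact: cvg_cst].
apply: cts_pair => // z; apply: cvgD; first exact: cts_snd.
by apply: continuous_comp; [exact: c1|exact: phi_cts].
Qed.

Lemma unstraighten_pants z : @standard_pants R z -> M (unstraighten z).
Proof.
move=> [z1 z2 z3]; apply/negP; set q := unstraighten z => Qq.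
have zE : z = straighten q by rewrite unstraightenK.
have [e1 e2] : z.1 = a * q.1 + b /\ z.2 = q.2 - phi q.1 by rewrite zE.
have [S12|nS] := boolP (S1 q || S2 q); last first.
  move: (phi_out Qq nS) => hp; have : z.2 = - 10 by lra.
  by move=> e; move: z1; rewrite e; nra.
have z20 : z.2 = 0 by rewrite e2 phi_in// subrr.
case/orP: S12 => [/(S1_in Qq)|/(S2_in Qq)] /andP[]; rewrite -e1 => ? ?.
  by move: z2; rewrite z20; nra.
by move: z3; rewrite z20; nra.
Qed.

Definition pants_set : set T :=
  [set t | ~ E t /\ @standard_pants R (straighten (pr t))].

Lemma pants_set_psi z : @standard_pants R z -> pants_set (psi (unstraighten z)).
Proof.
move=> zP; have [nE prE] := psiK (unstraighten_pants zP).
by split=> //; rewrite prE unstraightenK.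
Qed.

Lemma psi_unstraighten_cts : {within @standard_pants R,
  continuous (psi \o unstraighten)}.
Proof.
apply: (within_comp _ psi_cts); last exact: unstraighten_pants.
by apply: continuous_subspaceT; exact: unstraighten_cts.
Qed.

Lemma pants_setP : pair_of_pants R pants_set.
Proof.
pose F (t : pants_set) : @standard_pants R := SigSub (mem_set (set_valP t).2).
pose G (z : @standard_pants R) : pants_set :=
  SigSub (mem_set (pants_set_psi (set_valP z))).
exists F, G; split.
- apply: continuous_to_sub.
  apply: (@continuous_from_sub _ _ pants_set (straighten \o pr)).
  apply/continuous_in_subspaceT => t /set_mem [nE _].
  apply: continuous_comp; first exact: pr_cts.
  exact: straighten_cts.
- apply: continuous_to_sub.
  exact: (continuous_from_sub psi_unstraighten_cts).
- move=> t; apply: val_inj => /=; rewrite straightenK.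
  exact: (prK (set_valP t).1).2.
- move=> z; apply: val_inj => /=.
  by rewrite (psiK (unstraighten_pants (set_valP z))).2 unstraightenK.
Qed.

(** [unstraighten] sends graphs to graphs, and those coming from the standard pants avoid the
    punctures, so [plane_hol_graph] reads off the holonomy. *)
Lemma pants_graph_path (Y : R -> R) (X0 X1 : R) (p0 p1 : pants_set) :
  continuous Y -> X0 <= X1 ->
  (forall X, X0 <= X <= X1 -> @standard_pants R (X, Y X)) ->
  set_val p0 = psi (unstraighten (X0, Y X0)) ->
  set_val p1 = psi (unstraighten (X1, Y X1)) ->
  exists g : cpath R p0 p1,
    holc c (Defs.path_map (@initial_continuous pants_set T set_val) g) =
    ((gauge (pr (set_val p0)))^-1 *
     crossing (fun x => (Y (a * x + b) + phi x)%R)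
       ((X0 - b) / a)%R ((X1 - b) / a)%R * gauge (pr (set_val p1)))%g.
Proof.
move=> cY X01 Ypants e0 e1.
pose y x := Y (a * x + b) + phi x.
have cy : continuous y.
  move=> x; apply: cvgD; last exact: phi_cts.
  by apply: continuous_comp; [exact: affine_cts|exact: cY].
pose x0' := (X0 - b) / a; pose x1 := (X1 - b) / a.
have x01 : x0' <= x1 by rewrite ler_pM2r ?invr_gt0// lerB.
have y_unflat X : unstraighten (X, Y X) = ((X - b) / a, y ((X - b) / a)).
  by rewrite /unstraighten /y /=; congr (_, Y _ + _); field; rewrite gt_eqF.
have itvE x : x0' <= x <= x1 = (X0 <= a * x + b <= X1).
  by rewrite ler_pdivrMr// ler_pdivlMr// mulrC lerBlDr lerBrDr.
have yQ : {in Q, forall q, x0' <= q.1 <= x1 -> y q.1 != q.2}.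
  move=> q Qq; rewrite itvE => /Ypants /unstraighten_pants Mq.
  apply/negP => /eqP yq; move/negP: (Mq : _ \notin Q); apply.
  rewrite y_unflat addrK [a * _]mulrC mulfK ?gt_eqF// yq.
  by move: Qq; case: (q).
have /esym crE := plane_hol_graph cy x01 yQ; rewrite /plane_hol in crE.
pose f t := psi (graph_path y x0' x1 t).
have fE t : graph_path y x0' x1 t =
    unstraighten (X0 + (X1 - X0) * t, Y (X0 + (X1 - X0) * t)).
  rewrite y_unflat /graph_path.
  by congr (_, y _); rewrite /x0' /x1; field; rewrite gt_eqF.
have fX t : I t -> X0 <= X0 + (X1 - X0) * t <= X1.
  by rewrite I01E => -[? ?]; apply/andP; split; nra.
have cf : {within I, continuous f}.
  have -> : f = (psi \o unstraighten) \o
      (fun t => (X0 + (X1 - X0) * t, Y (X0 + (X1 - X0) * t))).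
    by apply/funext => t; rewrite /f fE.
  apply: (within_comp _ psi_unstraighten_cts); last by move=> t /fX /Ypants.
  have cX : continuous (fun t => X0 + (X1 - X0) * t).
    move=> t; apply: cvgD; first exact: cvg_cst.
    by apply: cvgM; [exact: cvg_cst|exact: cvg_id].
  apply: continuous_subspaceT; apply: cts_pair => // t.
  by apply: continuous_comp; [exact: cX|exact: cY].
have I0 : I 0 by rewrite I01E; split; lra.
have I1 : I 1 by rewrite I01E; split; lra.
have [g gE] : exists g : cpath R p0 p1, forall t, I t -> set_val (g t) = f t.
  apply: cpath_to_sub => //.
  - by move=> t It; rewrite /f fE; apply/pants_set_psi/Ypants/fX.
  - by rewrite e0 /f fE mulr0 addr0.
  - by rewrite e1 /f fE mulr1 addrC subrK.
exists g; rewrite -holE.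
have -> : hol c (Defs.path_map (@initial_continuous pants_set T set_val) g) =
    hol c f by apply/esym/hol_ext => // t It; rewrite -gE.
have pr0 : pr (set_val p0) = graph_path y x0' x1 0.
  rewrite e0 fE mulr0 addr0 (psiK _).2//; apply/unstraighten_pants/Ypants.
  by rewrite lexx.
have pr1 : pr (set_val p1) = graph_path y x0' x1 1.
  rewrite e1 fE mulr1 addrC subrK (psiK _).2//; apply/unstraighten_pants/Ypants.
  by rewrite lexx andbT.
rewrite pr0 pr1 [crossing _ _ _]crE.
move: (gauge _) (gauge _) => u v.
by rewrite !mulgA mulVg mul1g mulgVK.
Qed.

(* The diamonds |X - s| + |Y| = 2, for s = -2 and s = 2, surround the two     *)
(* holes of the standard pants and meet at the origin.                        *)
Definition diamond (e s X : R) : R := e * (2 - `|X - s|).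

Lemma diamond_cts e s : continuous (diamond e s).
Proof.
move=> X; apply: cvgM; first exact: cvg_cst.
apply: cvgB; first exact: cvg_cst.
apply: (@cvg_norm _ _ _ _ _ (fun x : R => x - s)).
by apply: cvgB; [exact: cvg_id|exact: cvg_cst].
Qed.

Lemma diamond_pants e s X : e ^+ 2 = 1 -> s = 2 \/ s = - 2 ->
  s - 2 <= X <= s + 2 -> @standard_pants R (X, diamond e s X).
Proof.
move=> e1 s2 /andP[Xl Xr].
have Y2 : diamond e s X ^+ 2 = (2 - `|X - s|) ^+ 2.
  by rewrite /diamond exprMn e1 mul1r.
rewrite /standard_pants /= Y2; case: s2 Xl Xr => -> Xl Xr.
- have X0 : 0 <= X * (4 - X) by apply: mulr_ge0; lra.
  have := sqr_ge0 (X - 3); have := sqr_ge0 (X - 1); have := sqr_ge0 X.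
  by case: (ger0P (X - 2)) => ? ? ? ?; split; nra.
- have X0 : 0 <= (X + 4) * (- X) by apply: mulr_ge0; lra.
  have := sqr_ge0 (X + 3); have := sqr_ge0 (X + 1); have := sqr_ge0 X.
  by case: (ger0P (X - - 2)) => ? ? ? ?; split; nra.
Qed.

Lemma diamond_end e s : diamond e s (s - 2) = 0 /\ diamond e s (s + 2) = 0.
Proof.
rewrite /diamond; split.
- by rewrite (_ : s - 2 - s = - 2) ?normrN ?ger0_norm ?subrr ?mulr0//; lra.
- by rewrite (_ : s + 2 - s = 2) ?ger0_norm ?subrr ?mulr0//; lra.
Qed.

Lemma S12_cases q : q \in Q -> [\/ [/\ S1 q, ~~ S2 q, phi q.1 = q.2 &
      - 5 / 2 <= a * q.1 + b <= - 3 / 2],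
    [/\ ~~ S1 q, S2 q, phi q.1 = q.2 & 3 / 2 <= a * q.1 + b <= 5 / 2] |
    [/\ ~~ S1 q, ~~ S2 q & phi q.1 = q.2 + 10]].
Proof.
move=> Qq; have := S1_in Qq; have := S2_in Qq.
have := phi_in Qq; have := phi_out Qq.
case: (S1 q); case: (S2 q) => /= h1 h2 h3 h4.
- have /andP[? ?] := h3 isT; have /andP[? ?] := h4 isT; lra.
- by apply: Or31; split=> //; [exact: h2|exact: h4].
- by apply: Or32; split=> //; [exact: h2|exact: h3].
- by apply: Or33; split=> //; exact: h1.
Qed.

Lemma crossing_diamond e s (S : pred (R * R)) :
  {in Q, forall q, (s - 2 <= a * q.1 + b < s + 2) &&
    (diamond e s (a * q.1 + b) + phi q.1 < q.2) = S q} ->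
  crossing (fun x => diamond e s (a * x + b) + phi x)
    ((s - 2 - b) / a) ((s + 2 - b) / a) = gprod [seq ploop q | q <- Q & S q].
Proof.
move=> H; rewrite /crossing; congr (gprod (map _ _)).
apply: eq_in_filter => q Qq; rewrite -H//.
by rewrite ler_pdivrMr// ltr_pdivlMr// [q.1 * a]mulrC lerBlDr ltrBrDr.
Qed.

Lemma diamond_path e s (S : pred (R * R)) (p q : pants_set) :
  e ^+ 2 = 1 -> s = 2 \/ s = - 2 ->
  set_val p = psi (unstraighten (s - 2, 0)) ->
  set_val q = psi (unstraighten (s + 2, 0)) ->
  {in Q, forall q, (s - 2 <= a * q.1 + b < s + 2) &&
    (diamond e s (a * q.1 + b) + phi q.1 < q.2) = S q} ->
  exists g : cpath R p q,
    holc c (Defs.path_map (@initial_continuous pants_set T set_val) g) =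
    ((gauge (pr (set_val p)))^-1 * gprod [seq ploop q | q <- Q & S q] *
     gauge (pr (set_val q)))%g.
Proof.
move=> e1 s2 pE qE H; rewrite -(crossing_diamond H).
apply: pants_graph_path; rewrite ?(diamond_end e s).1 ?(diamond_end e s).2//.
- exact: diamond_cts.
- lra.
- by move=> X; apply: diamond_pants.
Qed.

(** In straightened coordinates the punctures of the holes have ordinate 0 and the others -10. The
    upper half of a diamond passes below none of them; the lower half, at heights between -2 and 0,
    passes below exactly those of its own hole. *)
Lemma diamond_upper s : s = 2 \/ s = - 2 ->
  {in Q, forall q, (s - 2 <= a * q.1 + b < s + 2) &&
    (diamond 1 s (a * q.1 + b) + phi q.1 < q.2) = xpred0 q}.
Proof.
move=> s2 q Qq; apply/negP => /andP[/andP[l r]]; rewrite /diamond => h.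
case: (ger0P (a * q.1 + b - s)) h => ? h; case: s2 => s2; subst s;
  by case: (S12_cases Qq) => [[_ _ e /andP[? ?]]|[_ _ e /andP[? ?]]|[_ _ e]];
    lra.
Qed.

Lemma diamond_lower_left :
  {in Q, forall q, (- 2 - 2 <= a * q.1 + b < - 2 + 2) &&
    (diamond (- 1) (- 2) (a * q.1 + b) + phi q.1 < q.2) = S1 q}.
Proof.
move=> q Qq; rewrite /diamond.
case: (S12_cases Qq) => [[-> _ e /andP[? ?]]|
  [/negbTE -> _ e /andP[? ?]]|[/negbTE -> _ e]].
- apply/andP; split; first by apply/andP; split; lra.
  by case: (ger0P (a * q.1 + b - - 2)) => ?; lra.
- by apply/negP => /andP[/andP[? ?] _]; lra.
- apply/negP => /andP[/andP[? ?]].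
  by case: (ger0P (a * q.1 + b - - 2)) => ? ?; lra.
Qed.

Lemma diamond_lower_right :
  {in Q, forall q, (2 - 2 <= a * q.1 + b < 2 + 2) &&
    (diamond (- 1) 2 (a * q.1 + b) + phi q.1 < q.2) = S2 q}.
Proof.
move=> q Qq; rewrite /diamond.
case: (S12_cases Qq) => [[_ /negbTE -> e /andP[? ?]]|
  [_ -> e /andP[? ?]]|[_ /negbTE -> e]].
- by apply/negP => /andP[/andP[? ?] _]; lra.
- apply/andP; split; first by apply/andP; split; lra.
  by case: (ger0P (a * q.1 + b - 2)) => ?; lra.
- apply/negP => /andP[/andP[? ?]].
  by case: (ger0P (a * q.1 + b - 2)) => ? ?; lra.
Qed.

(** Each diamond is traversed along its lower half and back along its upper half, which contributes
    nothing. Both loops are based at the common vertex, so the same gauge conjugates both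
    products. *)
Lemma pants_loops : exists (p : pants_set) (g : pi1 R x0),
  pi1_sub_image (c (set_val p))
    (g^-1 * gprod [seq ploop q | q <- Q & S1 q] * g)%g /\
  pi1_sub_image (c (set_val p))
    (g^-1 * gprod [seq ploop q | q <- Q & S2 q] * g)%g.
Proof.
have mk X : X = - 2 - 2 \/ X = 0 \/ X = 2 + 2 ->
    exists p : pants_set, set_val p = psi (unstraighten (X, 0)).
  move=> HX; have zP : @standard_pants R (X, 0).
    by rewrite /standard_pants /=; split; case: HX => [->|[->|->]]; lra.
  by exists (SigSub (mem_set (pants_set_psi zP))).
have [p1 p1E] := mk (- 2 - 2) (or_introl erefl).
have [p0 p0E] := mk 0 (or_intror (or_introl erefl)).
have [p2 p2E] := mk (2 + 2) (or_intror (or_intror erefl)).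
have l0 : - 2 + 2 = 0 :> R by lra.
have r0 : 2 - 2 = 0 :> R by lra.
have e1 : 1 ^+ 2 = 1 :> R by rewrite expr1n.
have e2 : (- 1) ^+ 2 = 1 :> R by rewrite sqrrN expr1n.
have sl : - 2 = 2 :> R \/ - 2 = - 2 :> R by right.
have sr : 2 = 2 :> R \/ 2 = - 2 :> R by left.
have p0l : set_val p0 = psi (unstraighten (- 2 + 2, 0)) by rewrite l0.
have p0r : set_val p0 = psi (unstraighten (2 - 2, 0)) by rewrite r0.
have [u1 u1E] :=
  @diamond_path 1 (- 2) xpred0 p1 p0 e1 sl p1E p0l (diamond_upper sl).
have [v1 v1E] :=
  @diamond_path (- 1) (- 2) S1 p1 p0 e2 sl p1E p0l diamond_lower_left.
have [u2 u2E] :=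
  @diamond_path 1 2 xpred0 p0 p2 e1 sr p0r p2E (diamond_upper sr).
have [v2 v2E] :=
  @diamond_path (- 1) 2 S2 p0 p2 e2 sr p0r p2E diamond_lower_right.
exists p0, (gauge (pr (set_val p0))); split.
- have := @pi1_sub_image_loop _ _ _ c _ _ (path_cat (path_rev u1) v1).
  rewrite holc_incl_cat holc_incl_rev u1E v1E filter_pred0 /= mulg1.
  move: (gauge _) (gauge _) => g1 g0.
  by rewrite invgM invgK !mulgA mulgK.
- have := @pi1_sub_image_loop _ _ _ c _ _ (path_cat v2 (path_rev u2)).
  rewrite holc_incl_cat holc_incl_rev u2E v2E filter_pred0 /= mulg1.
  move: (gauge _) (gauge _) => g1 g0.
  by rewrite invgM invgK !mulgA mulgK.
Qed.

End pants.

(** Newton interpolation at distinct abscissas: [b] is 1 at the new node and 0 at the earlier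
    ones. *)
Lemma interpolation (v : R * R -> R) : exists2 phi : R -> R,
  continuous phi & {in Q, forall q, phi q.1 = v q}.
Proof.
elim: (Q) Qsorted => [|q s IH] /=.
  by exists (fun=> 0) => // x; exact: cvg_cst.
have tr : transitive (fun p q : R * R => p.1 < q.1).
  by move=> p1 p2 p3; exact: lt_trans.
rewrite path_sortedE// => /andP[/allP qs /IH[phi cphi phiE]].
have [b [cb bq bs]] : exists b : R -> R,
    [/\ continuous b, b q.1 = 1 & {in s, forall r, b r.1 = 0}].
  elim: (s) qs => [|r t IHt] qt.
    by exists (fun=> 1); split=> // x; exact: cvg_cst.
  have [x xt|b [cb bq bt]] := IHt; first by apply: qt; rewrite inE xt orbT.
  have qr : q.1 - r.1 != 0.
    by rewrite subr_eq0 lt_eqF//; apply: qt; exact: mem_head.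
  exists (fun x => b x * ((x - r.1) / (q.1 - r.1))); split.
  - move=> x; apply: cvgM; first exact: cb.
    apply: cvgM; last exact: cvg_cst.
    by apply: cvgB; [exact: cvg_id|exact: cvg_cst].
  - by rewrite bq mul1r divff.
  - move=> x; rewrite inE => /orP[/eqP ->|/bt ->]; last by rewrite mul0r.
    by rewrite subrr mul0r mulr0.
exists (fun x => phi x + (v q - phi q.1) * b x).
  move=> x; apply: cvgD; first exact: cphi.
  by apply: cvgM; [exact: cvg_cst|exact: cb].
move=> r; rewrite inE => /orP[/eqP ->|rs]; first by rewrite bq mulr1; lra.
by rewrite bs// mulr0 addr0 phiE.
Qed.

(** * Finiteness drawn from pairs of pants *)

Section pants_hypothesis.
Variables (pr : T -> R * R) (E : set T).
Hypothesis prK : forall t, ~ E t -> M (pr t) /\ psi (pr t) = t.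
Hypothesis pr_cts : forall t, ~ E t -> {for t, continuous pr}.
Hypothesis psiK : forall p, M p -> ~ E (psi p) /\ pr (psi p) = p.
Variables (F : fieldType) (n : nat) (rho : pi1 R x0 -> 'M[F]_n).
Hypothesis hrho : mx_group_repr rho.
Hypothesis hpants : forall P : set T, pair_of_pants R P ->
  forall (p : P) (a : cpath R x0 (set_val p)),
    finite_set (rho @` pi1_sub_image a).

(** Monoids are as good as groups here: by [finite_monoid_inv] a finite one contains the inverses of
    its invertible elements. *)
Definition finite_monoid_with (A B : 'M[F]_n) : Prop :=
  exists Z : set 'M[F]_n, [/\ finite_set Z, Z 1%:M,
    forall X Y, Z X -> Z Y -> Z (X *m Y), Z A & Z B].

Lemma finite_monoid_pants (a b : R) (S1 S2 : pred (R * R)) : 0 < a ->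
  {in Q, forall q, S1 q -> - 5 / 2 <= a * q.1 + b <= - 3 / 2} ->
  {in Q, forall q, S2 q -> 3 / 2 <= a * q.1 + b <= 5 / 2} ->
  finite_monoid_with (rho (gprod [seq ploop q | q <- Q & S1 q]))
                     (rho (gprod [seq ploop q | q <- Q & S2 q])).
Proof.
move=> a0 S1_in S2_in; have [rho1 rhoM] := hrho.
have [phi cphi phiE] :=
  interpolation (fun q => if S1 q || S2 q then q.2 else q.2 + 10).
have phi_in : {in Q, forall q, S1 q || S2 q -> phi q.1 = q.2}.
  by move=> q Qq S12; rewrite phiE// S12.
have phi_out : {in Q, forall q, ~~ (S1 q || S2 q) -> phi q.1 = q.2 + 10}.
  by move=> q Qq /negbTE S12; rewrite phiE// S12.
have [p [g [K1 K2]]] := pants_loops psiK a0 cphi S1_in S2_in phi_in phi_out.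
set P := pants_set _ _ _ _ _ in p K1 K2.
have finP := hpants (pants_setP prK pr_cts psiK a0 cphi S1_in S2_in phi_in phi_out)
  (c (set_val p)).
(* Conjugating the image of the pants group by [g] frees both products from the gauge. *)
pose K := [set x | pi1_sub_image (c (set_val p)) (g^-1 * x * g)%g].
have imE x : pi1_sub_image (c (set_val p)) x -> exists l : cpath R p p,
    x = holc c (Defs.path_map (@initial_continuous P T set_val) l).
  move=> [y _ <-]; exists (repr y); rewrite -[in LHS](pi1_class_repr y) /=.
  by rewrite pi1_mapE pi1_conjE.
have KM x y : K x -> K y -> K (x * y)%g.
  rewrite /K /= => /imE[l lE] /imE[m mE].
  rewrite (_ : _ * _ = (g^-1 * x * g) * (g^-1 * y * g))%g; last first.
    by rewrite !mulgA mulgK.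
  by rewrite lE mE -holc_incl_cat; exact: pi1_sub_image_loop.
exists (rho @` K); split.
- apply: (@sub_finite_set _ _ [set (rho g *m X *m rho g^-1%g) |
    X in rho @` pi1_sub_image (c (set_val p))]); last exact: finite_image.
  move=> _ [x Kx <-]; exists (rho (g^-1 * x * g)%g); first by exists (g^-1 * x * g)%g.
  by rewrite -!rhoM !mulgA mulgV mul1g mulgK.
- exists 1%g => //; rewrite /K /= mulg1 mulVg -(holc_cst c (set_val p)).
  have := pi1_sub_image_loop c (path_cst R p).
  by congr (pi1_sub_image _ _); rewrite -!holE.
- by move=> _ _ [x Kx <-] [y Ky <-]; exists (x * y)%g; [exact: KM|exact: rhoM].
- by eexists; [exact: K1|].
- by eexists; [exact: K2|].
Qed.

Lemma filter_subseq_mem (s : seq (R * R)) :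
  subseq s Q -> [seq q <- Q | q \in s] = s.
Proof. by move/(subseq_uniqP Q_uniq) => {2}->. Qed.

Lemma finite_monoid_pair (u v : R * R) : subseq [:: u; v] Q ->
  finite_monoid_with (rho (ploop u)) (rho (ploop v)).
Proof.
move=> uvQ.
have uv : u.1 < v.1.
  have := subseq_sorted _ uvQ Qsorted.
  by move=> /(_ (fun p q r => @lt_trans _ _ _ _ _)) /=; rewrite andbT.
have uQ : subseq [:: u] Q.
  by apply: subseq_trans uvQ; rewrite /= eqxx.
have vQ : subseq [:: v] Q.
  by apply: subseq_trans uvQ; rewrite sub1seq !inE eqxx orbT.
(* The affine map taking the two abscissas to the centres -2 and 2 of the holes. *)
pose a := 4 / (v.1 - u.1); pose b := - 2 - a * u.1.
have a0 : 0 < a by rewrite divr_gt0//; lra.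
have av : a * v.1 + b = 2 by rewrite /b /a; field; lra.
have au : a * u.1 + b = - 2 by rewrite /b; lra.
have := @finite_monoid_pants a b (fun q => q \in [:: u]) (fun q => q \in [:: v]) a0.
rewrite !filter_subseq_mem//= !mulg1; apply.
- by move=> q _; rewrite inE => /eqP ->; rewrite au; lra.
- by move=> q _; rewrite inE => /eqP ->; rewrite av; lra.
Qed.

Lemma finite_monoid_subseq (s : seq (R * R)) : subseq s Q ->
  finite_monoid_with (rho (gprod [seq ploop q | q <- s])) 1%:M.
Proof.
move=> sQ.
have [B B0 HB] : exists2 B, 0 < B & {in Q, forall q, `|q.1| <= B}.
  elim: (Q) => [|q t [B B0 IH]]; first by exists 1.
  exists (Num.max B `|q.1|); first by rewrite lt_max B0.
  move=> r; rewrite inE le_max => /orP[/eqP ->|/IH ->//]; by rewrite lexx orbT.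
(* Scaling by 1 / (2B) and shifting by -2 squeezes all abscissas into [-5/2, -3/2], so any
   subsequence fits into the left hole. *)
have := @finite_monoid_pants (2 * B)^-1 (- 2) (fun q => q \in s) xpred0.
rewrite filter_subseq_mem// filter_pred0 /= hrho.1; apply => //.
  by rewrite invr_gt0; lra.
move=> q Qq _; have := HB _ Qq; rewrite ler_norml => /andP[h1 h2].
have : - (2^-1) <= (2 * B)^-1 * q.1 <= 2^-1.
  by rewrite mulrC ler_pdivlMr ?ler_pdivrMr; lra.
by lra.
Qed.

End pants_hypothesis.
End punctured_plane.

(** * The sphere *)

(** Points with distinct ordinates get equal abscissas for one value of [a] only. A number exceeding
    the sum of the absolute values of all these exceptions avoids them. *)
Lemma separating_shear (R : realFieldType) (s : seq (R * R)) :
  exists a : R, {in s &, forall p q, p.1 + a * p.2 = q.1 + a * q.2 -> p = q}.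
Proof.
pose bad := [seq (q.1 - p.1) / (p.2 - q.2) | p <- s, q <- s].
have [a abad] : exists a : R, a \notin bad.
  exists (1 + \sum_(x <- bad) `|x|); apply/negP => aB.
  have : 1 + \sum_(x <- bad) `|x| <= \sum_(x <- bad) `|x|.
    rewrite {2}(big_rem _ aB) /= ger0_norm ?lerDl ?sumr_ge0//.
    by rewrite addr_ge0// sumr_ge0.
  by rewrite gerDr ler10.
exists a => p q ps qs e; have [pq|pq] := eqVneq p.2 q.2.
  move: e; rewrite pq => /addIr; case: p pq {ps} => p1 p2; case: (q) => q1 q2 /=.
  by move=> -> ->.
case/negP: abad; apply/allpairsP; exists (p, q); split=> //=.
have pq' : p.2 - q.2 != 0 by rewrite subr_eq0.
apply: (mulIf pq'); rewrite divfK//; lra.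
Qed.

Lemma cts_comp (X Y Z : topologicalType) (f : X -> Y) (g : Y -> Z) :
  continuous f -> continuous g -> continuous (fun x => g (f x)).
Proof. by move=> cf cg x; apply: continuous_comp; [exact: cf|exact: cg]. Qed.

Section sphere_charts.
Variables (R : realType) (T : topologicalType) (x0 : T).
Variable F : set (R * R * R).
Variables (e : T -> (sphere2 (R := R) `\` F)) (k : (sphere2 (R := R) `\` F) -> T).
Hypotheses (e_cts : continuous e) (k_cts : continuous k).
Hypotheses (eK : cancel e k) (kK : cancel k e).

Local Notation S := (@sphere2 R `\` F).

Definition emb (t : T) : R * R * R := set_val (e t).
(** Outside the punctured sphere the value is the dummy [x0]. *)
Definition unemb (v : R * R * R) : T := 'valL_x0 k v.

Lemma emb_cts : continuous emb.
Proof.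
move=> t; apply: continuous_comp; first exact: e_cts.
exact: set_val_continuous.
Qed.

Lemma unemb_cts : {within S, continuous unemb}.
Proof. exact/subspace_valL_continuousP'. Qed.

Lemma unembE (v : S) : unemb (set_val v) = k v.
Proof.
exact: (congr1 (fun f => f k v) (@sigL_valL _ _ x0 S)).
Qed.

Lemma emb_in t : S (emb t).
Proof. exact: set_valP. Qed.

Lemma embK t : unemb (emb t) = t.
Proof. by rewrite unembE eK. Qed.

Lemma unembK v : S v -> emb (unemb v) = v.
Proof.
move=> Sv; rewrite /emb -[v in LHS]/(set_val (SigSub (mem_set Sv) : S)).
by rewrite unembE kK.
Qed.

Section stereographic.
Variable a : R.

(* The shear by a serves to make the abscissas of the punctures distinct.     *)
Definition stereo (v : R * R * R) : R * R :=
  (v.1.1 / (1 - v.2) + a * (v.1.2 / (1 - v.2)), v.1.2 / (1 - v.2)).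

Definition unstereo (p : R * R) : R * R * R :=
  let u := p.1 - a * p.2 in let d := u ^+ 2 + p.2 ^+ 2 + 1 in
  (2 * u / d, 2 * p.2 / d, (d - 2) / d).

Lemma unstereo_den (p : R * R) : (p.1 - a * p.2) ^+ 2 + p.2 ^+ 2 + 1 != 0.
Proof.
rewrite gt_eqF//; have := sqr_ge0 (p.1 - a * p.2); have := sqr_ge0 p.2; lra.
Qed.

Lemma unstereo_sphere p : sphere2 (unstereo p).
Proof.
have d0 := unstereo_den p; rewrite /sphere2 /unstereo /=; field.
exact: d0.
Qed.

Lemma unstereo_pole p : (unstereo p).2 != 1.
Proof.
rewrite /unstereo /=; have := unstereo_den p; set d := _ + 1 => d0.
apply/eqP => /(congr1 ( *%R^~ d)); rewrite divfK// mul1r; lra.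
Qed.

Lemma unstereoK p : stereo (unstereo p) = p.
Proof.
have := unstereo_den p; case: p => x y; rewrite /stereo /unstereo /= => d0.
by congr (_, _); field; rewrite d0 /=; apply/eqP; lra.
Qed.

Lemma stereoK v : sphere2 v -> v.2 != 1 -> unstereo (stereo v) = v.
Proof.
case: v => -[x y] z; rewrite /sphere2 /stereo /unstereo /= => s z1.
have z1' : 1 - z != 0 by rewrite subr_eq0 eq_sym.
rewrite addrK.
have -> : (x / (1 - z)) ^+ 2 + (y / (1 - z)) ^+ 2 + 1 = 2 / (1 - z).
  have -> : (x / (1 - z)) ^+ 2 + (y / (1 - z)) ^+ 2 + 1 =
      (x ^+ 2 + y ^+ 2 + (1 - z) ^+ 2) / (1 - z) ^+ 2 by field.
  have -> : x ^+ 2 + y ^+ 2 + (1 - z) ^+ 2 = 2 * (1 - z) by lra.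
  by field.
by congr (_, _, _); field.
Qed.

Lemma unstereo_cts : continuous unstereo.
Proof.
have cu : continuous (fun p : R * R => p.1 - a * p.2).
  move=> p; apply: cvgB; first exact: cts_fst.
  by apply: cvgM; [exact: cvg_cst|exact: cts_snd].
pose d (p : R * R) := (p.1 - a * p.2) ^+ 2 + p.2 ^+ 2 + 1.
have cd : continuous d.
  move=> p; apply: cvgD; last exact: cvg_cst.
  by apply: cvgD; apply: (cvgM (f := fun p => _)); do ?[exact: cu|exact: cts_snd].
have cdV : continuous (fun p => (d p)^-1).
  by move=> p; apply: cvgV; [exact: unstereo_den|exact: cd].
apply: (@cts_pair _ _ _ (fun p => (2 * (p.1 - a * p.2) / d p, 2 * p.2 / d p))
  (fun p => (d p - 2) / d p)); last first.
  by move=> p; apply: cvgM; [apply: cvgB; [exact: cd|exact: cvg_cst]|exact: cdV].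
apply: cts_pair => p; (apply: cvgM; last exact: cdV).
  by apply: cvgM; [exact: cvg_cst|exact: cu].
by apply: cvgM; [exact: cvg_cst|exact: cts_snd].
Qed.

Definition plane_to_surface (p : R * R) : T := unemb (unstereo p).
Definition surface_to_plane (t : T) : R * R := stereo (emb t).
(** The point (0, 0, 1) missed by the projection; the set is empty when that point is a puncture. *)
Definition pole : set T := [set t | (emb t).2 = 1].

Lemma surface_to_plane_cts t : ~ pole t -> {for t, continuous surface_to_plane}.
Proof.
have cz : continuous (fun t => (emb t).2).
  exact: (cts_comp emb_cts (@cts_snd _ _)).
have cxy : continuous (fun t => (emb t).1).
  exact: (cts_comp emb_cts (@cts_fst _ _)).
have cx : continuous (fun t => (emb t).1.1).
  exact: (cts_comp cxy (@cts_fst _ _)).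
have cy : continuous (fun t => (emb t).1.2).
  exact: (cts_comp cxy (@cts_snd _ _)).
move=> np; have cV : (fun t => (1 - (emb t).2)^-1) @ t --> (1 - (emb t).2)^-1.
  apply: cvgV; first by rewrite subr_eq0 eq_sym; exact/eqP.
  by apply: cvgB; [exact: cvg_cst|exact: cz].
have cyV := cvgM (cy t) cV.
rewrite /continuous_at /surface_to_plane /stereo /=.
apply: (@cvg_pair _ _ _ _ (nbhs _) (nbhs _)); last exact: cyV.
apply: cvgD; first exact: (cvgM (cx t) cV).
by apply: cvgM; [exact: cvg_cst|exact: cyV].
Qed.

Lemma pole_closed : closed pole.
Proof.
have cz : continuous (fun t => (emb t).2).
  exact: (cts_comp emb_cts (@cts_snd _ _)).
apply: (@preimage_closed _ _ (fun t => (emb t).2) [set x | x = 1]).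
  by move=> t _; exact: cz.
exact: closed_eq.
Qed.

Lemma poleE t : pole t -> emb t = (0, 0, 1).
Proof.
rewrite /pole /=; case: (emb t) (emb_in t) => p z [/= + _] z1.
rewrite /sphere2 /= z1 expr1n => s.
by rewrite (@sqr_sum_eq0 _ p)//; lra.
Qed.

Lemma pole_one t t' : pole t -> pole t' -> t = t'.
Proof. by move=> /poleE tE /poleE t'E; rewrite -(embK t) tE -t'E embK. Qed.

Hypothesis F_fin : finite_set F.

(** The chart is the inverse of vertical projection from the upper hemisphere. No puncture off the
    vertical axis projects into the small disc, and the centre lifts to the image of [t0], which is
    not a puncture. *)
Lemma pole_cap t0 : pole t0 -> @cap_chart R T pole t0.
Proof.
move=> pt0; have /finite_seqP[fs FE] := F_fin.
pose nrm (v : R * R * R) := v.1.1 ^+ 2 + v.1.2 ^+ 2.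
have [r [r0 r1 rF]] : exists r, [/\ 0 < r, r <= 1 &
    {in fs, forall v, nrm v < r -> nrm v = 0}].
  elim: (fs) => [|v s [r [r0 r1 IH]]]; first by exists 1.
  have nv : 0 <= nrm v by rewrite addr_ge0 ?sqr_ge0.
  have [v0|v0] := eqVneq (nrm v) 0.
    exists r; split=> // w; rewrite inE => /orP[/eqP ->//|]; exact: IH.
  exists (Num.min r (nrm v)); split.
  - by rewrite lt_min r0 lt_def v0.
  - by rewrite ge_min r1.
  - move=> w; rewrite inE lt_min => /orP[/eqP ->|ws] /andP[wr].
      by rewrite ltxx.
    by move=> _; exact: IH wr.
have et0 := poleE pt0.
pose lift (w : R * R) : R * R * R :=
  (w, Num.sqrt (1 - (w.1 ^+ 2 + w.2 ^+ 2))).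
have liftS w : disc r w -> S (lift w).
  move=> wr; have wr' : w.1 ^+ 2 + w.2 ^+ 2 < r := wr.
  split=> [|Fw]; first by rewrite /sphere2 /= sqr_sqrtr; lra.
  move: (Fw); rewrite {1}FE /= => /rF /= /(_ wr) /sqr_sum_eq0 w0.
  apply: (emb_in t0).2; rewrite et0 FE /=; move: Fw.
  by rewrite FE /= /lift (w0 : w = (0, 0)) /= expr0n /= addr0 subr0 sqrtr1.
exists (unemb \o lift), (fun t => (emb t).1), r; split.
- exact: r0.
- apply: (within_comp _ unemb_cts) => //.
  have cn : continuous (fun w : R * R => 1 - (w.1 ^+ 2 + w.2 ^+ 2)).
    have c1 := @cts_fst R R; have c2 := @cts_snd R R.
    move=> u; apply: cvgB; first exact: cvg_cst.
    by apply: cvgD; [exact: (cvgM (c1 u) (c1 u))|exact: (cvgM (c2 u) (c2 u))].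
  apply: continuous_subspaceT; apply: cts_pair => [w|]; first exact: cvg_id.
  exact: (cts_comp cn (@sqrt_continuous R)).
- rewrite /lift /= expr0n /= addr0 subr0 sqrtr1 -[RHS]embK et0.
  by [].
- have cz : continuous (fun t => (emb t).2).
    exact: (cts_comp emb_cts (@cts_snd _ _)).
  have cxy : continuous (fun t => (emb t).1).
    exact: (cts_comp emb_cts (@cts_fst _ _)).
  have cn : continuous (fun t => (emb t).1.1 ^+ 2 + (emb t).1.2 ^+ 2).
    have c1 : continuous (fun t => (emb t).1.1).
      exact: (cts_comp cxy (@cts_fst _ _)).
    have c2 : continuous (fun t => (emb t).1.2).
      exact: (cts_comp cxy (@cts_snd _ _)).
    move=> u; apply: cvgD; first exact: (cvgM (c1 u) (c1 u)).
    exact: (cvgM (c2 u) (c2 u)).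
  have n1 : \forall t \near t0, 0 < (emb t).2.
    by apply: (cvgr_gt _ (cz t0)); rewrite et0.
  have n2 : \forall t \near t0, disc r (emb t).1.
    by apply: (cvgr_lt _ (cn t0)); rewrite et0 /= expr0n /= addr0.
  near=> t; split; [by near: t| |].
    have z0 : 0 < (emb t).2 by near: t.
    rewrite /lift /= -[RHS]embK; congr unemb.
    case: (emb t) (emb_in t) z0 => -[x y] z [/= + _] z0; rewrite /sphere2 /= => s.
    congr (_, _); rewrite (_ : 1 - _ = z ^+ 2); last by rewrite -s; ring.
    by rewrite sqrtr_sqr gtr0_norm.
  exact: cxy.
- move=> w wr w0; rewrite /pole /= unembK; last exact: liftS.
  rewrite /lift /= => w1; apply: w0.
  have wr' : w.1 ^+ 2 + w.2 ^+ 2 < r := wr.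
  have : 1 - (w.1 ^+ 2 + w.2 ^+ 2) = 1.
    by rewrite -[LHS]sqr_sqrtr ?w1 ?expr1n//; lra.
  by move=> h; apply: sqr_sum_eq0; lra.
Unshelve. all: by end_near.
Qed.

End stereographic.
Hypotheses (F_sub : F `<=` @sphere2 R) (F_fin : finite_set F).

Lemma sheared_punctures : exists (a : R) (Q : seq (R * R)),
  sorted (fun p q => p.1 < q.1) Q /\
  forall p, p \in Q <-> F (unstereo a p).
Proof.
have /finite_seqP[fs FE] := F_fin.
pose s := undup [seq v <- fs | v.2 != 1].
have sE v : v \in s -> F v /\ v.2 != 1.
  by rewrite mem_undup mem_filter FE => /andP[].
have [a aP] := separating_shear [seq stereo 0 v | v <- s].
pose Q0 := [seq stereo a v | v <- s].
have stereoE v : (stereo a v).1 = (stereo 0 v).1 + a * (stereo 0 v).2.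
  by rewrite /stereo /= mul0r addr0.
have Q0uniq : uniq (map fst Q0).
  rewrite -map_comp map_inj_in_uniq ?undup_uniq// => v w vs ws vw.
  have {}vw : (stereo a v).1 = (stereo a w).1 := vw.
  rewrite !stereoE in vw; have ee := aP _ _ (map_f _ vs) (map_f _ ws) vw.
  have [[Fv v1] [Fw w1]] := (sE _ vs, sE _ ws).
  rewrite -(stereoK 0 (F_sub Fv) v1) ee stereoK//.
  exact: F_sub.
exists a, (sort (relpre fst <=%R) Q0); split.
  by rewrite -(sorted_map (e' := <%R)) -sort_map sort_lt_sorted.
move=> p; rewrite mem_sort; split=> [/mapP[v vs ->]|Fp].
  by have [Fv v1] := sE _ vs; rewrite stereoK//; exact: F_sub.
apply/mapP; exists (unstereo a p); last by rewrite unstereoK.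
rewrite mem_undup mem_filter unstereo_pole /=.
by move: Fp; rewrite FE.
Qed.

End sphere_charts.

Lemma min_abscissa_gap (R : realType) (Q : seq (R * R)) :
  sorted (fun p q => p.1 < q.1) Q -> exists2 dl, 0 < dl &
  {in Q &, forall p q, p != q -> dl <= `|p.1 - q.1|}.
Proof.
elim: Q => [|q s IH] /=; first by exists 1.
have tr : transitive (fun p q : R * R => p.1 < q.1).
  by move=> p1 p2 p3; exact: lt_trans.
rewrite path_sortedE// => /andP[/allP qs /IH[d d0 dP]].
have [e e0 eP] := abscissa_gap s q.1.
have eP' r : r \in s -> e <= `|r.1 - q.1|.
  move=> rs; rewrite leNgt; apply/negP => /eP-/(_ rs) rq.
  by have := qs _ rs; rewrite rq ltxx.
exists (Num.min d e); first by rewrite lt_min d0.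
move=> p r; rewrite !inE ge_min => /orP[/eqP->|ps] /orP[/eqP->|rs].
- by rewrite eqxx.
- by rewrite distrC eP' ?orbT.
- by rewrite eP' ?orbT.
- by move=> pr; rewrite dP.
Qed.

(** * Path connectedness of the surface *)

Section connected.
Context {R : realType} {T : topologicalType}.
Local Notation I := (@I01 R).

Definition joined (x y : T) := exists _ : cpath R x y, True.

Lemma joined_sym x y : joined x y -> joined y x.
Proof. by move=> [f _]; exists (path_rev f). Qed.

Lemma joined_trans x y z : joined x y -> joined y z -> joined x z.
Proof. by move=> [f _] [g _]; exists (path_cat f g). Qed.

Lemma joined_seg (psi : R * R -> T) (M : set (R * R)) (p q : R * R) :
  {within M, continuous psi} -> (forall t, I t -> M (seg p q t)) ->
  joined (psi p) (psi q).
Proof.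
move=> cpsi hM; have cf := chart_path cpsi (@seg_within _ p q) hM.
have f0 : (psi \o seg p q) 0 = psi p by rewrite /= seg0.
have f1 : (psi \o seg p q) 1 = psi q by rewrite /= seg1.
by exists (CPath cf f0 f1).
Qed.

Variables (psi : R * R -> T) (Q : seq (R * R)) (pr : T -> R * R) (E : set T).
Hypothesis psi_cts : {within plane_minus Q, continuous psi}.
Hypothesis prK : forall t, ~ E t -> plane_minus Q (pr t) /\ psi (pr t) = t.
Hypothesis E_cap : forall t, E t -> @cap_chart R T E t.
Variable ht : R.
Hypothesis ht_gt : {in Q, forall q, q.2 < ht}.

(** Move right by less than the gap in abscissas, go vertically to height [ht] on a line without
    punctures, then horizontally above all punctures. *)
Lemma joined_base p : plane_minus Q p -> joined (psi p) (psi (0, ht)).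
Proof.
move=> Mp; have [d d0 dP] := abscissa_gap Q p.1.
pose x := p.1 + d / 2.
apply: (@joined_trans _ (psi (x, p.2))).
  apply: (joined_seg psi_cts) => t; rewrite I01E => -[t0 t1].
  apply/negP => Qt; move/negP: (Mp : p \notin Q); apply.
  have e : p.1 + t * (x - p.1) = p.1.
    apply: (dP _ Qt); rewrite /seg /= /x ltr_norml; nra.
  move: Qt; rewrite /seg /= e subrr mulr0 addr0.
  by case: (p).
apply: (@joined_trans _ (psi (x, ht))).
  apply: (joined_seg psi_cts) => t _; rewrite /seg /= subrr mulr0 addr0.
  apply/negP => Qt; have /= := dP _ Qt.
  by rewrite /x ltr_norml => /(_ _); lra.
apply: (joined_seg psi_cts) => t _; rewrite /seg /= subrr mulr0 addr0.
by apply/negP => /ht_gt /=; rewrite ltxx.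
Qed.

Lemma joined_all x y : joined x y.
Proof.
suff H z : joined z (psi (0, ht)) by apply: joined_trans (H x) (joined_sym (H y)).
have off t : ~ E t -> joined t (psi (0, ht)).
  by move=> nE; have [Mt <-] := prK nE; exact: joined_base.
have [Ez|nEz] := pselect (E z); last exact: off.
have [tau [om [r [r0 ctau tau0 _ tauE]]]] := E_cap Ez.
pose w0 : R * R := (Num.min r 1 / 2, 0).
have rr0 : 0 < Num.min r 1 by rewrite lt_min r0 ltr01.
have Dw0 : disc r w0.
  have rr1 : Num.min r 1 <= 1 by rewrite ge_min lexx orbT.
  have rrr : Num.min r 1 <= r by rewrite ge_min lexx.
  by rewrite /disc /=; nra.
apply: joined_trans (off (tau w0) _); last first.
  by apply: tauE => //; case => /eqP; rewrite mulf_eq0; lra.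
rewrite -tau0; apply: (joined_seg ctau) => t; apply: disc_convex => //.
by rewrite /disc /= expr0n /= addr0.
Qed.

End connected.

(** Left multiplication by [X] is injective from the finite set [Z] to itself, hence hits 1. *)
Lemma finite_monoid_inv (F : fieldType) n (Z : set 'M[F]_n) (X : 'M[F]_n) :
  finite_set Z -> Z 1%:M -> (forall X Y, Z X -> Z Y -> Z (X *m Y)) ->
  Z X -> X \in unitmx -> Z (invmx X).
Proof.
move=> /finite_seqP[s0 ->] /= Z1 ZM ZX uX.
pose s := undup s0.
have [|Y Ys||e1 e2] := @uniq_min_size _ [seq X *m Y | Y <- s] s.
- by rewrite map_inj_uniq ?undup_uniq//; exact: (can_inj (mulKmx uX)).
- have /mapP[W Ws ->] := Ys; move: Ws; rewrite !mem_undup; exact: ZM.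
- by rewrite size_map.
have : 1%:M \in [seq X *m Y | Y <- s] by rewrite e2 mem_undup.
move=> /mapP[Y Ys XY]; suff -> : invmx X = Y by move: Ys; rewrite mem_undup.
by rewrite -[Y](mulKmx uX) -XY mulmx1.
Qed.

(** All that topology contributes. The list [gs] follows the order of abscissas, so its subsequences
    give the ascending products; generation is phrased through finite multiplicative sets, for which
    inverses come free. *)
Lemma surface_group_reduction (R : realType) (n : nat) (T : topologicalType)
    (hT : genus0_surface R n T) (x0 : T) (F : fieldType) (m : nat)
    (rho : pi1 R x0 -> 'M[F]_m) (hrho : mx_group_repr rho)
    (hpants : forall P : set T, pair_of_pants R P ->
      forall (p : P) (a : cpath R x0 (set_val p)),
        finite_set (rho @` pi1_sub_image a)) :
  exists (gs : seq (pi1 R x0)) (g : pi1 R x0),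
  [/\ forall s, subseq s gs -> finite_monoid_with (rho (gprod s)) 1%:M,
      forall u v, subseq [:: u; v] gs -> finite_monoid_with (rho u) (rho v) &
      forall Z : set 'M[F]_m, finite_set Z -> Z 1%:M ->
        (forall X Y, Z X -> Z Y -> Z (X *m Y)) ->
        {in gs, forall u, Z (rho u)} -> forall a, Z (rho (g * a * g^-1)%g)].
Proof.
case: hT => S0 [S0_sub S0_card [e [k [e_cts k_cts eK kK]]]].
have S0_fin : finite_set S0 by exists n.
have [a [Q [Qs QE]]] := sheared_punctures S0_sub S0_fin.
have [dl dl0 dlP] := min_abscissa_gap Qs.
have [ht htP] : exists ht, {in Q, forall q, q.2 < ht}.
  elim: (Q) => [|q s [h IH]]; first by exists 0.
  exists (Num.max h (q.2 + 1)) => r; rewrite inE lt_max.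
  by move=> /orP[/eqP ->|/IH ->//]; rewrite ltrDl ltr01 orbT.
pose psi := plane_to_surface x0 k a.
pose pr := surface_to_plane e a.
pose E := pole e.
have MS p : plane_minus Q p -> (@sphere2 R `\` S0) (unstereo a p).
  move=> Mp; split; first exact: unstereo_sphere.
  by move=> /QE Qp; move/negP: (Mp : p \notin Q); apply.
have psi_cts : {within plane_minus Q, continuous psi}.
  have -> : psi = unemb x0 k \o unstereo a by [].
  apply: (within_comp _ (unemb_cts k_cts)) => //.
  by apply: continuous_subspaceT; exact: unstereo_cts.
have E1 t : ~ E t -> (emb e t).2 != 1 by move=> nE; exact/eqP.
have prK t : ~ E t -> plane_minus Q (pr t) /\ psi (pr t) = t.
  move=> /E1 nE; have [St nFt] := emb_in e t; split.
    by apply/negP => /QE; rewrite stereoK.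
  by rewrite /psi /plane_to_surface stereoK// embK.
have psiK p : plane_minus Q p -> ~ E (psi p) /\ pr (psi p) = p.
  move=> Mp; rewrite /E /pole /= /pr /surface_to_plane unembK//; last exact: MS.
  by rewrite unstereoK; split=> //; apply/eqP; exact: unstereo_pole.
have pr_cts t : ~ E t -> {for t, continuous pr}.
  exact: surface_to_plane_cts.
have E_cap t : E t -> @cap_chart R T E t by exact: pole_cap.
have E_closed : closed E by exact: pole_closed.
have E_one : forall t t', E t -> E t' -> t = t' by exact: pole_one.
have c x : cpath R x0 x.
  exact: (projT1 (cid (joined_all psi_cts prK E_cap htP x0 x))).
have [g gP] := pi1_generated c psi_cts dl0 dlP htP prK E_closed pr_cts E_one E_cap.
pose gam := ploop c psi Q dl ht.
exists (map gam Q), g; split.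
- move=> s /subseqP[mk _ ->]; rewrite -map_mask.
  apply: (finite_monoid_subseq c Qs psi_cts dl0 dlP htP prK pr_cts psiK hrho hpants).
  exact: mask_subseq.
- move=> u v /subseqP[mk _]; rewrite -map_mask.
  case mQ: (mask mk Q) => [|p [|q [|? ?]]] //= [-> ->].
  apply: (finite_monoid_pair c Qs psi_cts dl0 dlP htP prK pr_cts psiK hrho hpants).
  by rewrite -mQ mask_subseq.
- move=> Z Zfin Z1 ZM Zgs a'; have [rho1 rhoM] := hrho.
  elim: (gP a') => [|x y _ Zx _ Zy|x _ Zx|q Qq].
  + by rewrite rho1.
  + by rewrite rhoM; exact: ZM.
  + suff -> : rho x^-1%g = invmx (rho x).
      by apply: finite_monoid_inv => //; exact: mx_group_repr_unit.
    have ux := mx_group_repr_unit hrho x.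
    by rewrite -[RHS]mulmx1 -rho1 -(mulgV x) rhoM mulKmx.
  + by apply: Zgs; exact: map_f.
Qed.

(** * Conjugates of cyclotomic integers *)

Lemma prim_root_exists (C : numClosedFieldType) (n : nat) :
  (0 < n)%N -> exists z : C, n.-primitive_root z.
Proof.
move=> n_gt0; pose p : {poly C} := 'X^n - 1.
have [r Dp] := closed_field_poly_normal p.
rewrite (monicP _) ?monicXnsubC// scale1r in Dp.
have rn1 : all n.-unity_root r by apply/allP=> z; rewrite -root_prod_XsubC -Dp.
have sz_r : (n < (size r).+1)%N.
  by rewrite -(size_prod_XsubC r id) -Dp size_XnsubC.
have [|z] := hasP (has_prim_root n_gt0 rn1 _ sz_r); last by exists z.
by rewrite -separable_prod_XsubC -Dp separable_Xn_sub_1// pnatr_eq0 -lt0n.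
Qed.

Lemma absz_shift (x : int) (L : nat) : `|x| <= L%:Z ->
  (absz (x + L%:Z))%:Z - L%:Z = x /\ (absz (x + L%:Z)%R < (2 * L).+1)%N.
Proof. by rewrite ler_norml => /andP[? ?]; split; lia. Qed.

Definition poly_int_eval (C : nzRingType) (P : {poly int}) (x : C) : C :=
  (map_poly intr P).[x].

Section roots_of_unity.
Variable C : numClosedFieldType.
Variables (N : nat) (z : C).
Hypotheses (N_gt0 : (0 < N)%N) (zN : z ^+ N = 1).
Local Notation ev := (@poly_int_eval C).

(** The Galois conjugates of [z], described by the integer polynomial relations that they
    inherit. *)
Definition conj_root (r : C) : Prop :=
  r ^+ N = 1 /\ forall P : {poly int}, ev P z = 0 -> ev P r = 0.

Lemma map_ratr_intr (P : {poly int}) :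
  map_poly (ratr : rat -> C) (map_poly intr P) = map_poly intr P.
Proof.
by rewrite -map_poly_comp; apply: eq_map_poly => i /=; rewrite ratr_int.
Qed.

(** The minimal polynomial over the rationals divides X^N - 1, so Gauss's lemma ([dvdpP_rat_int])
    makes it integral and monic, and separability of X^N - 1 makes its roots distinct. They are
    conjugates since it divides every rational polynomial vanishing at [z]. *)
Lemma integral_minimal_poly : exists (mu : {poly int}) (rs : seq C),
  [/\ mu \is monic, uniq rs, ev mu z = 0,
      map_poly intr mu = \prod_(r <- rs) ('X - r%:P) &
      forall r, r \in rs -> conj_root r].
Proof.
pose vanish (p : {poly rat}) := root (map_poly (ratr : rat -> C) p) z.
pose X1 : {poly int} := 'X^N - 1.
have X1E (K : numFieldType) : map_poly intr X1 = 'X^N - 1 :> {poly K}.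
  by rewrite rmorphB /= map_polyXn rmorph1.
have X1z : vanish (map_poly intr X1).
  by rewrite /vanish map_ratr_intr X1E rootE hornerD hornerN hornerXn hornerC zN subrr.
pose ok (n : nat) := `[< exists p : {poly rat}, [/\ p != 0, size p = n & vanish p] >].
have ex_ok : exists n, ok n.
  exists (size (map_poly (intr : int -> rat) X1)); apply/asboolP.
  exists (map_poly intr X1); split=> //.
  by rewrite X1E -size_poly_eq0 size_XnsubC.
have [m /asboolP[p [p0 sp vp]] min] := ex_minnP ex_ok.
have dvd_p q : vanish q -> p %| q.
  move=> vq; apply/modp_eq0P/eqP; apply/negPn/negP => r0.
  have : ok (size (q %% p)).
    apply/asboolP; exists (q %% p); split=> //.
    move: vq; rewrite /vanish {1}(divp_eq q p) rmorphD rmorphM /= !rootE.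
    by rewrite hornerD hornerM (eqP (vp : _ == 0)) mulr0 add0r.
  by move/min; rewrite -sp leqNgt ltn_modpN0.
have [p1 [a a0 pE] [r X1r]] := dvdpP_rat_int (dvd_p _ X1z).
have lead1 : lead_coef r * lead_coef p1 = 1.
  rewrite mulrC -lead_coefM -X1r; apply/eqP; rewrite -monicE.
  exact: monic_Xn_sub_1.
have lr0 : lead_coef r != 0.
  by apply: contra_eq_neq lead1 => ->; rewrite mul0r.
pose mu := lead_coef r *: p1.
have muM : mu \is monic by rewrite monicE lead_coefZ lead1.
have [rs Drs] := closed_field_poly_normal (map_poly intr mu : {poly C}).
have muCM : map_poly intr mu \is @monic C by rewrite monic_map.
rewrite (monicP muCM) scale1r in Drs.
have mu_dvd : map_poly intr mu %| ('X^N - 1 : {poly C}).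
  rewrite -X1E X1r /mu map_polyZ /= dvdpZl ?intr_eq0// rmorphM /=.
  exact: dvdp_mulr.
have p_mu : map_poly (ratr : rat -> C) p =
    (ratr a * (lead_coef r)%:~R^-1) *: map_poly intr mu.
  rewrite pE map_polyZ /= map_ratr_intr /mu map_polyZ /= scalerA mulfVK//.
  by rewrite intr_eq0.
have c0 : ratr a * (lead_coef r)%:~R^-1 != 0 :> C.
  by rewrite mulf_neq0 ?invr_eq0 ?intr_eq0// fmorph_eq0.
exists mu, rs; split=> //.
- rewrite -separable_prod_XsubC -Drs; apply: dvdp_separable mu_dvd _.
  by apply: separable_Xn_sub_1; rewrite pnatr_eq0 -lt0n.
- move: vp; rewrite /vanish p_mu rootE hornerZ mulf_eq0 (negbTE c0) /=.
  by move/eqP.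
- move=> s srs; have mus : root (map_poly intr mu) s.
    by rewrite Drs root_prod_XsubC.
  split.
    have : root ('X^N - 1) s by exact: (root_dvdp mu_dvd mus).
    by rewrite rootE hornerD hornerN hornerXn hornerC subr_eq0 => /eqP.
  move=> P Pz; have /dvd_p : vanish (map_poly intr P).
    by rewrite /vanish map_ratr_intr rootE; apply/eqP.
  rewrite -(dvdp_map (ratr : {rmorphism rat -> C})) /= map_ratr_intr p_mu.
  move=> mu_P; apply/eqP/(root_dvdp mu_P).
  by rewrite rootE hornerZ (eqP (mus : _ == 0)) mulr0.
Qed.

Hypothesis arch : forall x : C, exists n : nat, `|x| <= n%:R.

(** Reduce [P] modulo the minimal polynomial. Inverting the Vandermonde matrix of the conjugates
    bounds the integer coefficients of the remainder by its values there, so finitely many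
    remainders occur. *)
Lemma finite_bounded_conj (B : nat) : finite_set [set v : C |
  exists2 P : {poly int}, v = ev P z &
    forall r, conj_root r -> `|ev P r| <= B%:R].
Proof.
have [mu [rs [muM urs muz Drs rsP]]] := integral_minimal_poly.
pose d := size rs.
have smu : size mu = d.+1.
  rewrite -(size_prod_XsubC rs id) -Drs size_map_inj_poly// ?rmorph0//.
  exact: intr_inj.
pose a : 'rV[C]_d := \row_j rs`_j.
pose V : 'M[C]_d := Vandermonde d a.
have Vunit : V \in unitmx.
  rewrite unitmxE det_Vandermonde unitfE; apply/prodf_neq0 => i _.
  apply/prodf_neq0 => j ij; rewrite !mxE subr_eq0 nth_uniq//.
  by rewrite gtn_eqF.
pose W := \sum_i \sum_j `|invmx V i j|.
have W0 : 0 <= B%:R * W.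
  by rewrite mulr_ge0// sumr_ge0// => i _; apply: sumr_ge0.
have [L] := arch (B%:R * W); rewrite ger0_norm// => LP.
(* Integers in [-L, L] are encoded as ordinals by adding L. *)
pose f (g : {ffun 'I_d -> 'I_(2 * L).+1}) : C :=
  ev (\poly_(i < d) (if insub i is Some j then (g j)%:Z - L%:Z else 0)) z.
apply: (@sub_finite_set _ _ (range f)); last exact: finite_image.
move=> v [P -> PB].
pose Q := Pdiv.Ring.rmodp P mu.
have sQ : (size Q <= d)%N.
  by rewrite -ltnS -smu Pdiv.Ring.ltn_rmodpN0 ?monic_neq0.
have evQ r : ev mu r = 0 -> ev Q r = ev P r.
  move=> mur; rewrite [P in RHS](Pdiv.RingMonic.rdivp_eq muM).
  rewrite /poly_int_eval rmorphD rmorphM /= hornerD hornerM.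
  by rewrite (mur : (map_poly intr mu).[r] = 0) mulr0 add0r.
have murs (j : 'I_d) : ev mu rs`_j = 0.
  by apply/eqP; rewrite -[_ == 0]/(root _ _) Drs root_prod_XsubC mem_nth.
pose q : 'rV[C]_d := \row_i (Q`_i)%:~R.
pose w : 'rV[C]_d := \row_j ev Q rs`_j.
have qV : q *m V = w.
  apply/rowP => j; rewrite !mxE /poly_int_eval (horner_coef_wide (n := d)).
    apply: eq_bigr => i _; rewrite !mxE coef_map_id0 ?rmorph0//.
  exact: leq_trans (size_poly _ _) sQ.
have coefB (i : 'I_d) : `|Q`_i| <= L%:Z.
  have : `|(Q`_i)%:~R| <= L%:R :> C.
    rewrite (_ : (Q`_i)%:~R = q 0 i); last by rewrite mxE.
    rewrite -[q](mulmxK Vunit) qV; apply: le_trans LP.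
    rewrite mxE; apply: le_trans (ler_norm_sum _ _ _) _.
    rewrite /W mulr_sumr; apply: ler_sum => k _.
    rewrite normrM; apply: ler_pM => //.
      by rewrite mxE evQ//; apply/PB/rsP/mem_nth.
    by rewrite (bigD1 i)//= lerDl sumr_ge0.
  by rewrite -intr_norm -[L%:R]/(L%:Z%:~R) ler_int.
pose g : {ffun 'I_d -> 'I_(2 * L).+1} := [ffun i : 'I_d => inord (absz (Q`_i + L%:Z))].
exists g => //; rewrite /f -evQ//; congr ev; apply/polyP => i.
rewrite coef_poly; case: ltnP => id; last by rewrite nth_default// (leq_trans sQ).
rewrite (insubT (fun i => (i < d)%N) id) ffunE inordK.
  exact: (absz_shift (coefB (Ordinal id))).1.
exact: (absz_shift (coefB (Ordinal id))).2.
Qed.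

End roots_of_unity.

(** * Matrices of size 2 *)

Section mx2.
Variable F : fieldType.
Local Notation M2 := 'M[F]_2.

Lemma ord2 (i : 'I_2) : i = 0 \/ i = 1.
Proof. by case: i => -[|[|//]] p; [left|right]; apply: val_inj. Qed.

Lemma mx2P (A B : M2) : A 0 0 = B 0 0 -> A 0 1 = B 0 1 -> A 1 0 = B 1 0 ->
  A 1 1 = B 1 1 -> A = B.
Proof.
move=> e00 e01 e10 e11; apply/matrixP => i j.
by case: (ord2 i) => ->; case: (ord2 j) => ->.
Qed.

Lemma mul2E (A B : M2) i j : (A * B) i j = A i 0 * B 0 j + A i 1 * B 1 j.
Proof.
rewrite -mulmxE mxE !big_ord_recl big_ord0 addr0.
by rewrite (_ : lift 0 0 = 1)//; apply: val_inj.
Qed.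

Lemma tr2E (A : M2) : \tr A = A 0 0 + A 1 1.
Proof.
rewrite /mxtrace !big_ord_recl big_ord0 addr0.
by rewrite (_ : lift 0 0 = 1)//; apply: val_inj.
Qed.

Lemma det2E (A : M2) : \det A = A 0 0 * A 1 1 - A 0 1 * A 1 0.
Proof.
rewrite (expand_det_row _ 0) !big_ord_recl big_ord0 addr0 /cofactor.
rewrite !det_mx11 !mxE /= expr0 expr1 mul1r mulN1r mulrN.
by congr (A _ _ * A _ _ - A _ _ * A _ _); apply: val_inj.
Qed.

Lemma scal2E (a : F) i j : (a%:M : M2) i j = if i == j then a else 0.
Proof. by rewrite mxE; case: (i == j). Qed.

Definition mx2E := (mul2E, tr2E, scal2E, mxE).

(** The adjugate: an inverse in determinant 1, and linear in [A]. *)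
Definition adj2 (A : M2) : M2 := (\tr A)%:M - A.

Lemma mul_adj2 (A : M2) : A * adj2 A = (\det A)%:M.
Proof. by apply: mx2P; rewrite /adj2 det2E !mx2E /=; ring. Qed.

Lemma adj2_mul (A : M2) : adj2 A * A = (\det A)%:M.
Proof. by apply: mx2P; rewrite /adj2 det2E !mx2E /=; ring. Qed.

Lemma mul2_delta (A B : M2) i j p q :
  (A * delta_mx i j * B) p q = A p i * B j q.
Proof.
by rewrite !mx2E; case: (ord2 i) => ->; case: (ord2 j) => ->; rewrite /=; ring.
Qed.

(** The Cayley-Hamilton identity, polarized. *)
Lemma mul2_comm (A B : M2) :
  B * A = (\tr B) *: A + (\tr A) *: B + (\tr (A * B) - \tr A * \tr B)%:M - A * B.
Proof. by apply: mx2P; rewrite !mx2E /=; ring. Qed.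

Lemma mul2_sqr (A : M2) : A * A = (\tr A) *: A - (\det A)%:M.
Proof. by apply: mx2P; rewrite det2E !mx2E /=; ring. Qed.

Lemma adj2M (A B : M2) : adj2 (A * B) = adj2 B * adj2 A.
Proof. by apply: mx2P; rewrite /adj2 !mx2E /=; ring. Qed.

Lemma tr_mul_adj2 (A B : M2) : \tr (A * adj2 B) = \tr B * \tr A - \tr (A * B).
Proof. by rewrite /adj2 !mx2E /=; ring. Qed.

Lemma tr_mul_adj2C (A B : M2) : \tr (A * adj2 B) = \tr (B * adj2 A).
Proof. by rewrite /adj2 !mx2E /=; ring. Qed.

(** To a matrix attach the vector of its two off-diagonal entries and the difference of its diagonal
    ones. Commutation says that two such vectors have zero cross product, and that of a nonscalar
    [X] is nonzero. *)
Lemma comm2_span (A X : M2) : A * X = X * A -> X <> (X 0 0)%:M ->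
  exists a b, A = a *: X + b%:M.
Proof.
move=> AX nX; have e i j : (A * X) i j = (X * A) i j by rewrite AX.
have h1 : A 0 1 * X 1 0 = A 1 0 * X 0 1.
  have := e 0 0; rewrite !mul2E => h; apply: (addrI (A 0 0 * X 0 0)).
  by rewrite h; ring.
have h2 : (A 0 0 - A 1 1) * X 0 1 = (X 0 0 - X 1 1) * A 0 1.
  apply/eqP; rewrite -subr_eq0; have /eqP := e 0 1; rewrite !mul2E -subr_eq0.
  by congr (_ == 0); ring.
have h3 : (A 0 0 - A 1 1) * X 1 0 = (X 0 0 - X 1 1) * A 1 0.
  apply/eqP; rewrite -subr_eq0; have /eqP := e 1 0.
  rewrite !mul2E eq_sym -subr_eq0.
  by congr (_ == 0); ring.
have mk a : A 0 1 = a * X 0 1 -> A 1 0 = a * X 1 0 ->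
    A 0 0 - A 1 1 = a * (X 0 0 - X 1 1) -> exists a b, A = a *: X + b%:M.
  move=> a01 a10 a0; exists a, (A 0 0 - a * X 0 0).
  apply: mx2P; rewrite !mx2E /= ?addr0//; first by ring.
  by rewrite -[LHS](subKr (A 0 0)) a0; ring.
have [x01|x01] := eqVneq (X 0 1) 0; last first.
  apply: (mk (A 0 1 / X 0 1)); first by rewrite divfK.
    by rewrite mulrAC h1 mulfK.
  by rewrite mulrAC [A 0 1 * _]mulrC -h2 mulfK.
have [x10|x10] := eqVneq (X 1 0) 0; last first.
  apply: (mk (A 1 0 / X 1 0)); last 1 first.
  - by rewrite mulrAC [A 1 0 * _]mulrC -h3 mulfK.
  - by rewrite mulrAC -h1 mulfK.
  - by rewrite divfK.
have [x0|x0] := eqVneq (X 0 0 - X 1 1) 0.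
  case: nX; apply: mx2P; rewrite !mx2E //=.
  by apply/esym/eqP; rewrite -subr_eq0 x0.
apply: (mk ((A 0 0 - A 1 1) / (X 0 0 - X 1 1))); last by rewrite divfK.
- by rewrite x01 mulr0; apply: (mulfI x0); rewrite -h2 x01 !mulr0.
- by rewrite x10 mulr0; apply: (mulfI x0); rewrite -h3 x10 !mulr0.
Qed.

Lemma commutant2 (A B X : M2) : A * B <> B * A ->
  A * X = X * A -> B * X = X * B -> X = (X 0 0)%:M.
Proof.
move=> nAB AX BX; apply: contrapT => nX; apply: nAB.
have [a [b ->]] := comm2_span AX nX; have [c [d ->]] := comm2_span BX nX.
by apply: mx2P; rewrite !mx2E /=; ring.
Qed.

End mx2.

Lemma scalar_mul2 (F : fieldType) (x : F) (X : 'M[F]_2) : x%:M * X = x *: X.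
Proof. exact: mul_scalar_mx. Qed.

Lemma mul2_scalar (F : fieldType) (x : F) (X : 'M[F]_2) : X * x%:M = x *: X.
Proof. exact: mul_mx_scalar. Qed.

(** * Words in matrices and their traces *)

Section words.
Variable F : fieldType.
Local Notation M2 := 'M[F]_2.

Inductive word (s : seq M2) : M2 -> Prop :=
| word1 : word s 1
| wordM u X : u \in s -> word s X -> word s (u * X).

Lemma word_mem s u : u \in s -> word s u.
Proof. by move=> us; rewrite -[u]mulr1; apply: wordM => //; exact: word1. Qed.

Lemma word_mul s X Y : word s X -> word s Y -> word s (X * Y).
Proof.
by elim=> [|u Z us _ IH] wY; rewrite ?mul1r// -mulrA; apply: wordM => //; apply: IH.
Qed.

Lemma word_sub s t X : {subset s <= t} -> word s X -> word t X.
Proof.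
by move=> st; elim=> [|u Y us _ IH]; [exact: word1|apply: wordM => //; exact: st].
Qed.

Lemma word_det s X : {in s, forall u, \det u = 1} -> word s X -> \det X = 1.
Proof.
move=> d1; elim=> [|u Y us _ IH]; first exact: det1.
by rewrite -mulmxE det_mulmx d1// IH mulr1.
Qed.

Section trace_ring.
Variable O : F -> Prop.
Hypotheses (O1 : O 1) (OB : forall x y, O x -> O y -> O (x - y))
  (OM : forall x y, O x -> O y -> O (x * y)).

Lemma O_zero : O 0. Proof. by rewrite -(subrr 1); exact: OB. Qed.

Lemma O_opp x : O x -> O (- x).
Proof. by move=> Ox; rewrite -sub0r; apply: OB => //; exact: O_zero. Qed.

Lemma O_add x y : O x -> O y -> O (x + y).
Proof. by move=> Ox Oy; rewrite -[y]opprK; apply: OB => //; exact: O_opp. Qed.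

(* The O-span of the ascending products of elements of s.                     *)
Fixpoint ascending_span (s : seq M2) (X : M2) : Prop :=
  if s is u :: s' then exists Y W,
    [/\ ascending_span s' Y, ascending_span s' W & X = Y + u * W]
  else exists2 x, O x & X = x%:M.

Lemma span_add s X Y : ascending_span s X -> ascending_span s Y ->
  ascending_span s (X + Y).
Proof.
elim: s X Y => [|u s IH] X Y /=.
  move=> [x Ox ->] [y Oy ->]; exists (x + y); first exact: O_add.
  by rewrite raddfD.
move=> [X1 [X2 [X1s X2s ->]]] [Y1 [Y2 [Y1s Y2s ->]]].
exists (X1 + Y1), (X2 + Y2); split; [exact: IH|exact: IH|].
by rewrite mulrDr addrACA.
Qed.

Lemma span_scale s a X : O a -> ascending_span s X -> ascending_span s (a *: X).
Proof.
move=> Oa; elim: s X => [|u s IH] X /=.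
  by move=> [x Ox ->]; exists (a * x); [exact: OM|rewrite scale_scalar_mx].
move=> [X1 [X2 [X1s X2s ->]]]; exists (a *: X1), (a *: X2).
by split; [exact: IH|exact: IH|rewrite scalerDr scalerAr].
Qed.

Lemma span_zero s : ascending_span s 0.
Proof.
elim: s => [|u s IH] /=; first by exists 0; [exact: O_zero|rewrite raddf0].
by exists 0, 0; split=> //; rewrite mulr0 addr0.
Qed.

Lemma span_one s : ascending_span s 1.
Proof.
elim: s => [|u s IH] /=; first by exists 1.
by exists 1, 0; split=> //; [exact: span_zero|rewrite mulr0 addr0].
Qed.

Lemma span_opp s X : ascending_span s X -> ascending_span s (- X).
Proof.
by move=> sX; rewrite -scaleN1r; apply: span_scale => //; apply: O_opp.
Qed.

(* The relations u u = tr(u) u - 1 and v u = tr(v) u + tr(u) v + ... - u v    *)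
(* sort any word into ascending order.                                        *)
Lemma span_mul s : {in s, forall u, \det u = 1 /\ O (\tr u)} ->
  (forall u v, subseq [:: u; v] s -> O (\tr (u * v))) ->
  forall u X, u \in s -> ascending_span s X -> ascending_span s (u * X).
Proof.
elim: s => [//|a s IH] s1 s2 u X us [Y [W [Ys Ws ->]]].
have [da Oa] := s1 _ (mem_head _ _).
have [->|ua] := eqVneq u a.
  exists (- W), (Y + \tr a *: W); split.
  - exact: span_opp.
  - by apply: span_add => //; exact: span_scale.
  - rewrite mulrDr mulrA mul2_sqr da mulrBl mulrDr -scalerAl -scalerAr mul1r.
    by rewrite addrA addrC.
have {ua}us : u \in s by move: us; rewrite inE (negbTE ua).
have [du Ou] := s1 u (mem_behead (s := a :: s) us).
have Oau : O (\tr (a * u)) by apply: s2; rewrite /= eqxx sub1seq.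
have sM Z : ascending_span s Z -> ascending_span s (u * Z).
  apply: IH => // [v vs|v w vw]; first exact: s1 _ (mem_behead (s := a :: s) vs).
  by apply: s2; apply: subseq_trans vw _; exact: subseq_cons.
exists (u * Y + \tr a *: (u * W) + (\tr (a * u) - \tr a * \tr u) *: W),
  (\tr u *: W - u * W); split.
- apply: span_add.
    by apply: span_add; [exact: sM|apply: span_scale => //; exact: sM].
  by apply: span_scale => //; apply: OB => //; exact: OM.
- by apply: span_add; [exact: span_scale|apply/span_opp/sM].
- have -> : u * (Y + a * W) = u * Y + (u * a) * W by rewrite mulrDr mulrA.
  rewrite (mul2_comm a u) mulrBl mulrDl mulrDl -!scalerAl mulrBr -scalerAr.
  rewrite scalar_mul2 -mulrA.
  move: (u * Y) (a * W) (u * W) (a * (u * W)) => X1 X2 X3 X4.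
  by apply: mx2P; rewrite !mxE; ring.
Qed.

(** [P] gathers the left factors split off during the induction on [s]. *)
Lemma span_trace s P X :
  (forall t, subseq t s -> O (\tr (P * \prod_(u <- t) u))) ->
  ascending_span s X -> O (\tr (P * X)).
Proof.
elim: s P X => [|a s IH] P X sP /=.
  move=> [x Ox ->]; rewrite mul2_scalar linearZ; apply: OM => //.
  by have := sP _ (sub0seq _); rewrite big_nil mulr1.
move=> [Y [W [Ys Ws ->]]]; rewrite mulrDr raddfD mulrA; apply: O_add.
  apply: IH Ys => t ts; apply: sP; apply: subseq_trans ts _.
  exact: subseq_cons.
apply: IH Ws => t ts; have := sP (a :: t); rewrite big_cons mulrA; apply.
by rewrite /= eqxx.
Qed.

Lemma word_trace s : {in s, forall u, \det u = 1} ->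
  (forall t, subseq t s -> O (\tr (\prod_(u <- t) u))) ->
  forall X, word s X -> O (\tr X).
Proof.
move=> d1 sO X wX; rewrite -[X]mul1r; apply: (@span_trace s).
  by move=> t ts; rewrite mul1r; exact: sO.
elim: wX => [|u Y us _ IH]; first exact: span_one.
apply: span_mul => // [v vs|v w vw].
  split; first exact: d1.
  by have := sO [:: v]; rewrite big_seq1 sub1seq; exact.
by have := sO _ vw; rewrite big_cons big_seq1.
Qed.

End trace_ring.

End words.

(* Schur orthogonality for a finite nonabelian group of matrices of           *)
(* determinant 1, enumerated by ks.                                           *)
Section finite_group.
Variable F : numFieldType.
Local Notation M2 := 'M[F]_2.
Variables (ks : seq M2) (A B : M2).
Hypotheses (ks_uniq : uniq ks) (ks_det : {in ks, forall k, \det k = 1}).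
Hypotheses (Aks : A \in ks) (Bks : B \in ks) (nAB : A * B <> B * A).
Hypothesis ksM : {in ks &, forall k l, k * l \in ks}.

Lemma sum_left_mul (V : nmodType) (f : M2 -> V) k : k \in ks ->
  \sum_(l <- ks) f (k * l) = \sum_(l <- ks) f l.
Proof.
move=> kks; have kV : adj2 k * k = 1 by rewrite adj2_mul ks_det.
have umap : uniq [seq k * l | l <- ks].
  rewrite map_inj_uniq// => l m e.
  by rewrite -[l]mul1r -kV -mulrA e mulrA kV mul1r.
rewrite -(big_map (fun l => k * l) xpredT f).
apply: perm_big; apply: uniq_perm => //.
have sub : {subset [seq k * l | l <- ks] <= ks}.
  by move=> _ /mapP[m mks ->]; exact: ksM.
have sz : (size ks <= size [seq (k * l)%R | l <- ks])%N by rewrite size_map.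
exact: (uniq_min_size umap sub sz).2.
Qed.

(** The sum over the group commutes with [A] and [B], so it is scalar by [commutant2] and determined
    by its trace; the 2 is the trace of the identity. *)
Lemma schur_scalar (X : M2) :
  2 *: (\sum_(k <- ks) k * X * adj2 k) = ((size ks)%:R * \tr X)%:M.
Proof.
set S := \sum_(k <- ks) _.
have comS k : k \in ks -> k * S = S * k.
  move=> kks; have kSk : k * S * adj2 k = S.
    rewrite /S mulr_sumr mulr_suml.
    rewrite -[RHS](sum_left_mul (fun l => l * X * adj2 l) kks).
    by apply: eq_bigr => l _; rewrite adj2M !mulrA.
  by rewrite -{2}kSk -!mulrA adj2_mul ks_det// mulr1.
have SE := commutant2 nAB (comS _ Aks) (comS _ Bks).
have trS : \tr S = (size ks)%:R * \tr X.
  rewrite /S raddf_sum /= big_seq (eq_bigr (fun=> \tr X)).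
    by rewrite -big_seq big_const_seq count_predT iter_addr_0 mulr_natl.
  move=> k kks; rewrite -mulmxE mxtrace_mulC mulmxE mulrA adj2_mul ks_det//.
  by rewrite mul1r.
rewrite -trS SE scale_scalar_mx; congr (_%:M).
by rewrite tr2E !scal2E /=; ring.
Qed.

Lemma schur_expansion (h : M2) :
  2 *: (\sum_(k <- ks) \tr (h * adj2 k) *: k) = (size ks)%:R *: h.
Proof.
(* Taking matrix units for [X] gives the orthogonality relations between entries. *)
have E p i j q : 2 * (\sum_(k <- ks) k p i * adj2 k j q) =
    (size ks)%:R * ((i == j)%:R * (p == q)%:R).
  have /matrixP/(_ p q) := schur_scalar (delta_mx i j).
  rewrite !mxE summxE.
  rewrite (eq_bigr (fun k : M2 => k p i * adj2 k j q)); last first.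
    by move=> k _; exact: mul2_delta.
  move=> ->; rewrite tr2E !mxE.
  by case: (ord2 i) => ->; case: (ord2 j) => ->; case: (p == q); rewrite /=; ring.
apply/matrixP => p i; rewrite !mxE summxE.
transitivity (h 0 0 * (2 * (\sum_(k <- ks) k p i * adj2 k 0 0)) +
  h 0 1 * (2 * (\sum_(k <- ks) k p i * adj2 k 1 0)) +
  h 1 0 * (2 * (\sum_(k <- ks) k p i * adj2 k 0 1)) +
  h 1 1 * (2 * (\sum_(k <- ks) k p i * adj2 k 1 1))).
  rewrite !mulr_sumr -!big_split /=; apply: eq_bigr => k _.
  by rewrite mxE tr2E !mul2E; ring.
rewrite !E; case: (ord2 p) => ->; case: (ord2 i) => ->; rewrite /=; ring.
Qed.

(** Multiply [schur_expansion] by the inverse [adj2 h] and take traces. *)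
Lemma schur_norm (h : M2) : \det h = 1 ->
  \sum_(k <- ks) \tr (h * adj2 k) ^+ 2 = (size ks)%:R.
Proof.
move=> dh; have two0 : 2 != 0 :> F by rewrite pnatr_eq0.
apply: (mulfI two0).
have /(congr1 (fun X => \tr (X * adj2 h))) := schur_expansion h.
rewrite -!scalerAl mul_adj2 dh !linearZ /= mulr_suml raddf_sum /=.
rewrite (eq_bigr (fun k => \tr (h * adj2 k) ^+ 2)) => [->|k _].
  by rewrite tr2E !scal2E /=; ring.
by rewrite -scalerAl linearZ /= expr2 tr_mul_adj2C [in X in _ * X]tr_mul_adj2C.
Qed.

End finite_group.

(** * Finiteness in determinant one, with noncommuting generators *)

Section finiteness.
Variable C : numClosedFieldType.
Hypothesis arch : forall x : C, exists n : nat, `|x| <= n%:R.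
Local Notation M2 := 'M[C]_2.

Lemma finite_combinations (Z : set C) (ks : seq M2) : finite_set Z ->
  finite_set [set X : M2 | exists t : M2 -> C,
    {in ks, forall k, Z (t k)} /\ X = \sum_(k <- ks) t k *: k].
Proof.
move=> Zf; elim: ks => [|k ks IH].
  apply: (@sub_finite_set _ _ [set 0]) => // X [t [_ ->]].
  by rewrite big_nil.
apply: (@sub_finite_set _ _ [set x *: k + Y | x in Z & Y in
  [set X : M2 | exists t : M2 -> C,
    {in ks, forall k, Z (t k)} /\ X = \sum_(k <- ks) t k *: k]]); last first.
  exact: finite_image2.
move=> X [t [tZ ->]]; rewrite big_cons.
exists (t k); first by apply: tZ; rewrite mem_head.
exists (\sum_(k <- ks) t k *: k) => //.
by exists t; split=> // l lks; apply: tZ; rewrite inE lks orbT.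
Qed.

Section fixed_order.
Variables (N : nat) (z : C).
Hypotheses (N_gt0 : (0 < N)%N) (z_prim : N.-primitive_root z).
Local Notation ev := (@poly_int_eval C).
Let zN : z ^+ N = 1 := prim_expr_order z_prim.

(* Z[z] intersected with the reals: its elements remain real under all        *)
(* conjugations.                                                              *)
Definition real_cyclotomic (x : C) : Prop :=
  exists2 P : {poly int}, x = ev P z & ev P z^-1 = ev P z.

Lemma unity_inv (r : C) : r ^+ N = 1 -> r ^+ N.-1 = r^-1.
Proof.
move=> rN; have r0 : r != 0.
  by apply: contra_eq_neq rN => ->; rewrite expr0n eqn0Ngt N_gt0 eq_sym oner_eq0.
by apply: (mulfI r0); rewrite -exprS prednK// rN divff.
Qed.

Lemma unity_conj (r : C) : r ^+ N = 1 -> r^* = r^-1.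
Proof.
move=> rN; have r1 : `|r| = 1.
  by apply/eqP; rewrite -(@pexpr_eq1 _ _ N)// -normrX rN normr1.
by rewrite invC_norm r1 expr1n invr1 mul1r.
Qed.

Lemma real_cyclotomic1 : real_cyclotomic 1.
Proof.
by exists 1; rewrite /poly_int_eval rmorph1 !hornerE.
Qed.

Lemma real_cyclotomicB x y :
  real_cyclotomic x -> real_cyclotomic y -> real_cyclotomic (x - y).
Proof.
move=> [P -> Ps] [Q -> Qs]; exists (P - Q).
  by rewrite /poly_int_eval rmorphB hornerD hornerN.
by move: Ps Qs; rewrite /poly_int_eval rmorphB !hornerD !hornerN => -> ->.
Qed.

Lemma real_cyclotomicM x y :
  real_cyclotomic x -> real_cyclotomic y -> real_cyclotomic (x * y).
Proof.
move=> [P -> Ps] [Q -> Qs]; exists (P * Q).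
  by rewrite /poly_int_eval rmorphM hornerM.
by move: Ps Qs; rewrite /poly_int_eval rmorphM !hornerM => -> ->.
Qed.

(** With z^(N-1) for the inverse of [z], invariance under inversion is an integer polynomial
    relation, so it passes to [r]; and the inverse of [r] is its complex conjugate. *)
Lemma conj_root_real (P : {poly int}) (r : C) : conj_root N z r ->
  ev P z^-1 = ev P z -> ev P r \is Num.real.
Proof.
move=> [rN rP] Ps; rewrite CrealE /poly_int_eval -horner_map /= -map_poly_comp.
rewrite (eq_map_poly (g := intr)); last by move=> i /=; rewrite rmorph_int.
apply/eqP; rewrite -[RHS]/(ev P r) unity_conj// -[LHS]/(ev P r^-1).
have evX s : s ^+ N = 1 -> ev (P \Po 'X^(N.-1)) s = ev P s^-1.
  move=> sN; rewrite /poly_int_eval map_comp_poly map_polyXn horner_comp.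
  by rewrite hornerXn unity_inv.
have /rP : ev (P \Po 'X^(N.-1) - P) z = 0.
  have := evX z zN; rewrite /poly_int_eval rmorphB hornerD hornerN => ->.
  by apply/eqP; rewrite subr_eq0; apply/eqP.
have := evX r rN; rewrite /poly_int_eval rmorphB hornerD hornerN => ->.
by move/eqP; rewrite subr_eq0 => /eqP.
Qed.

(** An eigenvalue is an N-th root of unity, hence a power of [z]; determinant 1 makes the trace the
    sum of it and its inverse. *)
Lemma trace_real_cyclotomic (A : M2) : \det A = 1 -> A ^+ N = 1 ->
  real_cyclotomic (\tr A).
Proof.
move=> dA AN.
have [x xA] : exists x, root (char_poly A) x.
  by apply/closed_rootP; rewrite size_char_poly.
have /eigenvalueP[v vA v0] : eigenvalue A x by rewrite eigenvalue_root_char.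
have vAk k : v *m A ^+ k = x ^+ k *: v.
  elim: k => [|k IH]; first by rewrite !expr0 mulmx1 scale1r.
  by rewrite exprS -mulmxE mulmxA vA -scalemxAl IH scalerA -exprS.
have xN : x ^+ N = 1.
  have := vAk N; rewrite AN mulmx1 -{1}[v]scale1r => /eqP.
  rewrite -subr_eq0 -scalerBl scaler_eq0 (negbTE v0) orbF subr_eq0.
  by rewrite eq_sym => /eqP.
have x0 : x != 0.
  by apply: contra_eq_neq xN => ->; rewrite expr0n eqn0Ngt N_gt0 eq_sym oner_eq0.
have trA : \tr A = x + x^-1.
  have h : x * \tr A = x ^+ 2 + 1.
    have e : x ^+ 2 *: v = (x * \tr A) *: v - v.
      rewrite -vAk expr2 mul2_sqr dA mulmxBr -scalemxAr vA mulmx1 scalerA.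
      by rewrite mulrC.
    have : (x ^+ 2 - (x * \tr A - 1)) *: v = 0.
      by rewrite scalerBl e scalerBl scale1r subrr.
    move/eqP; rewrite scaler_eq0 (negbTE v0) orbF subr_eq0 => /eqP ->.
    by rewrite subrK.
  by apply: (mulfI x0); rewrite h mulrDr divff// -expr2.
have [i xE] := prim_rootP z_prim xN.
have ziN : (z ^+ i) ^+ N = 1 by rewrite -xE.
exists ('X^i + 'X^(i * N.-1)).
  rewrite /poly_int_eval rmorphD /= !map_polyXn hornerD !hornerXn.
  by rewrite trA xE exprM unity_inv.
rewrite /poly_int_eval rmorphD /= !map_polyXn !hornerD !hornerXn.
rewrite !exprM exprVn [X in _ + X = _](_ : _ = z ^+ i).
  by rewrite addrC unity_inv.
by rewrite exprVn unity_inv// invrK.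
Qed.

Lemma finite_words_noncomm (s : seq M2) (a b : M2) (Z : set M2) :
  {in s, forall u, \det u = 1} ->
  (forall t, subseq t s -> (\prod_(u <- t) u) ^+ N = 1) ->
  a \in s -> b \in s -> a * b <> b * a ->
  finite_set Z -> Z 1 -> (forall X Y, Z X -> Z Y -> Z (X * Y)) -> Z a -> Z b ->
  finite_set (word s).
Proof.
move=> sdet sN as_ bs nab Zf Z1 ZM Za Zb.
have det_prod t : subseq t s -> \det (\prod_(u <- t) u) = 1.
  move=> ts; apply: (word_det sdet); elim: t ts => [|u t IH] ts.
    by rewrite big_nil; exact: word1.
  rewrite big_cons; apply: wordM; first by apply: (mem_subseq ts); rewrite mem_head.
  by apply: IH; apply: subseq_trans ts; exact: subseq_cons.
have trO X : word s X -> real_cyclotomic (\tr X).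
  apply: word_trace => //.
  - exact: real_cyclotomic1.
  - exact: real_cyclotomicB.
  - exact: real_cyclotomicM.
  - by move=> t ts; apply: trace_real_cyclotomic; [exact: det_prod|exact: sN].
have wZ X : word [:: a; b] X -> Z X.
  elim=> [//|u Y]; rewrite !inE => /orP[]/eqP -> _; exact: ZM.
have /finite_seqP[ks0 ks0E] : finite_set (word [:: a; b]).
  exact: sub_finite_set Zf.
pose ks := undup ks0.
have ksE k : k \in ks <-> word [:: a; b] k by rewrite mem_undup ks0E.
have ks_word k : k \in ks -> word s k.
  by move/ksE; apply: word_sub => u; rewrite !inE => /orP[]/eqP ->.
have ks_uniq : uniq ks by exact: undup_uniq.
have ks_det : {in ks, forall k, \det k = 1}.
  by move=> k /ks_word; exact: word_det.
have aks : a \in ks by apply/ksE/word_mem; rewrite inE eqxx.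
have bks : b \in ks by apply/ksE/word_mem; rewrite !inE eqxx orbT.
have ksM : {in ks &, forall k l, k * l \in ks}.
  by move=> k l /ksE kw /ksE lw; apply/ksE; exact: word_mul.
have n0 : (0 < size ks)%N by case: (ks) aks.
pose n := size ks.
pose V := [set v : C | exists2 P : {poly int}, v = ev P z &
    forall r, conj_root N z r -> `|ev P r| <= n%:R].
have Vf : finite_set V by exact: finite_bounded_conj.
have wV h k : word s h -> k \in ks -> V (\tr (h * adj2 k)).
  move=> hw kks.
  have Ot l : l \in ks -> real_cyclotomic (\tr (h * adj2 l)).
    move=> lks; rewrite tr_mul_adj2; apply: real_cyclotomicB.
      by apply: real_cyclotomicM; apply: trO => //; exact: ks_word.
    by apply: trO; apply: word_mul => //; exact: ks_word.
  (* Polynomials are fixed for all group elements at once, because the norm identity involves all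
     these traces together. *)
  have [Pf PfE] : exists Pf : M2 -> {poly int}, forall l, l \in ks ->
      \tr (h * adj2 l) = ev (Pf l) z /\ ev (Pf l) z^-1 = ev (Pf l) z.
    have ex l : exists P : {poly int}, l \in ks ->
        \tr (h * adj2 l) = ev P z /\ ev P z^-1 = ev P z.
      have [lks|nl] := pselect (l \in ks); last by exists 0.
      by have [P ? ?] := Ot _ lks; exists P.
    by exists (fun l => projT1 (cid (ex l))) => l; exact: (projT2 (cid (ex l))).
  exists (Pf k); first by have [] := PfE _ kks.
  move=> r rconj.
  (* [schur_norm] is an integer polynomial relation in [z], so it persists at the conjugate [r]. *)
  have sumr : \sum_(l <- ks) ev (Pf l) r ^+ 2 = n%:R.
    have evS s' : ev (\sum_(l <- ks) Pf l ^+ 2 - n%:R) s' =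
        \sum_(l <- ks) ev (Pf l) s' ^+ 2 - n%:R.
      rewrite /poly_int_eval rmorphB rmorph_sum /= hornerD hornerN horner_sum.
      rewrite rmorph_nat hornerMn hornerC; congr (_ - _).
      by apply: eq_bigr => l _; rewrite rmorphXn /= horner_exp.
    apply/eqP; rewrite -subr_eq0 -evS; apply/eqP; apply: rconj.2; rewrite evS.
    apply/eqP; rewrite subr_eq0; apply/eqP.
    rewrite -(schur_norm ks_uniq ks_det aks bks nab ksM (word_det sdet hw)).
    rewrite big_seq [RHS]big_seq; apply: eq_bigr => l lks.
    by rewrite (PfE _ lks).1.
  have realP l : l \in ks -> ev (Pf l) r \is Num.real.
    by move=> lks; apply: conj_root_real => //; rewrite (PfE _ lks).2.
  (* All summands are squares of reals, so each is at most their sum n, and n <= n^2. *)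
  have sq_le : `|ev (Pf k) r| ^+ 2 <= n%:R ^+ 2.
    apply: (@le_trans _ _ n%:R); last first.
      by rewrite -natrX ler_nat -mulnn leq_pmulr.
    rewrite real_normK ?realP// -sumr (big_rem k)//= lerDl.
    rewrite big_seq sumr_ge0// => l /mem_rem lks.
    by rewrite -realEsqr realP.
  by rewrite -(@ler_pXn2r _ 2) ?nnegrE ?ler0n.
apply: (@sub_finite_set _ _ [set (2 / n%:R) *: X | X in
  [set X : M2 | exists t : M2 -> C,
    {in ks, forall k, V (t k)} /\ X = \sum_(k <- ks) t k *: k]]); last first.
  by apply: finite_image; exact: finite_combinations.
move=> h hw; exists (\sum_(k <- ks) \tr (h * adj2 k) *: k).
  by exists (fun k => \tr (h * adj2 k)); split=> // k kks; exact: wV.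
have nn0 : n%:R != 0 :> C by rewrite pnatr_eq0 -lt0n.
rewrite mulrC -scalerA (schur_expansion ks_uniq ks_det aks bks nab ksM).
by rewrite scalerA mulVf// scale1r.
Qed.

End fixed_order.
End finiteness.

Lemma finite_monoid_order (R : unitRingType) (Z : set R) (x : R) :
  finite_set Z -> Z 1 -> (forall a b, Z a -> Z b -> Z (a * b)) -> Z x ->
  x \is a GRing.unit -> exists2 n, (0 < n)%N & x ^+ n = 1.
Proof.
move=> /finite_seqP[s ->] Z1 ZM Zx ux.
have Zexp k : x ^+ k \in s.
  by elim: k => [|k IH]; [exact: Z1|rewrite exprS; exact: ZM].
pose w := [seq x ^+ k | k <- iota 0 (size s).+1].
have : ~~ uniq w.
  apply/negP => uw; have := @uniq_leq_size _ _ s uw.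
  rewrite size_map size_iota ltnn => h; apply: notF; apply: h.
  by move=> _ /mapP[k _ ->].
move=> /(uniqPn 0)[i [j [ij]]]; rewrite size_map size_iota => js.
rewrite !(nth_map 0%N) ?size_iota// ?(ltn_trans ij)//.
rewrite !nth_iota ?(ltn_trans ij)// !add0n => e.
exists (j - i)%N; first by rewrite subn_gt0.
apply: (@mulrI _ (x ^+ i)); first by rewrite unitrX.
by rewrite -exprD subnKC ?(ltnW ij)// mulr1.
Qed.

Lemma common_order (R : pzRingType) (L : seq R) :
  {in L, forall x, exists2 n, (0 < n)%N & x ^+ n = 1} ->
  exists2 n, (0 < n)%N & {in L, forall x, x ^+ n = 1}.
Proof.
elim: L => [|x L IH] H; first by exists 1%N.
have [|n n0 nL] := IH; first by move=> y yL; apply: H; rewrite inE yL orbT.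
have [m m0 mx] := H x (mem_head _ _).
exists (m * n)%N; first by rewrite muln_gt0 m0.
move=> y; rewrite inE => /orP[/eqP ->|yL]; first by rewrite exprM mx expr1n.
by rewrite mulnC exprM nL// expr1n.
Qed.

Lemma subseq_pair (T : eqType) (s : seq T) (u v : T) : u \in s -> v \in s ->
  [\/ u = v, subseq [:: u; v] s | subseq [:: v; u] s].
Proof.
elim: s => [//|a s IH]; rewrite !inE => /orP[/eqP ua|us] /orP[/eqP va|vs].
- by apply: Or31; rewrite ua va.
- by apply: Or32; rewrite ua /= eqxx sub1seq.
- by apply: Or33; rewrite va /= eqxx sub1seq.
- have [->|h|h] := IH us vs; first exact: Or31.
    by apply: Or32; apply: subseq_trans h _; exact: subseq_cons.
  by apply: Or33; apply: subseq_trans h _; exact: subseq_cons.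
Qed.

Lemma subseq_map_inv (T T' : eqType) (f : T -> T') (s : seq T) (t : seq T') :
  subseq t (map f s) -> exists2 t', subseq t' s & t = map f t'.
Proof.
move=> /subseqP[m _ ->]; exists (mask m s); first exact: mask_subseq.
by rewrite map_mask.
Qed.

Lemma finite_words_comm (F : fieldType) (s : seq 'M[F]_2) (N : nat) :
  (0 < N)%N -> {in s, forall u, u ^+ N = 1} ->
  {in s &, forall u v, u * v = v * u} -> finite_set (word s).
Proof.
move=> N0; elim: s => [|a s IH] sN sC.
  apply: (@sub_finite_set _ _ [set 1]) => // X.
  by elim=> [//|u Y].
have sub_s u : u \in s -> u \in a :: s by move=> us; rewrite inE us orbT.
have {}IH : finite_set (word s).
  by apply: IH => [u /sub_s /sN|u v /sub_s us /sub_s vs]; last exact: sC.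
(* Commutation collects the powers of [a] in front, and exponents matter only modulo [N]. *)
apply: (@sub_finite_set _ _ [set A * X | A in [set a ^+ i | i in `I_N] &
  X in word s]); last by apply: finite_image2 => //; apply: finite_image.
move=> X wX; suff [i [Y [wY ->]]] : exists i Y, word s Y /\ X = a ^+ i * Y.
  exists (a ^+ (i %% N)); first by exists (i %% N)%N => //=; rewrite ltn_mod.
  exists Y => //; rewrite [in RHS](divn_eq i N) exprD mulnC exprM.
  by rewrite sN ?mem_head// expr1n mul1r.
elim: wX => [|u Y us _ [i [W [wW ->]]]].
  by exists 0%N, 1; split; [exact: word1|rewrite mulr1].
move: us; rewrite inE => /orP[/eqP ->|us].
  by exists i.+1, W; rewrite mulrA exprS.
exists i, (u * W); split; first exact: wordM.
have ua : GRing.comm u a by apply: sC; rewrite ?mem_head ?sub_s.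
by rewrite !mulrA (commrX i ua).
Qed.

(** * Reduction to determinant one *)

Section finite_matrix_group.
Variable C : numClosedFieldType.
Hypothesis arch : forall x : C, exists n : nat, `|x| <= n%:R.
Local Notation M2 := 'M[C]_2.

Lemma finite_scaled (N : nat) (z : C) (Z : set M2) : N.-primitive_root z ->
  finite_set Z -> finite_set [set x *: X | x in [set x | x ^+ N = 1] & X in Z].
Proof.
move=> zP Zf; apply: finite_image2 => //.
apply: (@sub_finite_set _ _ (range (fun i : 'I_N => z ^+ i))).
  by move=> x /(prim_rootP zP)[i ->]; exists i.
exact: finite_image.
Qed.

(** Dividing the generators by square roots of their determinants changes words by roots of unity of
    bounded order only. In determinant 1, either all generators commute or two of them generate a
    finite nonabelian group. *)
Lemma finite_words (s : seq M2) : {in s, forall u, u \in unitmx} ->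
  (forall t, subseq t s -> exists2 n, (0 < n)%N & (\prod_(u <- t) u) ^+ n = 1) ->
  (forall u v, subseq [:: u; v] s -> exists Z : set M2, [/\ finite_set Z, Z 1,
    forall X Y, Z X -> Z Y -> Z (X * Y), Z u & Z v]) ->
  finite_set (word s).
Proof.
move=> sU s_ord s_pair.
(* A common exponent exists since [s] has finitely many subsequences, indexed by masks. *)
have [M M0 MP] : exists2 M, (0 < M)%N &
    forall t, subseq t s -> (\prod_(u <- t) u) ^+ M = 1.
  have [|M M0 MP] := @common_order _
    [seq \prod_(u <- mask (m : (size s).-tuple bool) s) u |
      m <- enum {: (size s).-tuple bool}].
    by move=> _ /mapP[m _ ->]; apply/s_ord/mask_subseq.
  exists M => // _ /subseqP[m ms ->]; apply: MP.
  have mt : size m == size s by rewrite ms.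
  by apply/mapP; exists (Tuple mt) => //; rewrite mem_enum.
(* Determinants of generators are M-th roots of unity, so their square roots are 2M-th ones. *)
pose N := (2 * M)%N.
have N0 : (0 < N)%N by rewrite muln_gt0.
have [z zP] := prim_root_exists C N0.
pose c u : C := sqrtC (\det (u : M2)).
pose f u : M2 := (c u)^-1 *: u.
have c2 u : c u ^+ 2 = \det u by exact: sqrtCK.
have cN u : u \in s -> c u ^+ N = 1.
  move=> us; have := MP [:: u]; rewrite sub1seq us big_seq1 => /(_ isT) uM.
  rewrite exprM c2; have := congr1 determinant uM; rewrite det1 => <-.
  by elim: (M) => [|k IH]; rewrite ?expr0 ?det1// !exprS -mulmxE det_mulmx IH.
have c0 u : u \in s -> c u != 0.
  move=> /sU; rewrite unitmxE unitfE -c2; apply: contraNneq => ->.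
  by rewrite expr0n.
have fK u : u \in s -> u = c u *: f u.
  by move=> us; rewrite /f scalerA divff ?c0// scale1r.
have fdet u : u \in s -> \det (f u) = 1.
  by move=> us; rewrite /f detZ -c2 exprVn mulVf// expf_neq0// c0.
have VN x : x ^+ N = 1 -> x^-1 ^+ N = 1 by rewrite exprVn => ->; rewrite invr1.
have f_prod t : subseq t s -> exists2 x, x ^+ N = 1 &
    \prod_(u <- map f t) u = x *: \prod_(u <- t) u.
  elim: t => [|u t IH] ts.
    by exists 1; rewrite ?expr1n// !big_nil scale1r.
  have [|x xN xE] := IH; first by apply: subseq_trans ts; exact: subseq_cons.
  have us : u \in s by apply: (mem_subseq ts); rewrite mem_head.
  exists ((c u)^-1 * x); first by rewrite exprMn xN mulr1 VN// cN.
  by rewrite /= !big_cons xE /f -scalerAl -scalerAr scalerA.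
have f_ord t : subseq t (map f s) -> (\prod_(u <- t) u) ^+ N = 1.
  move=> /subseq_map_inv[t' ts ->]; have [x xN ->] := f_prod _ ts.
  by rewrite exprZn xN scale1r /N mulnC exprM MP// expr1n.
have f_det : {in map f s, forall u, \det u = 1}.
  by move=> _ /mapP[u us ->]; exact: fdet.
have f_fin : finite_set (word (map f s)).
  have [[u [v [us vs uv]]]|nab] := pselect (exists u v,
      [/\ u \in s, v \in s & f u * f v <> f v * f u]); last first.
    apply: (finite_words_comm N0).
      move=> u us; have := f_ord [:: u]; rewrite big_seq1; apply.
      by rewrite sub1seq.
    move=> _ _ /mapP[u us ->] /mapP[v vs ->]; apply: contrapT => uv.
    by apply: nab; exists u, v.
  have [Z [Zf Z1 ZM Zu Zv]] : exists Z : set M2, [/\ finite_set Z, Z 1,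
      forall X Y, Z X -> Z Y -> Z (X * Y), Z u & Z v].
    have [uv'|uv'|uv'] := subseq_pair us vs.
    - by case: uv; rewrite uv'.
    - exact: s_pair.
    - by have [Z [? ? ? ? ?]] := s_pair _ _ uv'; exists Z.
  pose Z' := [set x *: X | x in [set x | x ^+ N = 1] & X in Z].
  apply: (@finite_words_noncomm C arch N z N0 zP _ (f u) (f v) Z').
  - exact: f_det.
  - exact: f_ord.
  - exact: map_f.
  - exact: map_f.
  - exact: uv.
  - exact: (finite_scaled zP Zf).
  - by exists 1; rewrite /= ?expr1n//; exists 1 => //; rewrite scale1r.
  - move=> _ _ [x xN [X ZX <-]] [y yN [Y ZY <-]].
    exists (x * y); first by rewrite /= exprMn xN yN mulr1.
    by exists (X * Y); [exact: ZM|rewrite -scalerAl -scalerAr scalerA].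
  - by exists (c u)^-1; [exact/VN/cN|exists u].
  - by exists (c v)^-1; [exact/VN/cN|exists v].
apply: (@sub_finite_set _ _
  [set x *: X | x in [set x | x ^+ N = 1] & X in word (map f s)]); last first.
  exact: (finite_scaled zP f_fin).
move=> X; elim=> [|u Y us _ [x xN [W wW <-]]].
  by exists 1; rewrite /= ?expr1n//; exists 1; [exact: word1|rewrite scale1r].
exists (c u * x); first by rewrite /= exprMn xN cN// mulr1.
exists (f u * W); first by apply: wordM => //; exact: map_f.
by rewrite [in RHS](fK _ us); move: (f u) => v; rewrite -scalerAl -scalerAr scalerA.
Qed.

End finite_matrix_group.

Lemma complex_archimedean (R : realType) (x : R[i]) :
  exists n : nat, `|x| <= n%:R.
Proof.
exists (Num.bound (Num.sqrt (complex.Re x ^+ 2 + complex.Im x ^+ 2))).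
rewrite normc_def -(rmorph_nat (real_complex R)) lecR.
exact/ltW/archi_boundP/sqrtr_ge0.
Qed.

Theorem theorem1p4 (R : realType) (n : nat) (T : topologicalType)
    (hT : genus0_surface R n T) (x0 : T)
    (rho : pi1 R x0 -> 'M[R[i]]_2)
    (hrho : mx_group_repr rho)
    (hss : semisimple_repr rho)
    (hpants : forall P : set T, pair_of_pants R P ->
      forall (p : P) (a : cpath R x0 (set_val p)),
        finite_set (rho @` pi1_sub_image a)) :
  finite_set (range rho).
Proof.
have [rho1 rhoM] := hrho.
have [gs [g [gs_ord gs_pair gs_gen]]] := surface_group_reduction hT hrho hpants.
have rho_unit := mx_group_repr_unit hrho.
have rho_prod s : rho (gprod s) = \prod_(u <- map rho s) u.
  elim: s => [|u s IH]; first by rewrite big_nil rho1.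
  by rewrite /= big_cons rhoM IH.
have wf : finite_set (word (map rho gs)).
  apply: (finite_words (@complex_archimedean R)).
  - by move=> _ /mapP[u _ ->].
  - move=> _ /subseq_map_inv[t ts ->]; rewrite -rho_prod.
    have [Z [Zf Z1 ZM Zt _]] := gs_ord _ ts.
    exact: (finite_monoid_order Zf Z1 ZM Zt (rho_unit _)).
  - move=> u v /subseq_map_inv[[|a [|b [|? ?]]] // ab [-> ->]].
    exact: gs_pair.
(* Generation holds up to conjugation by [g], which is undone here. *)
apply: (@sub_finite_set _ _ [set rho g^-1%g *m X *m rho g |
  X in word (map rho gs)]); last exact: finite_image.
move=> _ [a _ <-]; exists (rho (g * a * g^-1)%g); last first.
  by rewrite -!rhoM !mulgA mulVg mul1g mulgVK.
apply: gs_gen => //.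
- exact: word1.
- by move=> X Y; exact: word_mul.
- by move=> u us; apply: word_mem; exact: map_f.
Qed.
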